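(* Let $\Omega=(a,b)$ be a finite interval, $0<\alpha<1$ and $1\le p<\infty$. Assume that $\alpha p<1$ and $\mu\in\mathbb{R}$ satisfies $\mu>p(1-\alpha p)^{-1}$. Then, for each choice of sign $\pm$ and for every bounded domain $\Omega'\supset\supset\Omega$, there exist a mapping $E_{\pm}:{}^{\pm}W^{\alpha,p}(\Omega)\cap L^{\mu}(\Omega)\to{}^{\pm}W^{\alpha,p}(\mathbb{R})$ and a constant $C=C(\alpha,p,\Omega')>0$ such that for any $u\in{}^{\pm}W^{\alpha,p}(\Omega)\cap L^{\mu}(\Omega)$: (i) $E_{\pm}u=u$ a.e. in $\Omega$; (ii) $\operatorname{supp}(E_{\pm}u)\subset\subset\Omega'$; (iii) $\|E_{\pm}u\|_{{}^{\pm}W^{\alpha,p}(\mathbb{R})}\le C\big(\|u\|_{{}^{\pm}W^{\alpha,p}(\Omega)}+\|u\|_{L^{\mu}(\Omega)}\big)$.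
   Context: Let $\Omega$ be $(a,b)$ or $\mathbb{R}$; put $a^*=a,b^*=b$ in the first case and $a^*=-\infty,b^*=\infty$ in the second. For $\sigma>0$: ${}^{-}I^{\sigma}f(x)=\frac{1}{\Gamma(\sigma)}\int_{a^*}^x\frac{f(y)}{(x-y)^{1-\sigma}}\,dy$ and ${}^{+}I^{\sigma}f(x)=\frac{1}{\Gamma(\sigma)}\int_x^{b^*}\frac{f(y)}{(y-x)^{1-\sigma}}\,dy$. For $0<\alpha<1$: ${}^{-}D^{\alpha}\varphi=\frac{d}{dx}\,{}^{-}I^{1-\alpha}\varphi$ and ${}^{+}D^{\alpha}\varphi=-\frac{d}{dx}\,{}^{+}I^{1-\alpha}\varphi$. Weak fractional derivatives ($0<\alpha<1$): for $u\in L^p(\Omega)$, $v\in L^1_{loc}(\Omega)$ is the left (resp. right) weak fractional derivative of $u$, written ${}^{-}\mathcal{D}^{\alpha}u=v$ (resp. ${}^{+}\mathcal{D}^{\alpha}u=v$), if $\int_\Omega v\varphi\,dx=\int_\Omega u\,{}^{+}D^{\alpha}\varphi\,dx$ (resp. with ${}^{-}D^{\alpha}\varphi$ on the right-hand side) for all $\varphi\in C_0^\infty(\Omega)$. ${}^{\pm}W^{\alpha,p}(\Omega)=\{u\in L^p(\Omega):{}^{\pm}\mathcal{D}^{\alpha}u\in L^p(\Omega)\}$ with norm $\|u\|_{{}^{\pm}W^{\alpha,p}(\Omega)}=\big(\|u\|_{L^p(\Omega)}^p+\|{}^{\pm}\mathcal{D}^{\alpha}u\|_{L^p(\Omega)}^p\big)^{1/p}$.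 $A\subset\subset B$ (equivalently $B\supset\supset A$) means that the closure of $A$ is a compact subset of $B$. *)

(* Defs.v *)
From mathcomp Require Import all_boot all_order all_algebra.
From mathcomp Require Import all_classical all_reals all_analysis.

Set Implicit Arguments.
Unset Strict Implicit.
Unset Printing Implicit Defensive.

Import Order.TTheory GRing.Theory Num.Theory.
Import numFieldNormedType.Exports.

Local Open Scope classical_set_scope.
Local Open Scope ring_scope.

Inductive side := Left | Right.

Definition opposite (s : side) : side :=
  match s with Left => Right | Right => Left end.

Section Fractional.
Context {R : realType}.
Implicit Types (s : side) (i : interval R) (al sigma x : R) (p : R).

Local Notation leb := (@lebesgue_measure R).

Definition Gamma sigma : R :=
  \int[leb]_(t in `]0, +oo[) (t `^ (sigma - 1) * expR (- t)).

(* The domain Omega is given as an interval i = Interval l r: the bounds l and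
   r play the roles of a^* and b^*, so that i = `]a, b[ and i = `]-oo, +oo[ are
   the two cases of interest. *)
Definition left_int i sigma (f : R -> R) x : R :=
  let: Interval l _ := i in
  (Gamma sigma)^-1 *
    \int[leb]_(y in [set` Interval l (BLeft x)]) (f y / (x - y) `^ (1 - sigma)).

Definition right_int i sigma (f : R -> R) x : R :=
  let: Interval _ r := i in
  (Gamma sigma)^-1 *
    \int[leb]_(y in [set` Interval (BRight x) r]) (f y / (y - x) `^ (1 - sigma)).

Definition frac_deriv s i al (phi : R -> R) x : R :=
  match s with
  | Left => derive1 (left_int i (1 - al) phi) x
  | Right => - derive1 (right_int i (1 - al) phi) x
  end.

Definition compactly_contained (A B : set R) : Prop :=
  compact (closure A) /\ closure A `<=` B.

(* A test function on Omega is identified with its extension by 0. *)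
Definition test_function (Omega : set R) (phi : R -> R) : Prop :=
  (forall n x, derivable (derive1n n phi) x 1) /\
  compactly_contained [set x | phi x != 0] Omega.

(* Functions on Omega are a.e.-equivalence classes of measurable functions on R
   for the restriction of the Lebesgue measure to Omega; the values outside
   Omega are thus irrelevant.  Such a class coerces to one of its members. *)
Definition leb_on i : {measure set (measurableTypeR R) -> \bar R} :=
  mrestr leb (measurable_itv i).

Local Notation fun_on i :=
  {mfun_ (leb_on i), measurableTypeR R >-> measurableTypeR R}.

Definition Lp_norm i p (u : fun_on i) : \bar R :=
  'N[leb_on i]_(p%:E)[EFin \o u].

Definition Lp_space i p : set (fun_on i) :=
  [set u | finite_norm (leb_on i) p%:E u].

Definition is_weak_deriv s i al (u v : fun_on i) : Prop :=
  locally_integrable [set` i] v /\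
  forall phi, test_function [set` i] phi ->
    \int[leb]_(x in [set` i]) (v x * phi x) =
    \int[leb]_(x in [set` i]) (u x * frac_deriv (opposite s) i al phi x).

(* A weak derivative is unique as a class; the value u is used when u has no
   weak derivative. *)
Definition weak_deriv s i al (u : fun_on i) : fun_on i :=
  xget u [set v | is_weak_deriv s al u v].

Definition W_space s i al p : set (fun_on i) :=
  [set u | Lp_space p u /\ exists2 v, is_weak_deriv s al u v & Lp_space p v].

Definition W_norm s i al p (u : fun_on i) : \bar R :=
  ((Lp_norm p u `^ p + Lp_norm p (weak_deriv s al u) `^ p) `^ p^-1)%E.

(* The complement of the largest open set on which u vanishes a.e. *)
Definition ess_supp (u : R -> R) : set R :=
  ~` \bigcup_(U in [set U | open U /\ {ae leb, forall x, U x -> u x = 0}]) U.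

End Fractional.

Arguments Lp_space {R} i p _.
Arguments W_space {R} s i al p _.

Notation fun_on i :=
  {mfun_ (leb_on i), measurableTypeR _ >-> measurableTypeR _}.

(* Main.v *)
Require Import Defs.
From mathcomp Require Import all_boot all_order all_algebra.
From mathcomp Require Import all_classical all_reals all_analysis.
From mathcomp Require Import measurable_realfun.
From mathcomp Require Import ring lra.

Set Implicit Arguments.
Unset Strict Implicit.
Unset Printing Implicit Defensive.

Import Order.TTheory GRing.Theory Num.Theory.
Import numFieldNormedType.Exports.

Local Open Scope classical_set_scope.
Local Open Scope ring_scope.

(** E is the extension by zero.  Translation and reflection reduce both signs to
    functions u, v supported in ]0, L[ and to the kernel K t = t^(-al) for t > 0.
    Put g = 1 / Gamma (1 - al), J y = int u(x) K(x - y) dx and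
    V y = int_(x > y) v.  If v is the weak derivative of u, then g J - V has zero
    derivative in the sense of distributions on ]0, L[, hence is constant there;
    the constant vanishes because u in L^mu with mu (1 - al) > 1 forces
    int_(L - t)^L |u| = o(t^al).  So g J = V on ]0, +oo[.  The values of J on the
    negative half-line are averages of its values on the positive one (balayage),
    which gives g J y = int_(x > y) (v - T v) for all y, where T v, supported in
    ]-oo, 0[, has the positive kernel [kappa], homogeneous of degree -1.
    Therefore v - T v is the weak derivative of the zero extension of u.  Schur's
    test with the weight Z^(-1/p), whose constants are finite because al p < 1,
    bounds T in L^p by a constant that depends only on al and p. *)

(** The condition on the higher exponent excludes a concrete function. On ]0, L[ the function u(x) =
    (L - x)^(al - 1) has constant J, hence weak derivative 0, but the derivative of its zero
    extension has a Dirac mass at L. This u lies in L^q exactly when q (1 - al) < 1, and a nonzero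
    constant in g J - V would be the trace of such a component. The derivative being nonlocal, that
    of the zero extension spills over to ]-oo, 0[, where it must be controlled by v although J is
    given in terms of u. Balayage avoids inverting g J = V: it passes directly from the values of J
    on the positive half-line to those on the negative one, so that V can replace g J before u is
    needed again. The weights are explicit, and integrating them against V produces incomplete Beta
    integrals; differentiating these gives the kernel of T. Even when v vanishes near 0, T v is in
    general of order |y|^(-al) as y tends to 0 from below. This is where al p < 1 enters: it puts
    such a singularity in L^p. *)

(** * Affine changes of variable, and Fubini's theorem for real-valued integrals *)

Section Affine.
Context {R : realType}.
Local Notation mu := (@lebesgue_measure R).

Lemma lebesgue_measureD (c : R) (A : set R) : measurable A ->
  pushforward mu ((fun x => c + x) : _ -> measurableTypeR R) A = mu A.
Proof.
move=> mA; apply/esym/lebesgue_measure_unique => //=; first exact: measurable_funD.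
move=> _ _ [[a b]] _ <-; rewrite /pushforward.
rewrite (_ : _ @^-1` _ = `](a - c), (b - c)]%classic).
  by rewrite !lebesgue_measure_itv/= !lte_fin ltrD2r -!EFinB (_ : b - c - (a - c) = b - a)//; ring.
by apply/seteqP; split=> x /=; rewrite !in_itv/= ltrBlDl lerBrDl.
Qed.

(** [Left] is the reflecting side: a left weak derivative is tested with right derivatives, and
    reflection turns these into left ones, which is the form already met when the side is
    [Right]. *)
Definition sgnside (s : side) : R := match s with Left => -1 | Right => 1 end.

Definition aff (c : R) (s : side) (x : R) : R := c + sgnside s * x.

Lemma measurable_aff c s : measurable_fun setT (aff c s).
Proof.
apply: measurable_funD; first exact: measurable_cst.
by apply: measurable_funM => //; exact: measurable_cst.
Qed.

Lemma affK c s x : sgnside s * (aff c s x - c) = x.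
Proof. by rewrite /aff; case: s => /=; ring. Qed.

Lemma affK' c s x : aff c s (sgnside s * (x - c)) = x.
Proof. by rewrite /aff; case: s => /=; ring. Qed.

Lemma lebesgue_measure_aff c s (A : set R) : measurable A ->
  pushforward mu (aff c s : _ -> measurableTypeR R) A = mu A.
Proof.
move=> mA; rewrite -(lebesgue_measureD c mA).
have mB : measurable ((fun x => c + x) @^-1` A).
  rewrite -[X in measurable X]setTI; apply: measurable_funD => //.
case: s; last by rewrite /pushforward; congr (mu _); apply/seteqP; split=> x /=; rewrite /aff mul1r.
rewrite {2}/pushforward -[RHS]lebesgue_measureN// /pushforward.
by congr (mu _); apply/seteqP; split=> x /=; rewrite /aff mulN1r.
Qed.

Lemma ge0_integral_aff c s (D : set R) (f : R -> \bar R) :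
  measurable D -> measurable_fun D f -> (forall x, 0 <= f x)%E ->
  (\int[mu]_(x in D) f x = \int[mu]_(x in aff c s @^-1` D) f (aff c s x))%E.
Proof.
move=> mD mf f0.
have /= <- := @ge0_integral_pushforward _ _ (measurableTypeR R)
  (measurableTypeR R) R _ (measurable_aff c s) mu D f mD mf (fun x _ => f0 x).
by apply: eq_measure_integral => [|? A mA _];
  [exact: measurable_aff|exact/esym/lebesgue_measure_aff].
Qed.

(** Positive and negative parts are transformed separately, so measurability suffices. *)
Lemma integral_aff c s (D : set R) (f : R -> \bar R) :
  measurable D -> measurable_fun D f ->
  (\int[mu]_(x in D) f x = \int[mu]_(x in aff c s @^-1` D) f (aff c s x))%E.
Proof.
move=> mD mf; rewrite integralE [RHS]integralE; congr (_ - _)%E.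
- rewrite (ge0_integral_aff c s mD (measurable_funepos mf) (funepos_ge0 f)).
  by apply: eq_integral => x _; rewrite !funeposE.
- rewrite (ge0_integral_aff c s mD (measurable_funeneg mf) (funeneg_ge0 f)).
  by apply: eq_integral => x _; rewrite !funenegE.
Qed.

Lemma Rintegral_aff c s (D : set R) (f : R -> R) :
  measurable D -> measurable_fun D f ->
  \int[mu]_(x in D) f x = \int[mu]_(x in aff c s @^-1` D) f (aff c s x).
Proof.
move=> mD mf; rewrite /Rintegral (integral_aff c s)//.
exact/measurable_EFinP.
Qed.

Lemma integrable_aff c s (D : set R) (f : R -> R) : measurable D ->
  mu.-integrable D (EFin \o f) ->
  mu.-integrable (aff c s @^-1` D) (EFin \o (f \o aff c s)).
Proof.
move=> mD /integrableP[mf intf]; apply/integrableP; split.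
  apply/measurable_EFinP; apply: (measurable_comp mD) => //.
    by move=> _ [x Dx <-].
    by move/measurable_EFinP : mf.
  apply: measurable_funTS; exact: measurable_aff.
move: intf; rewrite (ge0_integral_aff c s)//.
by apply: measurableT_comp.
Qed.

Lemma le_abse_fine (e : \bar R) : (`|fine e|%:E <= `|e|)%E.
Proof. by case: e => [r||] //=; rewrite normr0 leey. Qed.

(** The inner integrals are finite only almost everywhere. Where they are infinite [fine] gives 0,
    so the iterated real integrals differ from the extended ones on a null set only. *)
Lemma Rfubini (f : R -> R -> R) :
  measurable_fun setT (fun z : R * R => f z.1 z.2) ->
  (\int[mu]_x \int[mu]_y `|(f x y)%:E| < +oo)%E ->
  [/\ mu.-integrable setT (EFin \o (fun x => \int[mu]_y f x y)),
      mu.-integrable setT (EFin \o (fun y => \int[mu]_x f x y)) &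
      \int[mu]_x \int[mu]_y f x y = \int[mu]_y \int[mu]_x f x y].
Proof.
move=> mf fin.
pose F (z : R * R) := (f z.1 z.2)%:E.
have mF : measurable_fun setT F by apply/measurable_EFinP.
have iF : (mu \x mu)%E.-integrable setT F.
  by apply/(integrable12ltyP mu mu mF).
have i1 := integrable_fubini_F iF.
have i2 : mu.-integrable setT (fubini_G mu F).
  have mG := measurable_fubini_G iF.
  apply/integrableP; split => //.
  apply: (@le_lt_trans _ _ (\int[mu]_y \int[mu]_x `|F (x, y)|)%E).
    apply: ge0_le_integral => //.
    - exact: measurableT_comp.
    - apply: (@measurable_fun_fubini_tonelli_G _ _ _ _ R mu (abse \o F)) => //=.
      exact: measurableT_comp.
    - move=> y _; apply: le_abse_integral => //.
      by apply: (measurableT_comp mF); exact: measurable_pair2.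
  by apply/(integrable21ltyP mu mu mF).
have ae1 : ae_eq mu setT (fubini_F mu F) (EFin \o (fun x => \int[mu]_y f x y)).
  have := integrable_ae measurableT i1.
  by apply: filterS => x /(_ I) h _ /=; rewrite /Rintegral fineK.
have ae2 : ae_eq mu setT (fubini_G mu F) (EFin \o (fun x => \int[mu]_y f y x)).
  have := integrable_ae measurableT i2.
  by apply: filterS => x /(_ I) h _ /=; rewrite /Rintegral fineK.
have m1 : measurable_fun setT (EFin \o (fun x => \int[mu]_y f x y)).
  apply/measurable_EFinP; apply: measurableT_comp => //.
  exact: measurable_int i1.
have m2 : measurable_fun setT (EFin \o (fun x => \int[mu]_y f y x)).
  apply/measurable_EFinP; apply: measurableT_comp => //.
  exact: measurable_int i2.
have int1 : mu.-integrable setT (EFin \o (fun x => \int[mu]_y f x y)).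
  apply: le_integrable i1 => // x _ /=.
  exact: le_abse_fine.
have int2 : mu.-integrable setT (EFin \o (fun x => \int[mu]_y f y x)).
  apply: le_integrable i2 => // x _ /=.
  exact: le_abse_fine.
split => //.
rewrite {1}/Rintegral [RHS]/Rintegral; congr fine.
transitivity (\int[mu]_x fubini_F mu F x)%E.
  apply: ae_eq_integral => //; [exact: measurable_int i1|exact: ae_eq_sym].
transitivity (\int[mu]_y fubini_G mu F y)%E; first exact: Fubini.
by apply: ae_eq_integral => //; exact: measurable_int i2.
Qed.
End Affine.

(** * Improper integrals of powers and the Beta integral *)

Section ImproperFTC.
Context {R : realType}.
Local Notation mu := (@lebesgue_measure R).

(** On each compact interval the usual theorem applies, and nonnegativity allows monotone
    convergence along the exhaustion. Integrability of [g] is thus part of the conclusion. *)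
Lemma ge0_FTC_bigcup (g G : R -> R) (a_ b_ : nat -> R) (D : set R) (l : R) :
  (forall n, a_ n < b_ n) -> nonincreasing_seq a_ -> nondecreasing_seq b_ ->
  D = \bigcup_n `[a_ n, b_ n]%classic ->
  (forall x, D x -> 0 <= g x) -> (forall x, D x -> {for x, continuous g}) ->
  (forall x, D x -> is_derive x 1 G (g x)) ->
  G (b_ n) - G (a_ n) @[n --> \oo] --> l ->
  (\int[mu]_(x in D) (g x)%:E = l%:E)%E.
Proof.
move=> ab na nb DE g0 cg dG Gl.
have sub n : `[a_ n, b_ n] `<=` D by rewrite DE => x xn; exists n.
have wc n : {within `[a_ n, b_ n], continuous g}.
  by apply: continuous_in_subspaceT => x /set_mem /sub; exact: cg.
have fin n : (\int[mu]_(x in `[a_ n, b_ n]) (g x)%:E = (G (b_ n) - G (a_ n))%:E)%E.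
  rewrite EFinB; apply: continuous_FTC2 => //.
  - have dd x : `[a_ n, b_ n]%classic x -> derivable G x 1.
      by move=> /sub /dG [].
    have cc x : `[a_ n, b_ n]%classic x -> {for x, continuous G}.
      by move=> /dd /derivable1_diffP/differentiable_continuous.
    split.
    + by move=> x xab; apply: dd; exact: subset_itv_oo_cc xab.
    + by apply: cvg_at_right_filter; apply: cc; rewrite /= in_itv/= lexx ltW.
    + by apply: cvg_at_left_filter; apply: cc; rewrite /= in_itv/= lexx ltW.
  - by move=> x /subset_itv_oo_cc /sub /dG dx; rewrite derive1E derive_val.
have := @ge0_nondecreasing_set_cvg_integral _ (measurableTypeR R) R (fun n => `[a_ n, b_ n]%classic)
  (EFin \o g) mu.
rewrite -DE => cvg_int.
have c1 : (\int[mu]_(x in `[a_ n, b_ n]) (g x)%:E)%E @[n --> \oo] -->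
    (\int[mu]_(x in D) (g x)%:E)%E.
  apply: cvg_int => //=.
  - move=> n m nm; apply/subsetPset => x /=; rewrite !in_itv/= => /andP[ax xb].
    by rewrite (le_trans (na _ _ nm) ax) (le_trans xb (nb _ _ nm)).
  - move=> n; apply/measurable_EFinP.
    by apply: subspace_continuous_measurable_fun => //; exact: wc.
  - by move=> n x /sub /g0; rewrite lee_fin.
have c2 : (\int[mu]_(x in `[a_ n, b_ n]) (g x)%:E)%E @[n --> \oo] --> l%:E.
  by under eq_fun do rewrite fin; apply: cvg_EFin => //; exact: nearW.
by rewrite -(cvg_lim _ c1)// (cvg_lim _ c2).
Qed.

Lemma ge0_FTC_oo (g G : R -> R) (a b la lb : R) : a < b ->
  (forall x, a < x < b -> 0 <= g x) ->
  (forall x, a < x < b -> {for x, continuous g}) ->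
  (forall x, a < x < b -> is_derive x 1 G (g x)) ->
  G x @[x --> a^'+] --> la -> G x @[x --> b^'-] --> lb ->
  (\int[mu]_(x in `]a, b[) (g x)%:E = (lb - la)%:E)%E.
Proof.
move=> ab g0 cg dG /cvg_at_rightP Ga /cvg_at_leftP Gb.
(* Starting at 3 keeps [d n] below half the length, so that [a + d n < b - d n] already for n =
   0. *)
pose d n := (b - a) * (n.+3%:R^-1 : R).
have d0 n : 0 < d n by rewrite mulr_gt0 ?subr_gt0// invr_gt0.
have dcvg : d n @[n --> \oo] --> (0 : R).
  rewrite -[X in _ --> X](mulr0 (b - a)); apply: cvgMr.
  have := @cvg_harmonic R; rewrite -(cvg_shiftn 2)/=.
  by under eq_fun do rewrite addn2.
have dle m n : (m <= n)%N -> d n <= d m.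
  by move=> mn; rewrite ler_pM2l ?subr_gt0// lef_pV2 ?posrE// ler_nat.
have d1 n : d n < (b - a) / 2.
  by rewrite ltr_pM2l ?subr_gt0// ltf_pV2 ?posrE// ltr_nat.
apply: (@ge0_FTC_bigcup g G (fun n => a + d n) (fun n => b - d n)).
- by move=> n; have := d1 n; lra.
- by move=> m n /dle; rewrite lerD2l.
- by move=> m n /dle; rewrite lerD2l lerN2.
- apply/seteqP; split=> [x /= | x [n _]] /=; rewrite !in_itv/=; last first.
    by have := d0 n; lra.
  move=> /andP[ax xb].
  have : \forall n \near \oo, d n < Num.min (x - a) (b - x).
    by apply: (cvgr_lt _ dcvg); rewrite lt_min !subr_gt0 ax.
  case=> N _ /(_ N (leqnn N)) /=; rewrite lt_min => /andP[h1 h2].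
  by exists N => //=; rewrite in_itv/=; lra.
- by move=> x /=; rewrite in_itv/=; exact: g0.
- by move=> x /=; rewrite in_itv/=; exact: cg.
apply: cvgB.
- apply: Gb; split=> [n|]; first by rewrite ltrBlDr ltrDl.
  by rewrite -[X in _ --> X]subr0; apply: cvgB => //; exact: cvg_cst.
- apply: Ga; split=> [n|]; first by rewrite ltrDl.
  by rewrite -[X in _ --> X]addr0; apply: cvgD => //; exact: cvg_cst.
Qed.

Lemma ge0_FTC_oy (g G : R -> R) (a la lb : R) :
  (forall x, a < x -> 0 <= g x) ->
  (forall x, a < x -> {for x, continuous g}) ->
  (forall x, a < x -> is_derive x 1 G (g x)) ->
  G x @[x --> a^'+] --> la -> G x @[x --> +oo] --> lb ->
  (\int[mu]_(x in `]a, +oo[) (g x)%:E = (lb - la)%:E)%E.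
Proof.
move=> g0 cg dG /cvg_at_rightP Ga /cvg_pinftyP Gb.
(* The right end starts at a + 2 because the left end is a + 1 for n = 0. *)
apply: (@ge0_FTC_bigcup g G (fun n => a + n.+1%:R^-1) (fun n => a + n.+2%:R)).
- move=> n; rewrite ltrD2l (@le_lt_trans _ _ 1)// ?invf_le1// ?ler1n//.
  by rewrite ltr1n.
- by move=> m n mn; rewrite lerD2l lef_pV2 ?posrE// ler_nat.
- by move=> m n mn; rewrite lerD2l ler_nat.
- apply/seteqP; split=> [x /= | x [n _]] /=; rewrite !in_itv/=; last first.
    by rewrite andbT => /andP[h _]; apply: lt_le_trans h; rewrite ltrDl invr_gt0.
  rewrite andbT => ax.
  have [N NE] : exists N : nat, Num.max (x - a) (x - a)^-1 < N%:R.
    exists (Num.bound (Num.max (x - a) (x - a)^-1)).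
    by apply: archi_boundP; rewrite le_max subr_ge0 ltW.
  move: NE; rewrite gt_max => /andP[h1 h2]; exists N => //=; rewrite in_itv/=.
  apply/andP; split; last first.
    by rewrite -lerBlDl (le_trans (ltW h1))// ler_nat !leqW.
  rewrite addrC -lerBrDr -[leRHS]invrK lef_pV2 ?posrE ?invr_gt0 ?subr_gt0//.
  by rewrite (le_trans (ltW h2))// ler_nat.
- by move=> x /=; rewrite in_itv/= andbT; exact: g0.
- by move=> x /=; rewrite in_itv/= andbT; exact: cg.
- by move=> x xa; apply: dG; move: xa; rewrite /= in_itv/= andbT.
apply: cvgB.
- apply: Gb; apply/cvgryPge => A.
  near=> n; rewrite -lerBlDl (@le_trans _ _ n%:R)//; last by rewrite ler_nat !leqW.
  by near: n; exact: nbhs_infty_ger.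
- apply: Ga; split=> [n|]; first by rewrite ltrDl invr_gt0.
  by rewrite -[X in _ --> X]addr0; apply: cvgD;
    [exact: cvg_cst|exact: cvg_harmonic].
Unshelve. all: by end_near. Qed.
End ImproperFTC.

Section Beta.
Context {R : realType}.
Local Notation mu := (@lebesgue_measure R).

Lemma ge0_integrable (D : set R) (f : R -> R) : measurable D ->
  measurable_fun D f -> (forall x, D x -> 0 <= f x) ->
  (\int[mu]_(x in D) (f x)%:E < +oo)%E -> mu.-integrable D (EFin \o f).
Proof.
move=> mD mf f0 fin; apply/integrableP; split; first exact/measurable_EFinP.
apply: le_lt_trans fin; rewrite le_eqVlt; apply/orP; left; apply/eqP.
by apply: eq_integral => x /set_mem Dx /=; rewrite ger0_norm ?f0.
Qed.

Lemma measurable_invr D : measurable_fun D (@GRing.inv R).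
Proof.
apply: measurable_funTS; rewrite -(setUv [set 0]); apply/measurable_funU => //.
  exact: measurableC.
split; first exact: measurable_fun_set1.
apply: open_continuous_measurable_fun.
  by apply: closed_openC; exact: closed_eq.
by move=> x; rewrite inE/= => /eqP; exact: inv_continuous.
Qed.

Lemma continuous_powR (b t : R) : 0 < t -> {for t, continuous (@powR R ^~ b)}.
Proof.
move=> t0; apply/differentiable_continuous/derivable1_diffP.
by apply: derivable_powR; rewrite in_itv/= t0.
Qed.

Lemma powR_divl (x y b : R) : 0 <= x -> 0 <= y -> (x / y) `^ b = x `^ b / y `^ b.
Proof.
move=> x0 y0; rewrite powRM ?invr_ge0//; congr (_ * _).
by rewrite -powR_inv1// powRAC powR_inv1// powR_ge0.
Qed.

Lemma powRS (x b : R) : 0 < x -> x `^ b = x * x `^ (b - 1).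
Proof.
move=> x0; rewrite -{2}(powRr1 (ltW x0)) -powRD.
  by rewrite addrC subrK.
by rewrite (gt_eqF x0) implybT.
Qed.

Lemma cvg_powRNy (b : R) : 0 < b -> t `^ (- b) @[t --> +oo] --> (0 : R).
Proof.
move=> b0; apply/cvgrPdist_lt => e e0; near=> t.
have t0 : 0 < t by near: t; exact: nbhs_pinfty_gt.
rewrite sub0r normrN ger0_norm ?powR_ge0// powRN -[ltRHS]invrK ltf_pV2 ?posrE ?invr_gt0 ?powR_gt0//.
have -> : e^-1 = (e^-1 `^ (b^-1)) `^ b.
  by rewrite -powRrM mulVf ?gt_eqF// powRr1// invr_ge0 ltW.
rewrite gt0_ltr_powR ?nnegrE ?powR_ge0 ?(ltW t0)//.
Unshelve. all: by end_near. Qed.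

Lemma integral_powR0 (b c : R) : 0 < b -> 0 < c ->
  (\int[mu]_(t in `]0%R, c[) (t `^ (b - 1))%:E = (c `^ b / b)%:E)%E.
Proof.
move=> b0 c0; rewrite -[X in X%:E]subr0.
apply: (@ge0_FTC_oo R _ (fun t => t `^ b / b)) => //.
- by move=> x _; exact: powR_ge0.
- by move=> x /andP[x0 _]; exact: continuous_powR.
- move=> x /andP[x0 _].
  have := @is_derive1_powR R b x x0 => h.
  have -> : x `^ (b - 1) = b^-1 *: (b * x `^ (b - 1)).
    by rewrite /GRing.scale/= mulKf// gt_eqF.
  have -> : (fun t => t `^ b / b) = b^-1 \*: (@powR R ^~ b).
    by apply/funext => t; rewrite /= mulrC.
  exact: is_deriveZ.
- by rewrite -[X in _ --> X](mul0r b^-1); apply: cvgMl; exact: powR_cvg0.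
- by apply: cvgMl; apply: cvg_at_left_filter; exact: continuous_powR.
Qed.

Lemma integral_powRy (b c : R) : 0 < b -> 0 < c ->
  (\int[mu]_(t in `]c, +oo[) (t `^ (- b - 1))%:E = (c `^ (- b) / b)%:E)%E.
Proof.
move=> b0 c0; rewrite -[X in X%:E]add0r -[X in (0 + X)%:E]opprK.
apply: (@ge0_FTC_oy R _ (fun t => - (t `^ (- b) / b))) => //.
- by move=> x _; exact: powR_ge0.
- by move=> x cx; apply: continuous_powR; exact: lt_trans cx.
- move=> x cx; have x0 : 0 < x by exact: lt_trans cx.
  have := @is_derive1_powR R (- b) x x0 => h.
  have -> : x `^ (- b - 1) = (- b^-1) *: (- b * x `^ (- b - 1)).
    by rewrite /GRing.scale/= mulrA mulrNN mulVf ?gt_eqF// mul1r.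
  have -> : (fun t => - (t `^ (- b) / b)) = (- b^-1) \*: (@powR R ^~ (- b)).
    by apply/funext => t; rewrite [RHS]mulNr mulrC.
  exact: is_deriveZ.
- by apply: cvgN; apply: cvgMl; apply: cvg_at_right_filter; exact: continuous_powR.
- rewrite -[X in _ --> X]oppr0 -[X in _ --> - X](mul0r b^-1); apply: cvgN; apply: cvgMl; exact: cvg_powRNy.
Qed.

Variable b : R.
Hypotheses (b0 : 0 < b) (b1 : b < 1).

Definition betaf (t : R) : R := t `^ (b - 1) / (1 + t).

Lemma betaf_ge0 (t : R) : 0 < t -> 0 <= betaf t.
Proof. by move=> t0; rewrite divr_ge0 ?powR_ge0// addr_ge0// ltW. Qed.

Lemma continuous_betaf (t : R) : 0 < t -> {for t, continuous betaf}.
Proof.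
move=> t0; apply: cvgM; first exact: continuous_powR.
apply: cvgV; first by rewrite gt_eqF// addr_gt0.
by apply: cvgD; [exact: cvg_cst|exact: cvg_id].
Qed.

Lemma measurable_betaf D : measurable_fun D betaf.
Proof.
apply: measurable_funTS; apply: measurable_funM.
  exact: measurable_powR.
apply: measurableT_comp; first exact: measurable_invr.
exact: measurable_funD.
Qed.

(** This majorant is integrable at 0, and that of [betaf_ley] at infinity. *)
Lemma betaf_le0 (t : R) : 0 < t -> betaf t <= t `^ (b - 1).
Proof.
move=> t0; rewrite ler_pdivrMr ?addr_gt0// ler_peMr ?powR_ge0//.
by rewrite lerDl ltW.
Qed.

Lemma betaf_ley (t : R) : 0 < t -> betaf t <= t `^ (- (1 - b) - 1).
Proof.
move=> t0; rewrite ler_pdivrMr ?addr_gt0// opprB powRS//.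
rewrite mulrC ler_wpM2l ?powR_ge0// lerDr.
by [].
Qed.

Lemma integral_betaf0 (q : R) : 0 < q ->
  (\int[mu]_(t in `]0%R, q]) (betaf t)%:E <= (q `^ b / b)%:E)%E.
Proof.
move=> q0; rewrite -integral_itv_bndo_bndc; last first.
  by apply/measurable_EFinP; exact: measurable_betaf.
rewrite -integral_powR0//; apply: ge0_le_integral => //.
- by move=> x /=; rewrite in_itv/= => /andP[x0 _]; rewrite lee_fin betaf_ge0.
- by apply/measurable_EFinP; exact: measurable_betaf.
- by apply/measurable_EFinP/measurable_funTS; exact: measurable_powR.
- by move=> x /=; rewrite in_itv/= => /andP[x0 _]; rewrite lee_fin betaf_le0.
Qed.

Lemma integral_betafy (q : R) : 0 < q ->
  (\int[mu]_(t in `]q, +oo[) (betaf t)%:E <= (q `^ (- (1 - b)) / (1 - b))%:E)%E.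
Proof.
move=> q0; rewrite -integral_powRy ?subr_gt0//; apply: ge0_le_integral => //.
- move=> x /=; rewrite in_itv/= => /andP[qx _]; rewrite lee_fin betaf_ge0//.
  exact: lt_trans qx.
- by apply/measurable_EFinP; exact: measurable_betaf.
- by apply/measurable_EFinP/measurable_funTS; exact: measurable_powR.
- move=> x /=; rewrite in_itv/= => /andP[qx _]; rewrite lee_fin betaf_ley//.
  exact: lt_trans qx.
Qed.

Lemma integrable_betaf : mu.-integrable `]0%R, +oo[ (EFin \o betaf).
Proof.
apply: ge0_integrable => //; first exact: measurable_betaf.
  by move=> x /=; rewrite in_itv/= andbT; exact: betaf_ge0.
have -> : `]0%R, +oo[%classic = `]0%R, 1%R] `|` `]1%R, +oo[ :> set R.
  by rewrite -itv_bndbnd_setU// ?bnd_simp.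
rewrite ge0_integral_setU//.
- apply: lte_add_pinfty.
    exact: le_lt_trans (integral_betaf0 _) (ltry _).
  exact: le_lt_trans (integral_betafy _) (ltry _).
- by apply/measurable_EFinP; exact: measurable_betaf.
- move=> x; rewrite -itv_bndbnd_setU ?bnd_simp//= in_itv/= andbT lee_fin.
  exact: betaf_ge0.
- by apply/disj_setPRL => x /=; rewrite !in_itv/= andbT => h /andP[_]; rewrite leNgt h.
Qed.

(** The Beta value B(b, 1 - b) = pi / sin (pi b). It serves as a normalizing constant, of which only
    positivity and finiteness matter. *)
Definition betaI : R := \int[mu]_(t in `]0%R, +oo[) betaf t.

(** An incomplete Beta integral. It is the primitive from which the kernel integrals below are
    evaluated, each after a rational substitution. *)
Definition betaF (q : R) : R := \int[mu]_(t in `]0%R, q]) betaf t.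

Lemma integrable_betafS (i : interval R) : [set` i] `<=` `]0%R, +oo[ ->
  mu.-integrable [set` i] (EFin \o betaf).
Proof. by move=> s; apply: integrableS integrable_betaf. Qed.

Lemma is_derive_betaF (q : R) : 0 < q -> is_derive q 1 betaF (betaf q).
Proof.
move=> q0.
have int : mu.-integrable [set` Interval (BRight 0) (BRight (q + 1))] (EFin \o betaf).
  by apply: integrable_betafS; apply: subset_itvl; rewrite bnd_simp.
have qq : q < q + 1 by rewrite ltrDl.
have [|d dE] := continuous_FTC1 qq int _ (continuous_betaf q0).
  by rewrite lte_fin.
by split => //; rewrite -derive1E.
Qed.

Lemma betaF_ge0 (q : R) : 0 <= betaF q.
Proof.
apply: Rintegral_ge0 => x /=; rewrite in_itv/= => /andP[x0 _].
exact: betaf_ge0.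
Qed.

Lemma betaF_cvg0 : betaF q @[q --> 0^'+] --> (0 : R).
Proof.
apply: (@squeeze_cvgr _ _ _ _ (cst 0) (fun q => q `^ b / b)).
- near=> q; rewrite betaF_ge0/= -lee_fin /betaF /Rintegral.
  rewrite fineK ?integral_betaf0//.
  by apply: integrable_fin_num => //; apply: integrable_betafS; apply: subset_itvl.
- exact: cvg_cst.
- by rewrite -[X in _ --> X](mul0r b^-1); apply: cvgMl; exact: powR_cvg0.
Unshelve. all: by end_near. Qed.

Lemma betaFB (q : R) : 0 < q -> betaI - betaF q = \int[mu]_(t in `]q, +oo[) betaf t.
Proof.
move=> q0; apply: Rintegral_itvB; first exact: integrable_betaf.
  by rewrite bnd_simp ltW.
by rewrite bnd_simp.
Qed.

Lemma betaF_cvgy : betaF q @[q --> +oo] --> betaI.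
Proof.
apply/subr_cvg0; rewrite -[X in _ --> X]oppr0.
have -> : (fun q => betaF q - betaI) = (fun q => - (betaI - betaF q)).
  by apply/funext => q; rewrite opprB.
apply: cvgN.
apply: (@squeeze_cvgr _ _ _ _ (cst 0) (fun q => q `^ (- (1 - b)) / (1 - b))).
- near=> q.
  have q0 : 0 < q by near: q; exact: nbhs_pinfty_gt.
  rewrite betaFB//; apply/andP; split.
    apply: Rintegral_ge0 => x /=; rewrite in_itv/= => /andP[x0 _].
    by apply: betaf_ge0; exact: lt_trans x0.
  rewrite -lee_fin /Rintegral fineK ?integral_betafy//.
  apply: integrable_fin_num => //; apply: integrable_betafS; apply: subset_itvr.
  by rewrite bnd_simp ltW.
- exact: cvg_cst.
- rewrite -[X in _ --> X](mul0r (1 - b)^-1); apply: cvgMl; apply: cvg_powRNy.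
  by rewrite subr_gt0.
Unshelve. all: by end_near. Qed.

(** If the total mass were 0, [betaF] would vanish on the positive half-line, whereas its derivative
    at 1 is [betaf 1], that is 1/2. *)
Lemma betaI_gt0 : 0 < betaI.
Proof.
rewrite lt_neqAle; apply/andP; split; last first.
  apply: Rintegral_ge0 => x /=; rewrite in_itv/= => /andP[x0 _].
  exact: betaf_ge0.
apply/negP => /eqP I0.
have F0 (q : R) : 0 < q -> betaF q = 0.
  move=> q0; apply/le_anti; rewrite betaF_ge0 andbT.
  rewrite -oppr_ge0; have := betaFB q0; rewrite -I0 sub0r => ->.
  apply: Rintegral_ge0 => x /=; rewrite in_itv/= => /andP[x0 _].
  by apply: betaf_ge0; exact: lt_trans x0.
have h1 := is_derive_betaF (@ltr01 R).
have h2 : is_derive (1 : R) 1 betaF 0.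
  apply: (@near_eq_is_derive _ _ _ (cst 0)) => //.
  by near=> q; rewrite F0//; near: q; exact: lt_nbhsr.
have : betaf 1 = 0.
  by have [_ <-] := h1; have [_ <-] := h2.
rewrite /betaf powR1 => /eqP; rewrite mul1r invr_eq0 => /eqP; lra.
Unshelve. all: by end_near. Qed.
End Beta.

Section BetaIntegrals.
Context {R : realType}.
Local Notation mu := (@lebesgue_measure R).
Variable b : R.
Hypotheses (b0 : 0 < b) (b1 : b < 1).

Lemma cvg_at_right0 (T : Type) (F : set_system T) (FF : Filter F) (th : T -> R) :
  (\forall x \near F, 0 < th x) -> th x @[x --> F] --> (0 : R) ->
  th x @[x --> F] --> 0^'+.
Proof.
move=> th0 thc A; rewrite /at_right withinE => -[U nU UA].
have := thc _ nU; rewrite !near_simpl; apply: filterS2 th0 => x x0 Ux /=.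
have : (U `&` (fun u => 0 < u)) (th x) by [].
by rewrite -UA => -[].
Qed.

(** The substitution [th] is carried out inside the primitive, so that evaluating an integral
    amounts to one algebraic identity and two limits. *)
Lemma is_derive_scale_betaF (k : R) (th : R -> R) (x dth l : R) :
  0 < th x -> is_derive x 1 th dth -> k * (betaf b (th x) * dth) = l ->
  is_derive x 1 (fun t => k * betaF b (th t)) l.
Proof.
move=> th0 dth1 <-.
have h := @is_derive1_comp R _ th x _ _ (is_derive_betaF b0 b1 th0) dth1.
exact: (is_deriveZ k h).
Qed.

Lemma is_derive_divr (c x : R) : is_derive x 1 (fun t => t / c) c^-1.
Proof.
have -> : (fun t => t / c) = c^-1 \*: (@id R).
  by apply/funext => t; rewrite /= mulrC.
by rewrite -[X in is_derive _ _ _ X]mulr1; exact: is_deriveZ.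
Qed.

Lemma continuous_scale_powR (c x : R) : 0 < x -> 0 < c ->
  {for x, continuous (fun t => t `^ (b - 1) / (c + t))}.
Proof.
move=> x0 c0; apply: cvgM; first exact: continuous_powR.
apply: cvgV; first by rewrite gt_eqF// addr_gt0.
by apply: cvgD; [exact: cvg_cst|exact: cvg_id].
Qed.

Let dG (c x : R) : 0 < c -> 0 < x ->
  is_derive x 1 (fun t => c `^ (b - 1) * betaF b (t / c)) (x `^ (b - 1) / (c + x)).
Proof.
move=> c0 x0; apply: (is_derive_scale_betaF _ (is_derive_divr c x)).
  by rewrite divr_gt0.
rewrite /betaf powR_divl ?(ltW c0) ?(ltW x0)//; field.
by rewrite !gt_eqF ?powR_gt0 ?addr_gt0.
Qed.

Let G0 (c : R) : 0 < c ->
  c `^ (b - 1) * betaF b (t / c) @[t --> 0^'+] --> (0 : R).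
Proof.
move=> c0; rewrite -[X in _ --> X](mulr0 (c `^ (b - 1))); apply: cvgMr.
apply: (@cvg_comp _ _ _ (fun t => t / c) (betaF b) _ (0^'+)); last first.
  exact: betaF_cvg0.
apply: cvg_at_right0.
  near=> t; rewrite divr_gt0//; near: t; exact: nbhs_right_gt.
rewrite -[X in _ --> X](mul0r c^-1); apply: cvgMl.
by apply: cvg_at_right_filter; exact: cvg_id.
Unshelve. all: by end_near. Qed.

Lemma integral_betaf_scale (c q : R) : 0 < c -> 0 < q ->
  (\int[mu]_(t in `]0%R, q[) (t `^ (b - 1) / (c + t))%:E =
   (c `^ (b - 1) * betaF b (q / c))%:E)%E.
Proof.
move=> c0 q0; rewrite -[X in X%:E]subr0.
apply: (@ge0_FTC_oo R _ (fun t => c `^ (b - 1) * betaF b (t / c))) => //.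
- by move=> x /andP[x0 _]; rewrite divr_ge0 ?powR_ge0// addr_ge0// ltW.
- by move=> x /andP[x0 _]; exact: continuous_scale_powR.
- by move=> x /andP[x0 _]; exact: dG.
- exact: G0.
- apply: cvg_at_left_filter.
  by have [/derivable1_diffP/differentiable_continuous + _] := dG c0 q0.
Qed.

Lemma integral_betaf_scaley (c : R) : 0 < c ->
  (\int[mu]_(t in `]0%R, +oo[) (t `^ (b - 1) / (c + t))%:E =
   (c `^ (b - 1) * betaI b)%:E)%E.
Proof.
move=> c0; rewrite -[X in X%:E]subr0.
apply: (@ge0_FTC_oy R _ (fun t => c `^ (b - 1) * betaF b (t / c))) => //.
- by move=> x x0; rewrite divr_ge0 ?powR_ge0// addr_ge0// ltW.
- by move=> x x0; exact: continuous_scale_powR.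
- by move=> x x0; exact: dG.
- exact: G0.
- apply: cvgMr; apply: (@cvg_comp _ _ _ (fun t => t / c) (betaF b)); last exact: betaF_cvgy.
  by apply: gt0_cvgMly => //; rewrite invr_gt0.
Qed.

(** The substitution t = Z / y reverses the orientation: y = 0 corresponds to t = +oo, whence the
    mass of [betaf] beyond Z / Y. *)
Lemma integral_betaf_inv (Z Y : R) : 0 < Z -> 0 < Y ->
  (\int[mu]_(y in `]0%R, Y[) (y `^ (- b) / (y + Z))%:E =
   (Z `^ (- b) * (betaI b - betaF b (Z / Y)))%:E)%E.
Proof.
move=> Z0 Y0.
have -> : Z `^ (- b) * (betaI b - betaF b (Z / Y)) =
    - Z `^ (- b) * betaF b (Z / Y) - (- Z `^ (- b) * betaI b) by ring.
have dH (y : R) : 0 < y ->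
    is_derive y 1 (fun y => - Z `^ (- b) * betaF b (Z / y)) (y `^ (- b) / (y + Z)).
  move=> y0; apply: (@is_derive_scale_betaF _ (fun y => Z / y) y (- (Z / y ^+ 2))).
  - by rewrite divr_gt0.
  - have h := is_deriveZ Z (@is_deriveV R id y 1 1 (lt0r_neq0 y0) (is_derive_id _ _)).
    by apply: is_derive_eq h _; rewrite /GRing.scale/= mulr1 mulrN.
  - rewrite /betaf powR_divl ?ltW// !powRN (powRS b Z0) (powRS b y0); field.
    by rewrite !gt_eqF ?powR_gt0 ?addr_gt0.
apply: (@ge0_FTC_oo R _ (fun y => - Z `^ (- b) * betaF b (Z / y))) => //.
- by move=> x /andP[x0 _]; rewrite divr_ge0 ?powR_ge0// addr_ge0// ltW.
- move=> x /andP[x0 _]; apply: cvgM; first exact: continuous_powR.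
  apply: cvgV; first by rewrite gt_eqF// addr_gt0.
  by apply: cvgD; [exact: cvg_id|exact: cvg_cst].
- by move=> x /andP[x0 _]; exact: dH.
- apply: cvgMr; apply: (@cvg_comp _ _ _ (fun y => Z / y) (betaF b)); last exact: betaF_cvgy.
  apply: gt0_cvgMry => //; apply/cvgrVy.
    by near=> t; near: t; exact: nbhs_right_gt.
  by apply: cvg_at_right_filter; exact: cvg_id.
- apply: cvg_at_left_filter.
  by have [/derivable1_diffP/differentiable_continuous + _] := dH _ Y0.
Unshelve. all: by end_near. Qed.

(* The substitution [t = S (X + Y) / (Y (X - S))] turns the integrand into
   [betaf b]. *)
Lemma integral_balayage (X Y : R) : 0 < X -> 0 < Y ->
  (\int[mu]_(S in `]0%R, X[) ((X - S) `^ (- b) * (S `^ (b - 1) / (Y + S)))%:E =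
   (betaI b * (Y `^ (b - 1) * (X + Y) `^ (- b)))%:E)%E.
Proof.
move=> X0 Y0; pose k := Y `^ (b - 1) * (X + Y) `^ (- b).
pose th (S : R) := (X + Y) / Y * (S / (X - S)).
have XY0 : 0 < X + Y by rewrite addr_gt0.
have -> : betaI b * k = k * betaI b - 0 by rewrite subr0 mulrC.
have th0 (S : R) : 0 < S < X -> 0 < th S.
  by move=> /andP[S0 SX]; rewrite mulr_gt0 ?divr_gt0// subr_gt0.
have dth (S : R) : 0 < S < X ->
    is_derive S 1 th ((X + Y) / Y * (X / (X - S) ^+ 2)).
  move=> /andP[S0 SX].
  have XS : X - S != 0 by rewrite gt_eqF// subr_gt0.
  have h1 : is_derive S 1 (fun S : R => X - S) (- 1).
    have h := is_deriveB (is_derive_cst X S 1) (is_derive_id S 1).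
    by apply: is_derive_eq h _; rewrite sub0r.
  have h2 := @is_deriveV R _ S _ _ XS h1.
  have h3 := is_deriveM (is_derive_id S 1) h2.
  apply: is_derive_eq (is_deriveZ ((X + Y) / Y) h3) _.
  by rewrite /GRing.scale/=; field; rewrite XS gt_eqF.
apply: (@ge0_FTC_oo R _ (fun S => k * betaF b (th S))) => //.
- move=> S /andP[S0 SX]; rewrite mulr_ge0 ?powR_ge0// divr_ge0 ?powR_ge0//.
  by rewrite addr_ge0// ltW.
- move=> S /andP[S0 SX]; apply: cvgM; last exact: continuous_scale_powR.
  apply: (@cvg_comp _ _ _ (fun S => X - S) (@powR R ^~ (- b))).
    by apply: cvgB; [exact: cvg_cst|exact: cvg_id].
  by apply: continuous_powR; rewrite subr_gt0.
- move=> S S0X; apply: (is_derive_scale_betaF (th0 _ S0X) (dth _ S0X)).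
  move: S0X => /andP[S0 SX].
  have XS0 : 0 < X - S by rewrite subr_gt0.
  have thE : th S `^ (b - 1) = (X + Y) `^ (b - 1) / Y `^ (b - 1) *
      (S `^ (b - 1) / (X - S) `^ (b - 1)).
    by rewrite powRM ?divr_ge0 ?(ltW XY0) ?(ltW S0) ?(ltW Y0) ?(ltW XS0)//
      !powR_divl ?(ltW XY0) ?(ltW S0) ?(ltW Y0) ?(ltW XS0).
  rewrite /betaf thE /k /th !powRN (powRS b XY0) (powRS b XS0); field.
  (* This quantity is Y (X - S) (1 + th S). It factors as X (Y + S), which is where the denominator
     Y + S of the integrand comes from. *)
  have D0 : 0 < Y * (X - S) + (X + Y) * S.
    by rewrite (_ : _ + _ = X * (Y + S)) ?mulr_gt0 ?addr_gt0//; ring.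
  rewrite (gt_eqF D0) (gt_eqF XS0) (gt_eqF XY0) (gt_eqF Y0).
  by rewrite !(gt_eqF (powR_gt0 _ _))// gt_eqF// addr_gt0.
- rewrite -[X in _ --> X](mulr0 k); apply: cvgMr.
  apply: (@cvg_comp _ _ _ th (betaF b) _ (0^'+)); last exact: betaF_cvg0.
  apply: cvg_at_right0.
    near=> S; apply: th0; apply/andP; split; near: S.
      exact: nbhs_right_gt.
    exact: nbhs_right_lt.
  apply: cvg_at_right_filter; rewrite -[X in _ --> X](mulr0 ((X + Y) / Y)).
  apply: cvgMr; rewrite -[X in _ --> X](mul0r (X - 0)^-1); apply: cvgM.
    exact: cvg_id.
  apply: cvgV; first by rewrite subr0 gt_eqF.
  by apply: cvgB; [exact: cvg_cst|exact: cvg_id].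
- apply: cvgMr; apply: (@cvg_comp _ _ _ th (betaF b)); last exact: betaF_cvgy.
  apply: gt0_cvgMry; first by rewrite divr_gt0.
  apply: (@ger_cvgy _ _ _ _ (fun S => X / 2 / (X - S))).
    near=> S; rewrite ler_pM2r.
      by apply: ltW; near: S; apply: nbhs_left_gt; rewrite ltr_pdivrMr// mulr_natr mulr2n ltrDl.
    by rewrite invr_gt0 subr_gt0; near: S; exact: nbhs_left_lt.
  apply: gt0_cvgMry; first by rewrite divr_gt0.
  apply/cvgrVy.
    by near=> S; rewrite subr_gt0; near: S; exact: nbhs_left_lt.
  apply: cvg_at_left_filter; rewrite -[X in _ --> X](subrr X).
  by apply: cvgB; [exact: cvg_cst|exact: cvg_id].
Unshelve. all: by end_near. Qed.
End BetaIntegrals.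

(** * Smooth cutoffs and test functions *)

Section Smooth.
Context {R : realType}.
Implicit Types (f g : R -> R) (x y : R) (P Q : {poly R}).

(** Differentiability n times, as a chain of successive derivatives. In this form the closure
    properties follow by induction, without any formula for n-th derivatives. *)
Fixpoint Cn (n : nat) f : Prop :=
  if n is m.+1 then
    exists f', (forall x, is_derive x 1 f (f' x)) /\ Cn m f'
  else True.

Lemma CnP f :
  (forall n, Cn n f) <-> (forall n x, derivable (derive1n n f) x 1).
Proof.
split=> [h n x|].
  move: (h n.+1) => {h}; elim: n f => [|n IH] f [f' [df hf']].
    by have [] := df x.
  rewrite derive1Sn (_ : f^`()%classic = f'); first exact: IH.
  by apply/funext => y; rewrite derive1E; have [_ ->] := df y.
move=> h n; elim: n f h => // n IH f h; exists f^`()%classic; split.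
  by move=> x; split; [exact: (h 0%N)|rewrite -derive1E].
by apply: IH => m x; rewrite -derive1Sn.
Qed.

Lemma CnS n f : Cn n.+1 f -> Cn n f.
Proof.
elim: n f => // n IH f [f' [df /IH hf']].
by exists f'.
Qed.

Lemma eq_Cn n f g : f =1 g -> Cn n f -> Cn n g.
Proof. by move=> /funext ->. Qed.

Lemma Cn_cst n (k : R) : Cn n (cst k).
Proof. by elim: n k => // n IH k; exists (cst 0); split => // x; exact: is_derive_cst. Qed.

Lemma CnD n f g : Cn n f -> Cn n g -> Cn n (fun x => f x + g x).
Proof.
elim: n f g => // n IH f g [f' [df hf']] [g' [dg hg']].
exists (fun x => f' x + g' x); split; last exact: IH.
by move=> x; exact: (is_deriveD (df x) (dg x)).
Qed.

Lemma CnM n f g : Cn n f -> Cn n g -> Cn n (fun x => f x * g x).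
Proof.
elim: n f g => // n IH f g /[dup] /CnS hf [f' [df hf']] /[dup] /CnS hg [g' [dg hg']].
exists (fun x => f x * g' x + g x * f' x); split.
  by move=> x; exact: (is_deriveM (df x) (dg x)).
by apply: CnD; exact: IH.
Qed.

Lemma CnV n f : (forall x, f x != 0) -> Cn n f -> Cn n (fun x => (f x)^-1).
Proof.
move=> f0; elim: n => // n IH /[dup] /CnS /IH hV [f' [df hf']].
exists (fun x => (f x)^-1 * (f x)^-1 * (-1 * f' x)); split.
  move=> x; apply: is_derive_eq (is_deriveV (f0 x) (df x)) _.
  by rewrite /GRing.scale/= expr2 invfM mulN1r mulrN mulNr.
by do 2 apply: CnM => //; exact: Cn_cst.
Qed.

Lemma Cn_aff n (k c : R) f : Cn n f -> Cn n (fun x => f (k * x + c)).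
Proof.
elim: n f => // n IH f [f' [df hf']].
exists (fun x => f' (k * x + c) * k); split; last first.
  by apply: CnM; [exact: IH|exact: Cn_cst].
move=> x; have h : is_derive x 1 (fun x => k * x + c) k.
  have := is_deriveD (is_deriveZ k (is_derive_id x (1:R))) (is_derive_cst c x (1:R)).
  by move=> h; apply: is_derive_eq h _; rewrite addr0 /GRing.scale/= mulr1.
exact: (is_derive1_comp (df _) h).
Qed.

Lemma poly_expR_bounded P : exists2 C : R, 0 <= C &
  forall t : R, 0 <= t -> `|P.[t]| * expR (- t) <= C.
Proof.
(* For n > 0, raise t / n <= exp (t / n) to the power n. *)
have mon n (t : R) : 0 <= t -> t ^+ n * expR (- t) <= n%:R ^+ n + 1.
  move=> t0; case: n => [|n].
    by rewrite !expr0 mul1r -expR0 ler_wpDl// ler_expR oppr_le0.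
  rewrite expRN ler_pdivrMr ?expR_gt0// (@le_trans _ _ (n.+1%:R ^+ n.+1 * expR t))//.
    rewrite -[X in expR X](@divfK _ n.+1%:R)// expRM_natr -exprMn lerXn2r ?nnegrE ?mulr_ge0 ?expR_ge0//.
    rewrite mulrC -ler_pdivrMr// (le_trans _ (expR_ge1Dx _))// lerDr//.
  by rewrite ler_wpM2r ?expR_ge0// lerDl.
exists (\sum_(i < size P) `|P`_i| * (i%:R ^+ i + 1)).
  by apply: sumr_ge0 => i _; rewrite mulr_ge0// addr_ge0// exprn_ge0.
move=> t t0; rewrite horner_coef.
apply: (@le_trans _ _ ((\sum_(i < size P) `|P`_i| * t ^+ i) * expR (- t))).
  rewrite ler_wpM2r ?expR_ge0// (le_trans (ler_norm_sum _ _ _))//.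
  by apply: ler_sum => i _; rewrite normrM [X in _ * X <= _]ger0_norm ?exprn_ge0.
rewrite mulr_suml; apply: ler_sum => i _.
by rewrite -mulrA ler_wpM2l// mon.
Qed.

(* The derivatives of [exp (-1/x)] are of the form [P (1/x) exp (-1/x)]. *)
Definition expinv P x : R := if 0 < x then P.[x^-1] * expR (- x^-1) else 0.

Lemma is_derive_expinv P x :
  is_derive x 1 (expinv P) (expinv ('X^2 * (P - P^`())) x).
Proof.
have [x0|x0|->] := ltgtP x 0.
- rewrite {2}/expinv ltNge (ltW x0)/=.
  apply: (@near_eq_is_derive _ _ _ (cst 0)).
  near=> y; rewrite /expinv ltNge (_ : y <= 0)//.
  by apply: ltW; near: y; exact: lt_nbhsl.
- rewrite {2}/expinv x0/=.
  apply: (@near_eq_is_derive _ _ _ (fun y => P.[y^-1] * expR (- y^-1))).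
    by near=> y; rewrite /expinv (_ : 0 < y)//; near: y; exact: lt_nbhsr.
  have xn0 : x != 0 by rewrite gt_eqF.
  have h1 := @is_deriveV R id x 1 1 xn0 (is_derive_id _ _).
  have h2 := @is_derive1_comp R (horner P) (fun y => y^-1) x _ _ (is_derive_poly P _) h1.
  have h3 := @is_derive1_comp R expR (fun y => - y^-1) x _ _ (is_derive_expR _) (is_deriveN h1).
  apply: is_derive_eq (is_deriveM h2 h3) _.
  rewrite /GRing.scale/= hornerM hornerXn hornerD hornerN exprVn; ring.
- rewrite {2}/expinv ltxx.
  (* For h > 0 and t = 1 / h, the difference quotient at 0 is h times (X^2 P)(t) exp (-t), hence
     O(h). *)
  have [C C0 hC] := poly_expR_bounded ('X^2 * P).
  have bnd h : `|h^-1 * expinv P h| <= C * `|h|.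
    rewrite /expinv; case: ifPn => h0; last by rewrite mulr0 normr0 mulr_ge0.
    have hi : 0 <= h^-1 by rewrite invr_ge0 ltW.
    have := hC _ hi; rewrite hornerM hornerXn -(ler_pM2r h0) => h1.
    rewrite (gtr0_norm h0); apply: le_trans h1.
    rewrite !normrM (ger0_norm hi) (ger0_norm (expR_ge0 _)).
    rewrite le_eqVlt; apply/orP; left; apply/eqP.
    by field; rewrite gt_eqF.
  have cv : h^-1 *: (expinv P (h *: 1 + 0) - expinv P 0) @[h --> 0^'] --> (0 : R).
    apply/cvgr0Pnorm_le => e e0.
    near=> h; rewrite [expinv P 0]/expinv ltxx subr0 addr0 /GRing.scale/= mulr1.
    apply: le_trans (bnd _) _.
    rewrite (@le_trans _ _ ((C + 1) * `|h|))// ?ler_wpM2r ?lerDl//.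
    rewrite mulrC -ler_pdivlMr ?ltr_wpDl//.
    near: h; apply: dnbhs0_le; by rewrite divr_gt0 ?ltr_wpDl.
  split; first by apply/cvg_ex; exists 0.
  exact/cvg_lim.
Unshelve. all: by end_near. Qed.

Lemma Cn_expinv n P : Cn n (expinv P).
Proof.
elim: n P => // n IH P.
by exists (expinv ('X^2 * (P - P^`()))); split=> // x; exact: is_derive_expinv.
Qed.

Let e x : R := expinv 1 x.

Let e_gt0 x : 0 < x -> 0 < e x.
Proof. by move=> x0; rewrite /e /expinv x0 hornerE mul1r expR_gt0. Qed.

Let e_eq0 x : x <= 0 -> e x = 0.
Proof. by move=> x0; rewrite /e /expinv ltNge x0. Qed.

Let e_ge0 x : 0 <= e x.
Proof. by have [/e_eq0 ->|/e_gt0/ltW] := leP x 0. Qed.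

Definition step x : R := expinv 1 x / (expinv 1 x + expinv 1 (1 - x)).

Let denom_gt0 x : 0 < e x + e (1 - x).
Proof.
have [x0|x0] := leP x 0; last by rewrite ltr_pwDl ?e_gt0.
by rewrite ltr_wpDl ?e_gt0// subr_gt0; lra.
Qed.

Lemma Cn_step n : Cn n step.
Proof.
apply: CnM; first exact: Cn_expinv.
apply: CnV; first by move=> x; rewrite gt_eqF// denom_gt0.
apply: CnD; first exact: Cn_expinv.
apply: (@eq_Cn _ (fun x => expinv 1 (-1 * x + 1))).
  by move=> x; rewrite mulN1r addrC.
by apply: Cn_aff; exact: Cn_expinv.
Qed.

Lemma step_ge0 x : 0 <= step x.
Proof. by rewrite divr_ge0 ?(ltW (denom_gt0 _))//; exact: e_ge0. Qed.

Lemma step_le1 x : step x <= 1.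
Proof. by rewrite ler_pdivrMr ?denom_gt0// mul1r lerDl; exact: e_ge0. Qed.

Lemma step_eq0 x : x <= 0 -> step x = 0.
Proof. by move=> x0; rewrite /step -/(e x) e_eq0// mul0r. Qed.

Lemma step_eq1 x : 1 <= x -> step x = 1.
Proof.
move=> x1; rewrite /step -/(e x) -/(e (1 - x)) (@e_eq0 (1 - x)) ?subr_le0//.
by rewrite addr0 divff// gt_eqF// e_gt0// (lt_le_trans _ x1).
Qed.
End Smooth.

Section TestFunctions.
Context {R : realType}.
Local Notation mu := (@lebesgue_measure R).
Implicit Types (phi f : R -> R) (x y : R).

Lemma test_functionI (D : set R) phi (s t : R) : (forall n, Cn n phi) ->
  (forall x, phi x != 0 -> s <= x <= t) -> `[s, t]%classic `<=` D ->
  test_function D phi.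
Proof.
move=> /CnP sphi hphi stD; split => //.
have sub : closure [set x | phi x != 0] `<=` `[s, t]%classic.
  rewrite [X in _ `<=` X](closure_id `[s, t]%classic).1; last exact: itv_closed.
  by apply: closure_subset => x /=; rewrite in_itv; exact: hphi.
split; last exact: subset_trans stD.
apply: subclosed_compact sub; first exact: closed_closure.
exact: segment_compact.
Qed.

Lemma test_function_Cn (D : set R) phi n : test_function D phi -> Cn n phi.
Proof. by move=> [/CnP]. Qed.

Lemma test_functionS (D D' : set R) phi : D `<=` D' ->
  test_function D phi -> test_function D' phi.
Proof. by move=> DD' [h [c s]]; split => //; split => //; exact: subset_trans DD'. Qed.

Lemma test_function_bounded (D : set R) phi : test_function D phi ->
  exists2 M : R, 0 < M & forall x, phi x != 0 -> `|x| <= M.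
Proof.
move=> [_ [/compact_bounded [M [_ hM]] _]].
exists (`|M| + 1); first by rewrite ltr_wpDl.
move=> x px; apply: (hM (`|M| + 1)).
  by rewrite (le_lt_trans (ler_norm _))// ltrDl.
exact: subset_closure.
Qed.

Lemma Cn_is_derive phi x : Cn 1 phi -> is_derive x 1 phi (phi^`()%classic x).
Proof.
move=> [phi' [d _]]; have [dx _] := d x.
by split => //; rewrite derive1E.
Qed.

Lemma Cn_derive1 n phi : Cn n.+1 phi -> Cn n phi^`()%classic.
Proof.
move=> [phi' [d hphi']]; apply: eq_Cn hphi' => x.
by have [_ <-] := d x; rewrite derive1E.
Qed.

Lemma Cn_continuous phi : Cn 1 phi -> continuous phi.
Proof.
move=> h x; apply/differentiable_continuous/derivable1_diffP.
by have [] := Cn_is_derive x h.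
Qed.

Lemma derive1_eq0_out phi (M : R) : (forall x, phi x != 0 -> `|x| <= M) ->
  forall x, phi^`()%classic x != 0 -> `|x| <= M.
Proof.
move=> hM x; apply: contra_neqT; rewrite -ltNge => Mx.
rewrite derive1E; apply: derive_val.
apply: (@near_eq_is_derive _ _ _ (cst 0)).
have c : {for x, continuous (fun y : R => `|y|)} by exact: norm_continuous.
near=> y; have [//|/hM] := eqVneq (phi y) 0; rewrite leNgt => /negP[].
near: y; exact: (cvgr_gt _ c).
Unshelve. all: by end_near. Qed.

Lemma compact_supp_bounded f (M : R) : continuous f ->
  (forall x, f x != 0 -> `|x| <= M) -> exists2 C : R, 0 <= C & forall x, `|f x| <= C.
Proof.
move=> cf hM; pose M' := Num.max M 0.
have M0 : - M' <= M' by rewrite ge0_cp// le_max lexx orbT.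
have cn : {within `[- M', M'], continuous (fun x => `|f x|)}.
  by apply: continuous_subspaceT => x; apply: continuous_comp; [exact: cf|exact: norm_continuous].
have [c _ hc] := EVT_max M0 cn.
exists `|f c| => // x; have [->|fx] := eqVneq (f x) 0; first by rewrite normr0.
apply: hc; rewrite in_itv/= -ler_norml (le_trans (hM _ fx))//.
by rewrite le_max lexx.
Qed.

(** The infimum and supremum of the points where [phi] does not vanish lie in the closure of that
    set, hence in the open interval. *)
Lemma test_function_oo (L : R) phi : 0 < L -> test_function `]0, L[ phi ->
  exists s t, [/\ 0 < s, s < t, t < L & forall x, phi x != 0 -> s <= x <= t].
Proof.
move=> L0 [_ [cK KL]]; set A := [set x | phi x != 0] in cK KL.
have [[x0 Ax0]|A0] := pselect (A !=set0); last first.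
  exists (L / 3), (L / 2); split; [lra..|].
  by move=> x px; exfalso; apply: A0; exists x.
have AL x : A x -> 0 < x < L.
  by move=> /subset_closure /KL; rewrite /= in_itv.
have clAE (z : R) : closure A z -> 0 < z < L by move=> /KL; rewrite /= in_itv.
have ub : has_ubound A by exists L => x /AL /andP[_ /ltW].
pose B := [set - x | x in A].
have lb : has_ubound B by exists 0 => _ [x /AL /andP[/ltW x0' _] <-]; rewrite oppr_le0.
have B0 : B !=set0 by exists (- x0), x0.
have sB : 0 < - sup B < L.
  apply: clAE; move: (closure_sup B0 lb) => clB U nU.
  have nV : nbhs (sup B) (-%R @^-1` U).
    have c : - x @[x --> sup B] --> - sup B by apply: cvgN; exact: cvg_id.
    exact: c nU.
  by have [_ [[x Ax <-] /=]] := clB _ nV; rewrite opprK; exists x.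
have sA : 0 < sup A < L by apply: clAE; apply: closure_sup => //; exists x0.
(* Here [- sup B] is the infimum of [A]. Moving the upper end beyond [sup A] makes [s < t]
   strict. *)
exists (- sup B), ((sup A + L) / 2).
have xA x : A x -> - sup B <= x <= sup A.
  move=> Ax; rewrite lerNl; apply/andP; split; apply: sup_upper_bound => //.
  + by exists x.
  + by split => //; exists x0.
have := xA _ Ax0; move/andP: sA => [_ sA]; move/andP: sB => [sB _].
move=> /andP[h1 h2]; split; [lra|lra|lra|].
by move=> x /xA /andP[h3 h4]; apply/andP; split; lra.
Qed.
End TestFunctions.

(** * The fundamental lemma of the calculus of variations and the lemma of du Bois-Reymond *)

Section FundamentalLemma.
Context {R : realType}.
Local Notation mu := (@lebesgue_measure R).
Implicit Types (phi f : R -> R) (x y : R).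

Lemma Rintegral_supp (D : set R) f : (forall x, f x != 0 -> D x) ->
  \int[mu]_(x in D) f x = \int[mu]_x f x.
Proof.
move=> fD; rewrite Rintegral_mkcond; apply: eq_Rintegral => x _.
rewrite patchE; case: ifPn => // /negP xD; have [//|fx] := eqVneq (f x) 0.
by exfalso; apply: xD; rewrite inE; exact: fD.
Qed.

Lemma step_cvg (s y : R) :
  step (n.+1%:R * (y - s)) @[n --> \oo] --> ((s < y)%R%:R : R).
Proof.
have [sy|ys] := ltP s y; last first.
  rewrite (_ : (fun _ => _) = cst 0); first exact: cvg_cst.
  by apply/funext => n; rewrite step_eq0// mulr_ge0_le0// subr_le0.
apply: cvg_near_cst; near=> n; apply: step_eq1.
rewrite -ler_pdivrMr ?subr_gt0// mul1r (@le_trans _ _ n%:R)//; last by rewrite ler_nat.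
by near: n; exact: nbhs_infty_ger.
Unshelve. all: by end_near. Qed.

Lemma Cn_step_shift n (k s : R) : Cn n (fun y => step (k * (y - s))).
Proof.
apply: (@eq_Cn _ _ (fun y => step (k * y + - (k * s)))).
  by move=> y; rewrite mulrBr.
by apply: Cn_aff; exact: Cn_step.
Qed.

(** The indicator of ]s, t] is a pointwise limit of differences of two ever steeper smooth steps,
    bounded by 1. Dominated convergence then applies. *)
Lemma integral_test_eq0_itv f (s t t' : R) : s < t -> t < t' ->
  mu.-integrable `[s, t'] (EFin \o f) ->
  (forall phi, (forall n, Cn n phi) -> (forall x, phi x != 0 -> s <= x <= t') ->
    \int[mu]_x (f x * phi x) = 0) ->
  \int[mu]_(x in `]s, t]) f x = 0.
Proof.
move=> st tt' fi h.
(* With a slope factor of at least 1 / (t' - t), the step starting at t has reached 1 at t', so the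
   difference of the two steps vanishes beyond t'. *)
pose N := Num.bound (t' - t)^-1.
have NN : (t' - t)^-1 < N%:R.
  by apply: archi_boundP; rewrite invr_ge0 subr_ge0 ltW.
pose k n : R := (n + N).+1%:R.
have k0 n : 0 < k n by [].
pose phi n y := step (k n * (y - s)) - step (k n * (y - t)).
have sphi n m : Cn m (phi n).
  apply: CnD; first exact: Cn_step_shift.
  apply: (@eq_Cn _ _ (fun y => -1 * step (k n * (y - t)))).
    by move=> y; rewrite mulN1r.
  by apply: CnM; [exact: Cn_cst|exact: Cn_step_shift].
have suppphi n x : phi n x != 0 -> s <= x <= t'.
  apply: contra_neqT; rewrite negb_and -!ltNge /phi => /orP[xs|t'x].
    by rewrite !step_eq0 ?subrr// mulr_ge0_le0 ?(ltW (k0 n))//; lra.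
  have kt : 1 <= k n * (x - t).
    have h1 : (t' - t)^-1 <= k n.
      by rewrite (le_trans (ltW NN))// ler_nat leqW// leq_addl.
    rewrite -(@mulVf _ (t' - t)) ?gt_eqF ?subr_gt0//.
    by apply: ler_pM; rewrite ?invr_ge0//; lra.
  rewrite !step_eq1 ?subrr//; apply: le_trans kt _.
  by rewrite ler_pM2l//; lra.
have phi1 n x : `|phi n x| <= 1.
  by have := step_ge0 (k n * (x - s)); have := step_ge0 (k n * (x - t));
     have := step_le1 (k n * (x - s)); have := step_le1 (k n * (x - t));
     rewrite /phi ler_norml; lra.
have phi_cvg x : phi n x @[n --> \oo] --> ((s < x)%R%:R - (t < x)%R%:R : R).
  by apply: cvgB; [have := @step_cvg s x|have := @step_cvg t x];
    rewrite -(cvg_shiftn N).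
have mf : measurable_fun `[s, t'] f.
  by apply/measurable_EFinP; exact: measurable_int fi.
have mphi n : measurable_fun setT (phi n).
  by apply: continuous_measurable_fun; exact: (@Cn_continuous _ _ (sphi n 1%N)).
have mlim : measurable_fun setT (fun x : R => (s < x)%R%:R - (t < x)%R%:R : R).
  by apply: measurable_fun_cvg => // n; exact: mphi.
have zero n : (\int[mu]_(x in `[s, t']) (f x * phi n x)%:E = 0)%E.
  have int : mu.-integrable `[s, t'] (EFin \o (fun x => f x * phi n x)).
    apply: le_integrable fi => //.
      by apply/measurable_EFinP/measurable_funM => //; apply: measurable_funTS; exact: mphi.
    by move=> x _ /=; rewrite lee_fin normrM ler_piMr.
  rewrite -(@fineK _ (integral _ _ _)); last exact: integrable_fin_num int.
  have := h (phi n) (sphi n) (suppphi n).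
  rewrite -(@Rintegral_supp `[s, t']%classic); first by rewrite /Rintegral => ->.
  by move=> x; rewrite mulf_eq0 negb_or /= in_itv => /andP[_ /suppphi].
have cv := @dominated_cvg _ (measurableTypeR R) R mu `[s, t']%classic
  (measurable_itv _) (fun n x => (f x * phi n x)%:E)
  (fun x => (f x * ((s < x)%R%:R - (t < x)%R%:R))%:E) (fun x => `|f x|%:E).
have {}cv : (\int[mu]_(x in `[s, t']) (f x * phi n x)%:E)%E @[n --> \oo] -->
   (\int[mu]_(x in `[s, t']) (f x * ((s < x)%R%:R - (t < x)%R%:R))%:E)%E.
  apply: cv => //.
  - move=> n; apply/measurable_EFinP/measurable_funM => //; apply: measurable_funTS; exact: mphi.
  - move=> x _; apply: cvg_EFin; first exact: nearW.
    by apply: cvgMr; exact: phi_cvg.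
  - by have := integrable_norm fi.
  - by move=> n x _; rewrite lee_fin normrM ler_piMr.
have l0 : (\int[mu]_(x in `[s, t']) (f x * ((s < x)%R%:R - (t < x)%R%:R))%:E = 0)%E.
  rewrite -(cvg_lim _ cv)//; under eq_fun do rewrite zero.
  exact: lim_cst.
rewrite /Rintegral (_ : integral _ _ _ = 0%E)//.
rewrite -l0 integral_mkcond [RHS]integral_mkcond.
apply: eq_integral => x _; rewrite !patchE !mem_setE !in_itv/=.
case: (ltP s x) => sx /=; case: (ltP t x) => tx /=;
  rewrite ?subrr ?subr0 ?mulr0 ?mulr1 ?if_same//.
  by rewrite (ltW sx) (le_trans tx (ltW tt')).
by have := lt_le_trans (lt_trans st tx) sx; rewrite ltxx.
Qed.

(** The integrals of [f] over all ]s, y] vanish, and [f] is almost everywhere the derivative of its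
    indefinite integral. *)
Lemma integral_test_eq0_ae f (s t' : R) : s < t' ->
  mu.-integrable `[s, t'] (EFin \o f) ->
  (forall phi, (forall n, Cn n phi) -> (forall x, phi x != 0 -> s <= x <= t') ->
    \int[mu]_x (f x * phi x) = 0) ->
  {ae mu, forall x, s < x < t' -> f x = 0}.
Proof.
move=> st fi h.
pose f1 := f \_ `[s, t'].
have f1i : mu.-integrable setT (EFin \o f1).
  by move: (fi); rewrite integrable_mkcond//= (restrict_EFin f).
have f1i' (y : R) : mu.-integrable `]-oo, y] (EFin \o f1).
  exact: integrableS f1i.
have := FTC1Ny f1i' (open_integrable_locally openT f1i).
apply: filterS; first exact: (ae_filter_ringOfSetsType mu).
move=> x [_ fx] /andP[sx xt].
suff : f1 x = 0 by rewrite /f1 patchE mem_setE in_itv/= !ltW.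
rewrite -fx derive1E; apply: derive_val; apply: (@near_eq_is_derive _ _ _ (cst 0)).
near=> y.
have sy : s < y by near: y; exact: lt_nbhsr.
have yt : y < t' by near: y; exact: lt_nbhsl.
transitivity (\int[mu]_(z in `[s, y]) f z); last first.
  rewrite Rintegral_mkcond [RHS]Rintegral_mkcond; apply: eq_Rintegral => z _.
  rewrite /f1 !patchE !mem_setE !in_itv/=.
  case: (leP z y) => zy; rewrite ?andbF// andbT.
  by rewrite (le_trans zy (ltW yt)) andbT.
rewrite -Rintegral_itv_obnd_cbnd; last first.
  by apply: integrableS fi => //; apply: subset_itv; rewrite bnd_simp// ltW.
apply/esym; apply: (integral_test_eq0_itv sy yt fi) => phi sphi hphi.
exact: h.
Unshelve. all: by end_near. Qed.
End FundamentalLemma.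

Section DuBoisReymond.
Context {R : realType}.
Local Notation mu := (@lebesgue_measure R).
Implicit Types (phi f : R -> R) (x y : R).

Lemma integrableM_bounded (D : set R) f (g : R -> R) (C : R) : measurable D ->
  mu.-integrable D (EFin \o f) -> measurable_fun D g ->
  (forall x, `|g x| <= C) ->
  mu.-integrable D (EFin \o (fun x => f x * g x)).
Proof.
move=> mD fi mg gC.
apply: (@le_integrable _ _ _ mu D mD _ (fun x => C%:E * (f x)%:E)%E).
- apply/measurable_EFinP/measurable_funM => //.
  by apply/measurable_EFinP; exact: measurable_int fi.
- move=> x _ /=; rewrite lee_fin !normrM [leRHS]mulrC ler_wpM2l//.
  by rewrite (le_trans (gC x))// ler_norm.
- exact: integrableZl.
Qed.

Lemma integrable_cst_itv (a b k : R) : mu.-integrable `[a, b] (EFin \o cst k).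
Proof.
apply: measurable_bounded_integrable => //.
  rewrite [X in (X < _)%E](_ : _ = mu `[a, b]%classic)//.
  by rewrite lebesgue_measure_itv/=; case: ifP => _; rewrite ?ltry// -EFinB ltry.
exact: bounded_cst.
Qed.

Lemma integrable_compact_supp phi (M : R) : continuous phi ->
  (forall x, phi x != 0 -> `|x| <= M) -> mu.-integrable setT (EFin \o phi).
Proof.
move=> cphi hM; have [C C0 hC] := compact_supp_bounded cphi hM.
have mphi : measurable_fun setT phi by exact: continuous_measurable_fun.
apply: (@le_integrable _ _ _ mu setT measurableT _ (fun x => (C * \1_(`[- M, M]%classic) x)%:E)).
- exact/measurable_EFinP.
- move=> x _ /=; rewrite lee_fin; have [->|px] := eqVneq (phi x) 0.
    by rewrite normr0.
  rewrite indicE mem_set ?mulr1; last by rewrite /= in_itv/= -ler_norml hM.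
  by rewrite (le_trans (hC x))// ler_norm.
- under eq_fun do rewrite EFinM; apply: integrableZl => //.
  exact: integrable_indic_itv.
Qed.

Lemma is_derive_antiderivative phi x : mu.-integrable setT (EFin \o phi) ->
  continuous phi ->
  is_derive x 1 (fun x => \int[mu]_(t in `]-oo, x]) phi t) (phi x).
Proof.
move=> iphi cphi; have xx : x < x + 1 by rewrite ltrDl.
have i1 : mu.-integrable [set` Interval -oo%O (BRight (x + 1))] (EFin \o phi).
  exact: integrableS iphi.
have [d dE] := continuous_FTC1 xx i1 (ltNyr x) (cphi x).
by apply: DeriveDef; [exact: d|rewrite -derive1E; exact: dE].
Qed.

Lemma Cn_antiderivative n phi : mu.-integrable setT (EFin \o phi) ->
  continuous phi -> Cn n phi ->
  Cn n.+1 (fun x => \int[mu]_(t in `]-oo, x]) phi t).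
Proof.
move=> iphi cphi hphi; exists phi; split => // x.
exact: is_derive_antiderivative.
Qed.

(** Every test function is the derivative of a test function plus a multiple of one fixed bump of
    integral 1. The constant is the integral of [f] against that bump. *)
Lemma du_bois_reymond (L : R) f : 0 < L -> mu.-integrable setT (EFin \o f) ->
  (forall phi, test_function `]0, L[ phi -> \int[mu]_x (f x * phi^`()%classic x) = 0) ->
  exists c, {ae mu, forall x, 0 < x < L -> f x = c}.
Proof.
move=> L0 fi h.
(* It rises from 0 at L / 3 to 1 at 2 L / 3; its derivative is the bump of integral 1. *)
pose sg y := step (3 / L * (y - L / 3)).
have hsg n : Cn n sg by exact: Cn_step_shift.
have sg0 y : y <= L / 3 -> sg y = 0.
  by move=> yL; apply: step_eq0; rewrite mulr_ge0_le0 ?subr_le0// divr_ge0// ltW.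
have sg1 y : 2 * L / 3 <= y -> sg y = 1.
  move=> Ly; apply: step_eq1.
  rewrite mulrC mulrA ler_pdivlMr// mul1r; lra.
have csg : continuous sg^`()%classic by exact: Cn_continuous (Cn_derive1 (hsg 2%N)).
have suppsg x : sg^`()%classic x != 0 -> L / 3 <= x <= 2 * L / 3.
  apply: contra_neqT; rewrite negb_and -!ltNge => /orP[xs|t'x];
    rewrite derive1E; apply: derive_val.
    apply: (@near_eq_is_derive _ _ _ (cst 0)); near=> y.
    by rewrite sg0//; apply: ltW; near: y; exact: lt_nbhsl.
  apply: (@near_eq_is_derive _ _ _ (cst (1 : R) : R -> R)); near=> y.
  by rewrite sg1//; apply: ltW; near: y; exact: lt_nbhsr.
have suppsg' x : sg^`()%classic x != 0 -> `|x| <= L.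
  by move=> /suppsg /andP[h1 h2]; rewrite ler_norml; apply/andP; split; lra.
have [C C0 hC] := compact_supp_bounded csg suppsg'.
have msg : measurable_fun setT sg^`()%classic by exact: continuous_measurable_fun.
pose c := \int[mu]_x (f x * sg^`()%classic x).
exists c.
have key th : test_function `]0, L[ th -> \int[mu]_x (f x * th x) = c * \int[mu]_x th x.
  move=> tth; have [s [t [s0 st tL hst]]] := test_function_oo L0 tth.
  have cth : continuous th by exact: Cn_continuous (test_function_Cn 1 tth).
  have [M M0 hM] := test_function_bounded tth.
  have ith := integrable_compact_supp cth hM.
  have mth : measurable_fun setT th by exact: continuous_measurable_fun.
  have [C' _ hC'] := compact_supp_bounded cth hM.
  pose m := \int[mu]_x th x.
  pose Th x := \int[mu]_(z in `]-oo, x]) th z.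
  have hTh n : Cn n Th.
    by apply: CnS; apply: Cn_antiderivative => //; exact: test_function_Cn tth.
  have dTh x : Th^`()%classic x = th x.
    rewrite derive1E; apply: derive_val; exact: is_derive_antiderivative.
  (* The primitive [Th] equals [m] near L; subtracting [m * sg x] gives it compact support in ]0,
     L[. *)
  pose psi x := Th x + (- m) * sg x.
  have hpsi n : Cn n psi.
    by apply: CnD => //; apply: CnM => //; exact: Cn_cst.
  have dpsi x : psi^`()%classic x = th x - m * sg^`()%classic x.
    rewrite derive1E; apply: derive_val.
    have := is_deriveD (Cn_is_derive x (hTh 1%N)) (is_deriveZ (- m) (Cn_is_derive x (hsg 1%N))).
    by rewrite dTh /GRing.scale/= mulNr.
  have tpsi : test_function `]0, L[ psi.
    apply: (@test_functionI _ _ _ (Num.min s (L / 3)) (Num.max t (2 * L / 3))) => //.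
      move=> x; apply: contra_neqT; rewrite negb_and -!ltNge.
      rewrite lt_min gt_max => /orP[/andP[xs xL]|/andP[tx Lx]].
        rewrite /psi sg0 ?(ltW xL)// mulr0 addr0 /Th.
        rewrite Rintegral_mkcond (_ : _ \_ _ = cst 0) ?Rintegral_cst ?mul0r//.
        apply/funext => z; rewrite patchE mem_setE in_itv/=; case: ifPn => // zx.
        have [//|/hst /andP[sz _]] := eqVneq (th z) 0.
        by have := lt_le_trans xs (le_trans sz zx); rewrite ltxx.
      rewrite /psi sg1 ?(ltW Lx)// mulr1 /Th Rintegral_supp ?subrr// => z /hst.
      by move=> /andP[_ zt]; rewrite /= in_itv/= (le_trans zt)// ltW.
    move=> x /=; rewrite !in_itv/= ge_min le_max => /andP[h1 h2].
    apply/andP; split.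
      by move: h1 => /orP[]; [exact: lt_le_trans|apply: lt_le_trans; lra].
    by move: h2 => /orP[] h2; apply: le_lt_trans h2 _ => //; lra.
  have := h psi tpsi; under eq_Rintegral do rewrite dpsi mulrBr.
  rewrite RintegralB//; last 2 first.
  - exact: (integrableM_bounded measurableT fi mth hC').
  - have := @integrableM_bounded setT f _ (`|m| * C) measurableT fi (measurable_funM (measurable_cst m) msg).
    by apply=> x; rewrite normrM ler_wpM2l.
  move/eqP; rewrite subr_eq0 => /eqP ->.
  under eq_Rintegral do rewrite mulrCA.
  rewrite RintegralZl//; first by rewrite mulrC.
  exact: (integrableM_bounded measurableT fi msg hC).
(* Functions carried by a compact subinterval are test functions on ]0, L[, so [f = c] is obtained
   on each member of a countable exhaustion. *)
have [s_ [t_ [st_ cover]]] : exists s_ t_ : nat -> R,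
    (forall n, [/\ 0 < s_ n, s_ n < t_ n & t_ n < L]) /\
    (forall x, 0 < x < L -> exists n, s_ n < x < t_ n).
  exists (fun n => L / n.+3%:R), (fun n => L - L / n.+3%:R); split.
    move=> n; have h3 : n.+3%:R^-1 <= 3^-1 :> R by rewrite lef_pV2 ?posrE// ler_nat.
    have h0 : 0 < n.+3%:R^-1 :> R by rewrite invr_gt0.
    have h1 : L * n.+3%:R^-1 <= L * 3^-1 by rewrite ler_wpM2l// ltW.
    have h2 : 0 < L * n.+3%:R^-1 by rewrite mulr_gt0.
    by move: h1 h2; move: (L / n.+3%:R) => w h1 h2; split; lra.
  move=> x /andP[x0 xL]; pose m := Num.min x (L - x).
  have m0 : 0 < m by rewrite lt_min x0 subr_gt0.
  exists (Num.bound (L / m)).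
  have : L / m < (Num.bound (L / m)).+3%:R.
    apply: lt_le_trans (archi_boundP _) _; first by rewrite divr_ge0// ltW.
    by rewrite ler_nat -addn3 leq_addr.
  rewrite ltr_pdivrMr// mulrC -ltr_pdivrMr// => h1.
  move: h1; rewrite lt_min; move: (L / _) => w /andP[h1 h2].
  by apply/andP; split; lra.
have : forall n, {ae mu, forall x, s_ n < x < t_ n -> f x - c = 0}.
  move=> n; have [sn0 snt tnL] := st_ n.
  have fin : mu.-integrable `[s_ n, t_ n] (EFin \o (fun x => f x - c)).
    under [X in _.-integrable _ X]eq_fun do rewrite /= EFinB.
    apply: integrableB => //; first exact: integrableS fi.
    exact: integrable_cst_itv.
  have := integral_test_eq0_ae snt fin; apply => phi hphi suppphi.
  have tphi : test_function `]0, L[ phi.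
    apply: (test_functionI hphi suppphi) => x /=; rewrite !in_itv/= => /andP[h1 h2].
    by rewrite (lt_le_trans sn0 h1) (le_lt_trans h2 tnL).
  have cphi : continuous phi by exact: Cn_continuous (hphi 1%N).
  have [M M0 hM] := test_function_bounded tphi.
  have [C' _ hC'] := compact_supp_bounded cphi hM.
  under eq_Rintegral do rewrite mulrBl.
  rewrite RintegralB//; last 2 first.
  - apply: (integrableM_bounded measurableT fi _ hC'); exact: continuous_measurable_fun.
  - exact: (integrableZl measurableT c (integrable_compact_supp cphi hM)).
  rewrite key// RintegralZl ?subrr//; exact: integrable_compact_supp hM.
move=> /ae_foralln; apply: filterS => x hx /cover [n /hx] /eqP.
by rewrite subr_eq0 => /eqP.
Unshelve. all: by end_near. Qed.
End DuBoisReymond.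

(** * Kernels of the fractional integrals *)

Section Kernels.
Context {R : realType}.
Local Notation mu := (@lebesgue_measure R).
Implicit Types (phi u v f : R -> R) (x y : R).

(** For nonzero [c], both functions are integrable or neither is. In the latter case the extended
    integrals are infinite and both real integrals are 0. *)
Lemma RintegralMl (c : R) f : measurable_fun setT f ->
  \int[mu]_x (c * f x) = c * \int[mu]_x f x.
Proof.
move=> mf; have [->|c0] := eqVneq c 0.
  by rewrite mul0r; under eq_Rintegral do rewrite mul0r; rewrite Rintegral_cst ?mul0r.
have mcf : measurable_fun setT (fun x => c * f x) by exact: measurable_funM.
have [fi|fni] := pselect (mu.-integrable setT (EFin \o f)).
  exact: RintegralZl.
have nfin (h : R -> R) : measurable_fun setT h -> ~ mu.-integrable setT (EFin \o h) ->
    \int[mu]_x h x = 0.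
  move=> mh hni; rewrite /Rintegral.
  suff : ~~ ((\int[mu]_x (h x)%:E)%E \is a fin_num) by case: integral.
  apply/negP => hfin; apply: hni; apply/integrableP; split; first exact/measurable_EFinP.
  by rewrite integral_fin_num_abs//; exact/measurable_EFinP.
rewrite (nfin f)// (nfin (fun x => c * f x)) ?mulr0// => cfi; apply: fni.
have := integrableZl measurableT c^-1 cfi.
by apply: eq_integrable => // x _ /=; rewrite -EFinM mulKf.
Qed.

Lemma measurable_section1 (H : R -> R -> R) y :
  measurable_fun setT (fun z : R * R => H z.1 z.2) ->
  measurable_fun setT (fun x => H x y).
Proof. by move=> mH; exact: (measurableT_comp mH (measurable_pair2 y)). Qed.

Lemma measurable_section2 (H : R -> R -> R) x :
  measurable_fun setT (fun z : R * R => H z.1 z.2) ->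
  measurable_fun setT (H x).
Proof. by move=> mH; exact: (measurableT_comp mH (measurable_pair1 x)). Qed.

Lemma measurable_comp1 f : measurable_fun setT f ->
  measurable_fun setT (fun z : R * R => f z.1).
Proof. by move=> mf; exact: (measurableT_comp mf measurable_fst). Qed.

Lemma measurable_comp2 f : measurable_fun setT f ->
  measurable_fun setT (fun z : R * R => f z.2).
Proof. by move=> mf; exact: (measurableT_comp mf measurable_snd). Qed.

(** A bound on the inner integral that is uniform on the support of [u] makes the double integral
    absolutely convergent. The exchanges for J, V and T are instances, with the kernel, an indicator
    and [kappa] as [H]. *)
Lemma Rfubini_kernel u phi (H : R -> R -> R) (C : R) :
  mu.-integrable setT (EFin \o u) -> measurable_fun setT phi ->
  measurable_fun setT (fun z : R * R => H z.1 z.2) ->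
  (forall x, u x != 0 -> (\int[mu]_y (`|phi y * H x y|)%:E <= C%:E)%E) ->
  [/\ mu.-integrable setT (EFin \o (fun x => u x * \int[mu]_y (phi y * H x y))),
      mu.-integrable setT (EFin \o (fun y => phi y * \int[mu]_x (u x * H x y))) &
      \int[mu]_x (u x * \int[mu]_y (phi y * H x y)) =
      \int[mu]_y (phi y * \int[mu]_x (u x * H x y))].
Proof.
move=> ui mphi mH hC.
have mu_ : measurable_fun setT u by apply/measurable_EFinP; exact: measurable_int ui.
pose F x y := u x * (phi y * H x y).
have mF : measurable_fun setT (fun z : R * R => F z.1 z.2).
  apply: measurable_funM; first exact: measurable_comp1.
  by apply: measurable_funM => //; exact: measurable_comp2.
have finF : (\int[mu]_x \int[mu]_y `|(F x y)%:E| < +oo)%E.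
  have uC : mu.-integrable setT (EFin \o (fun x => u x * C)).
    exact: (@integrableM_bounded _ setT u (cst C) `|C|).
  move/integrableP : uC => [muC]; apply: le_lt_trans.
  apply: ge0_le_integral => //.
  - by move=> x _; exact: integral_ge0.
  - apply: (@measurable_fun_fubini_tonelli_F _ _ _ _ R mu (fun z => `|(F z.1 z.2)%:E|)%E).
      by apply/measurableT_comp => //; exact/measurable_EFinP.
    by move=> z; exact: abse_ge0.
  - exact: measurableT_comp.
  - move=> x _; have [ux|ux] := eqVneq (u x) 0.
      rewrite integral0_eq// => y _.
      by rewrite /F ux mul0r abse0.
    under eq_integral do rewrite /F abse_EFin normrM EFinM.
    rewrite ge0_integralZl//; last first.
      by apply/measurable_EFinP; apply: measurableT_comp => //;
         apply: measurable_funM => //; exact: measurable_section2.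
    rewrite /= normrM EFinM; apply: lee_pmul => //.
      by apply: integral_ge0 => y _; rewrite lee_fin.
    by rewrite (le_trans (hC _ ux))// lee_fin ler_norm.
have [i1 i2 e12] := Rfubini mF finF.
have E1 x : \int[mu]_y F x y = u x * \int[mu]_y (phi y * H x y).
  by apply: RintegralMl; apply: measurable_funM => //; exact: measurable_section2.
have E2 y : \int[mu]_x F x y = phi y * \int[mu]_x (u x * H x y).
  rewrite -RintegralMl; last by apply: measurable_funM => //; exact: measurable_section1.
  by apply: eq_Rintegral => x _; rewrite /F mulrCA.
split.
- by move: i1; apply: eq_integrable => // x _ /=; rewrite E1.
- by move: i2; apply: eq_integrable => // y _ /=; rewrite E2.
- by under eq_Rintegral do rewrite -E1; rewrite e12; apply: eq_Rintegral => y _.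
Qed.

Lemma measurable_bool_natr d (T : measurableType d) (b : T -> bool) :
  measurable_fun setT b -> measurable_fun setT (fun z => (b z)%:R : R).
Proof.
move=> mb; have -> : (fun z => (b z)%:R : R) = (fun z => if b z then 1 else 0).
  by apply/funext => z; case: (b z).
exact: measurable_fun_ifT.
Qed.
End Kernels.

(** * The Riemann-Liouville kernel and its balayage *)

Section FractionalKernels.
Context {R : realType}.
Local Notation mu := (@lebesgue_measure R).

Lemma integral_supp (D : set R) (f g : R -> \bar R) :
  (forall x, D x -> f x = g x) -> (forall x, ~ D x -> f x = 0%E) ->
  (\int[mu]_x f x = \int[mu]_(x in D) g x)%E.
Proof.
move=> fg f0; rewrite [RHS]integral_mkcond; apply: eq_integral => x _.
by rewrite patchE; case: ifPn => [/set_mem/fg|/negP xD]//; apply: f0 => xD'; apply: xD; exact/mem_set.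
Qed.

Lemma measurable_funV d (T : measurableType d) (f : T -> R) :
  measurable_fun setT f -> measurable_fun setT (fun x => (f x)^-1).
Proof. by move=> mf; apply: measurableT_comp mf; exact: measurable_invr. Qed.

Variable al : R.
Hypotheses (al0 : 0 < al) (al1 : al < 1).

Let al1' : 0 < 1 - al. Proof. by rewrite subr_gt0. Qed.

(** The indicator discards the default values of [powR] at negative arguments and lets all integrals
    run over the whole line. *)
Definition rlker (t : R) : R := (0 < t)%R%:R * t `^ (- al).

Lemma rlker_ge0 t : 0 <= rlker t.
Proof. by rewrite mulr_ge0// powR_ge0. Qed.

Lemma rlker_eq0 t : t <= 0 -> rlker t = 0.
Proof. by move=> t0; rewrite /rlker ltNge t0 mul0r. Qed.

Lemma rlkerE t : 0 < t -> rlker t = t `^ (- al).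
Proof. by move=> t0; rewrite /rlker t0 mul1r. Qed.

Lemma measurable_rlker : measurable_fun setT rlker.
Proof.
apply: measurable_funM; last exact: measurable_powR.
by apply: measurable_bool_natr; exact: measurable_fun_ltr.
Qed.

Lemma integral_rlker (c : R) : 0 < c ->
  (\int[mu]_t (rlker t * (t < c)%R%:R)%:E = (c `^ (1 - al) / (1 - al))%:E)%E.
Proof.
move=> c0; rewrite -integral_powR0//; apply: integral_supp => t /=; rewrite in_itv/=.
  by move=> /andP[t0 ->]; rewrite rlkerE// mulr1; congr (_ `^ _)%:E; ring.
move=> /negP; rewrite negb_and -!leNgt => /orP[t0|ct].
  by rewrite rlker_eq0// mul0r.
by rewrite ltNge ct mulr0.
Qed.

(** The kernel has mass 1 / (1 - al) on ]0, 1[ and is at most 1 beyond; hence a bound uniform in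
    [x], as [Rfubini_kernel] demands. *)
Lemma integral_rlkerB (x M : R) : 0 <= M ->
  (\int[mu]_y (rlker (x - y) * (`|y| <= M)%R%:R)%:E <= ((1 - al)^-1 + 2 * M)%:E)%E.
Proof.
move=> M0.
have mK : measurable_fun setT (fun y : R => rlker (x - y)).
  apply: (measurableT_comp measurable_rlker); exact: measurable_funB.
apply: (@le_trans _ _ (\int[mu]_y ((rlker (x - y) * (x - y < 1)%R%:R)%:E + (\1_(`[- M, M]%classic) y)%:E))%E).
  apply: ge0_le_integral => //.
  - by move=> y _; rewrite lee_fin mulr_ge0// rlker_ge0.
  - apply/measurable_EFinP/measurable_funM => //; apply: measurable_bool_natr.
    by apply: measurable_fun_ler => //; exact: measurableT_comp.
  - apply: emeasurable_funD; apply/measurable_EFinP.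
      apply: measurable_funM => //; apply: measurable_bool_natr.
      by apply: measurable_fun_ltr => //; exact: measurable_funB.
    exact: measurable_indic.
  - move=> y _; rewrite -EFinD lee_fin indicE mem_setE in_itv/= -ler_norml.
    case: (leP `|y| M) => yM; last by rewrite mulr0 addr0 mulr_ge0 ?rlker_ge0.
    rewrite mulr1; case: (ltP (x - y) 1) => h; rewrite ?mulr1 ?mulr0 ?lerDl//.
    rewrite add0r rlkerE ?(lt_le_trans ltr01 h)// -(powRr0 (x - y)) ler_powR//.
    by rewrite oppr_le0 ltW.
rewrite ge0_integralD//; last 3 first.
- by move=> y _; rewrite lee_fin mulr_ge0// rlker_ge0.
- apply/measurable_EFinP; apply: measurable_funM => //; apply: measurable_bool_natr.
  by apply: measurable_fun_ltr => //; exact: measurable_funB.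
- by apply/measurable_EFinP; exact: measurable_indic.
rewrite integral_indic// setIT EFinD leeD//.
  have := @integral_rlker 1 ltr01; rewrite powR1 div1r => <-.
  rewrite [leRHS](ge0_integral_aff x Left)//; last 2 first.
  - apply/measurable_EFinP; apply: measurable_funM; first exact: measurable_rlker.
    by apply: measurable_bool_natr; exact: measurable_fun_ltr.
  - by move=> y; rewrite lee_fin mulr_ge0// rlker_ge0.
  rewrite le_eqVlt; apply/orP; left; apply/eqP; rewrite preimage_setT.
  by apply: eq_integral => y _; rewrite /aff /= mulN1r.
rewrite (_ : _ `[- M, M]%classic = mu `[- M, M]%classic)//.
rewrite lebesgue_measure_itv/=; case: ifP => _; last by rewrite lee_fin mulr_ge0.
by rewrite -EFinB lee_fin; lra.
Qed.

Local Notation B := (betaI al).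

Let B0 : 0 < B. Proof. exact: betaI_gt0. Qed.

(* Balayage of the kernel [x |-> (x + Y)^(-al)] onto the half-line [0 < S] *)
Definition rho (Y S : R) : R :=
  (0 < S)%R%:R * (B^-1 * Y `^ (1 - al)) * (S `^ (al - 1) / (Y + S)).

Lemma rho_ge0 Y S : 0 < Y -> 0 <= rho Y S.
Proof.
move=> Y0; rewrite /rho; have [S0|_] := ltP 0 S; last by rewrite !mul0r.
by rewrite !mulr_ge0 ?powR_ge0 ?invr_ge0 ?(ltW B0)// addr_ge0// ltW.
Qed.

Lemma measurable_rho Y : measurable_fun setT (rho Y).
Proof.
apply: measurable_funM.
  apply: measurable_funM => //; apply: measurable_bool_natr.
  exact: measurable_fun_ltr.
apply: measurable_funM; first exact: measurable_powR.
apply: measurable_funV; exact: measurable_funD.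
Qed.

(** The balayage identity: seen from x > 0, the kernel with pole at -Y is an average of kernels with
    poles S > 0. The weight [rho] has total mass 1. *)
Lemma integral_rho_rlker (x Y : R) : 0 < x -> 0 < Y ->
  (\int[mu]_S (rho Y S * rlker (x - S))%:E = (rlker (x + Y))%:E)%E.
Proof.
move=> x0 Y0.
transitivity (\int[mu]_(S in `]0%R, x[) ((B^-1 * Y `^ (1 - al))%:E *
    ((x - S) `^ (- al) * (S `^ (al - 1) / (Y + S)))%:E))%E.
  apply: integral_supp => S /=; rewrite in_itv/=.
    move=> /andP[S0 Sx]; rewrite -EFinM rlkerE ?subr_gt0// /rho S0 mul1r; congr _%:E; ring.
  move=> /negP; rewrite negb_and -!leNgt => /orP[S0|xS].
    by rewrite /rho ltNge S0 !mul0r.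
  by rewrite rlker_eq0 ?subr_le0// mulr0.
rewrite ge0_integralZl//.
- rewrite integral_balayage// -EFinM; congr _%:E.
  rewrite rlkerE ?addr_gt0// -(opprB al 1) (powRN Y); field.
  by rewrite !gt_eqF// powR_gt0.
- apply/measurable_EFinP; apply: measurable_funTS; apply: measurable_funM.
    apply: (measurableT_comp (measurable_powR _)); exact: measurable_funB.
  apply: measurable_funM; first exact: measurable_powR.
  apply: measurable_funV; exact: measurable_funD.
- move=> S /=; rewrite in_itv/= => /andP[S0 _]; rewrite lee_fin mulr_ge0 ?powR_ge0//.
  by rewrite divr_ge0 ?powR_ge0// addr_ge0// ltW.
- by rewrite lee_fin mulr_ge0 ?powR_ge0// invr_ge0 ltW.
Qed.

(** The same average, taken of the indicator of S < x, which is the kernel of [tail]. *)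
Lemma integral_rho_lt (x Y : R) : 0 < x -> 0 < Y ->
  (\int[mu]_S (rho Y S * (S < x)%R%:R)%:E = (B^-1 * betaF al (x / Y))%:E)%E.
Proof.
move=> x0 Y0.
transitivity (\int[mu]_(S in `]0%R, x[) ((B^-1 * Y `^ (1 - al))%:E *
    (S `^ (al - 1) / (Y + S))%:E))%E.
  apply: integral_supp => S /=; rewrite in_itv/=.
    by move=> /andP[S0 ->]; rewrite -EFinM /rho S0 mul1r mulr1.
  move=> /negP; rewrite negb_and -!leNgt => /orP[S0|xS].
    by rewrite /rho ltNge S0 !mul0r.
  by rewrite ltNge xS mulr0.
rewrite ge0_integralZl//.
- rewrite integral_betaf_scale// -EFinM; congr _%:E.
  rewrite -(opprB al 1) (powRN Y); field.
  by rewrite !gt_eqF// powR_gt0.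
- apply/measurable_EFinP; apply: measurable_funTS.
  apply: measurable_funM; first exact: measurable_powR.
  apply: measurable_funV; exact: measurable_funD.
- move=> S /=; rewrite in_itv/= => /andP[S0 _]; rewrite lee_fin.
  by rewrite divr_ge0 ?powR_ge0// addr_ge0// ltW.
- by rewrite lee_fin mulr_ge0 ?powR_ge0// invr_ge0 ltW.
Qed.

(* [- kappa y Z] is the density at [y < 0] of the fractional derivative of the
   zero extension of the fractional integral of the Dirac mass at [Z > 0]. *)
Definition kappa (y Z : R) : R :=
  (y < 0)%R%:R * (0 < Z)%R%:R * (B^-1 * Z `^ al) * ((- y) `^ (- al) / (- y + Z)).

Lemma kappa_ge0 y Z : 0 <= kappa y Z.
Proof.
rewrite /kappa; have [y0|_] := ltP y 0; last by rewrite !mul0r.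
have [Z0|_] := ltP 0 Z; last by rewrite mulr0 !mul0r.
by rewrite !mulr_ge0 ?powR_ge0 ?invr_ge0 ?(ltW B0)// addr_ge0 ?oppr_ge0// ltW.
Qed.

Lemma measurable_kappa : measurable_fun setT (fun z : R * R => kappa z.1 z.2).
Proof.
apply: measurable_funM; [apply: measurable_funM|apply: measurable_funM].
- apply: measurable_funM; apply: measurable_bool_natr;
    exact: measurable_fun_ltr.
- apply: measurable_funM => //.
  by apply: (@measurable_comp2 _ (fun y : R => y `^ al)); exact: measurable_powR.
- apply: (@measurable_comp1 _ (fun y : R => (- y) `^ (- al))).
  by apply: (measurableT_comp (measurable_powR _)).
- apply: measurable_funV; apply: measurable_funD.
    by apply: (@measurable_comp1 _ (fun y : R => - y)); exact: oppr_measurable.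
  exact: measurable_snd.
Qed.

(** This mass and that of [integral_rho_lt] at x = Z add up to 1. This is the origin of [kappa]: it
    is the derivative in Y of the mass that [rho] puts beyond Z. *)
Lemma integral_kappa_gt (Y Z : R) : 0 < Z -> 0 < Y ->
  (\int[mu]_y ((- Y < y)%R%:R * kappa y Z)%:E = (1 - B^-1 * betaF al (Z / Y))%:E)%E.
Proof.
move=> Z0 Y0.
have mk : measurable_fun setT (fun y => (- Y < y)%R%:R * kappa y Z).
  apply: measurable_funM; last exact: (measurable_section1 Z measurable_kappa).
  by apply: measurable_bool_natr; exact: measurable_fun_ltr.
rewrite (ge0_integral_aff 0 Left)//; last 2 first.
- exact/measurable_EFinP.
- by move=> y; rewrite lee_fin mulr_ge0// kappa_ge0.
rewrite preimage_setT.
transitivity (\int[mu]_(y in `]0%R, Y[) ((B^-1 * Z `^ al)%:E *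
    (y `^ (- al) / (y + Z))%:E))%E.
  apply: integral_supp => y /=; rewrite /aff/= add0r mulN1r in_itv/=.
    by move=> /andP[y0 yY]; rewrite -EFinM /kappa opprK ltrN2 yY oppr_lt0 y0 Z0 !mul1r.
  move=> /negP; rewrite negb_and -!leNgt => /orP[y0|Yy].
    by rewrite /kappa oppr_lt0 [(0 < y)%R]ltNge y0/= !mul0r mulr0.
  by rewrite ltrN2 ltNge Yy/= mul0r.
rewrite ge0_integralZl//.
- rewrite integral_betaf_inv// -EFinM powRN; congr _%:E; field.
  by rewrite !gt_eqF// powR_gt0.
- apply/measurable_EFinP; apply: measurable_funTS.
  apply: measurable_funM; first exact: measurable_powR.
  by apply: measurable_funV; exact: measurable_funD.
- move=> y /=; rewrite in_itv/= => /andP[y0 _]; rewrite lee_fin.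
  by rewrite divr_ge0 ?powR_ge0// addr_ge0// ltW.
- by rewrite lee_fin mulr_ge0 ?powR_ge0// invr_ge0 ltW.
Qed.

(** Since [kappa] is homogeneous of degree -1, integrating it against a power of one variable
    returns the same power of the other, here and in [integral_kappar_weight]. The bounds on [c]
    make the Beta integral converge at both ends. *)
Lemma integral_kappal_weight (c Z : R) : 0 <= c -> c < 1 - al -> 0 < Z ->
  (\int[mu]_y ((- y) `^ (- c) * kappa y Z)%:E =
   (B^-1 * betaI (1 - al - c) * Z `^ (- c))%:E)%E.
Proof.
move=> c0 c1 Z0.
have b0 : 0 < 1 - al - c by rewrite subr_gt0.
have b1 : 1 - al - c < 1 by have := al0; have := al1; lra.
have mk : measurable_fun setT (fun y : R => (- y) `^ (- c) * kappa y Z).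
  apply: measurable_funM; last exact: (measurable_section1 Z measurable_kappa).
  by apply: (measurableT_comp (measurable_powR _)).
rewrite (ge0_integral_aff 0 Left)//; last 2 first.
- exact/measurable_EFinP.
- by move=> y; rewrite lee_fin mulr_ge0 ?powR_ge0// kappa_ge0.
rewrite preimage_setT.
transitivity (\int[mu]_(y in `]0%R, +oo[) ((B^-1 * Z `^ al)%:E *
    (y `^ (1 - al - c - 1) / (Z + y))%:E))%E.
  apply: integral_supp => y /=; rewrite /aff/= add0r mulN1r in_itv/= andbT.
    move=> y0; rewrite -EFinM /kappa opprK oppr_lt0 y0 Z0 !mul1r.
    rewrite (_ : 1 - al - c - 1 = - c - al); last by ring.
    rewrite powRB; last by rewrite (gt_eqF y0) implybT.
    by rewrite (powRN _ al) (addrC y); congr _%:E; ring.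
  by move=> /negP; rewrite -leNgt => y0; rewrite /kappa oppr_lt0 [(0 < y)%R]ltNge y0/= !mul0r mulr0.
rewrite ge0_integralZl//.
- rewrite integral_betaf_scaley// -EFinM; congr _%:E.
  rewrite (_ : 1 - al - c - 1 = - c - al); last by ring.
  rewrite powRB; last by rewrite (gt_eqF Z0) implybT.
  by field; rewrite !gt_eqF// powR_gt0.
- apply/measurable_EFinP; apply: measurable_funTS.
  apply: measurable_funM; first exact: measurable_powR.
  by apply: measurable_funV; exact: measurable_funD.
- move=> y /=; rewrite in_itv/= andbT => y0; rewrite lee_fin.
  by rewrite divr_ge0 ?powR_ge0// addr_ge0// ltW.
- by rewrite lee_fin mulr_ge0 ?powR_ge0// invr_ge0 ltW.
Qed.

Lemma integral_kappar_weight (c Y : R) : al < c -> c < 1 + al -> 0 < Y ->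
  (\int[mu]_Z (Z `^ (- c) * kappa (- Y) Z)%:E =
   (B^-1 * betaI (1 + al - c) * Y `^ (- c))%:E)%E.
Proof.
move=> c0 c1 Y0.
have b0 : 0 < 1 + al - c by rewrite subr_gt0.
have b1 : 1 + al - c < 1 by lra.
transitivity (\int[mu]_(Z in `]0%R, +oo[) ((B^-1 * Y `^ (- al))%:E *
    (Z `^ (1 + al - c - 1) / (Y + Z))%:E))%E.
  apply: integral_supp => Z /=; rewrite in_itv/= andbT.
    move=> Z0; rewrite -EFinM /kappa opprK oppr_lt0 Y0 Z0 !mul1r.
    rewrite (_ : 1 + al - c - 1 = al - c); last by ring.
    rewrite powRB; last by rewrite (gt_eqF Z0) implybT.
    by rewrite (powRN _ c); congr _%:E; ring.
  by move=> /negP; rewrite -leNgt => Z0; rewrite /kappa [(0 < Z)%R]ltNge Z0/= mulr0 !mul0r mulr0.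
rewrite ge0_integralZl//.
- rewrite integral_betaf_scaley// -EFinM; congr _%:E.
  rewrite (_ : 1 + al - c - 1 = al - c); last by ring.
  rewrite powRB; last by rewrite (gt_eqF Y0) implybT.
  by rewrite !powRN; field; rewrite !gt_eqF// powR_gt0.
- apply/measurable_EFinP; apply: measurable_funTS.
  apply: measurable_funM; first exact: measurable_powR.
  by apply: measurable_funV; exact: measurable_funD.
- move=> y /=; rewrite in_itv/= andbT => y0; rewrite lee_fin.
  by rewrite divr_ge0 ?powR_ge0// addr_ge0// ltW.
- by rewrite lee_fin mulr_ge0 ?powR_ge0// invr_ge0 ltW.
Qed.
End FractionalKernels.

(** * The derivative of the zero extension on the half-line *)

Section Pairings.
Context {R : realType}.
Local Notation mu := (@lebesgue_measure R).
Implicit Types (phi psi u v f : R -> R).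

Variable al : R.
Hypotheses (al0 : 0 < al) (al1 : al < 1).

Local Notation K := (rlker al).

(* The factor [1 / Gamma (1 - al)] is omitted from [rlint] and [rlderiv]; it
   enters only as an arbitrary scalar [g]. *)
Definition rlint u (y : R) : R := \int[mu]_x (u x * K (x - y)).

Definition tail v (y : R) : R := \int[mu]_x (v x * (y < x)%R%:R).

Definition rlderiv psi (x : R) : R := \int[mu]_y (psi^`()%classic y * K (x - y)).

Lemma measurable_rlker2 :
  measurable_fun setT (fun z : R * R => K (z.1 - z.2)).
Proof.
apply: (measurableT_comp (measurable_rlker al)).
by apply: measurable_funB; [exact: measurable_fst|exact: measurable_snd].
Qed.

Lemma measurable_lt2 :
  measurable_fun setT (fun z : R * R => (z.2 < z.1)%R%:R : R).
Proof.
by apply: measurable_bool_natr; apply: measurable_fun_ltr; [exact: measurable_snd|exact: measurable_fst].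
Qed.

Lemma rlint_pairing u phi (C M : R) : mu.-integrable setT (EFin \o u) ->
  measurable_fun setT phi -> 0 <= C -> 0 <= M ->
  (forall y, `|phi y| <= C) -> (forall y, phi y != 0 -> `|y| <= M) ->
  [/\ mu.-integrable setT (EFin \o (fun x => u x * \int[mu]_y (phi y * K (x - y)))),
      mu.-integrable setT (EFin \o (fun y => phi y * rlint u y)) &
      \int[mu]_x (u x * \int[mu]_y (phi y * K (x - y))) =
      \int[mu]_y (phi y * rlint u y)].
Proof.
move=> ui mphi C0 M0 phiC phiM.
have [|i0 i e] := @Rfubini_kernel R u phi (fun x y => K (x - y)) (C * ((1 - al)^-1 + 2 * M)) ui mphi measurable_rlker2.
  move=> x _; apply: (@le_trans _ _ (\int[mu]_y (C%:E * (K (x - y) * (`|y| <= M)%R%:R)%:E))%E).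
    apply: ge0_le_integral => //.
    - apply/measurable_EFinP; apply: measurableT_comp => //; apply: measurable_funM => //.
      exact: (@measurable_section2 _ (fun x y => K (x - y)) x measurable_rlker2).
    - apply/measurable_EFinP; apply: measurable_funM => //; apply: measurable_funM.
        exact: (@measurable_section2 _ (fun x y => K (x - y)) x measurable_rlker2).
      by apply: measurable_bool_natr; apply: measurable_fun_ler => //; exact: measurableT_comp.
    - move=> y _; rewrite -EFinM lee_fin normrM (ger0_norm (rlker_ge0 _ _)).
      have [->|py] := eqVneq (phi y) 0.
        by rewrite normr0 mul0r mulr_ge0// mulr_ge0// rlker_ge0.
      by rewrite phiM// mulr1 ler_wpM2r// rlker_ge0.
  rewrite ge0_integralZl//.
  - by rewrite [leRHS]EFinM lee_wpmul2l// integral_rlkerB.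
  - apply/measurable_EFinP; apply: measurable_funM.
      exact: (@measurable_section2 _ (fun x y => K (x - y)) x measurable_rlker2).
    by apply: measurable_bool_natr; apply: measurable_fun_ler => //; exact: measurableT_comp.
  - by move=> y _; rewrite lee_fin mulr_ge0// rlker_ge0.
by apply: And3; [exact: i0|exact: i|exact: e].
Qed.

Lemma rlderiv_pairing (D : set R) u psi : mu.-integrable setT (EFin \o u) ->
  test_function D psi ->
  \int[mu]_x (u x * rlderiv psi x) = \int[mu]_y (psi^`()%classic y * rlint u y).
Proof.
move=> ui tpsi; have [M M0 hM] := test_function_bounded tpsi.
have hM' := derive1_eq0_out hM.
have cpsi : continuous psi^`()%classic.
  exact: Cn_continuous (Cn_derive1 (test_function_Cn 2 tpsi)).
have [C C0 hC] := compact_supp_bounded cpsi hM'.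
have [_ _] := rlint_pairing ui (continuous_measurable_fun cpsi) C0 (ltW M0) hC hM'.
by [].
Qed.

Lemma tail_pairing v phi : mu.-integrable setT (EFin \o v) ->
  mu.-integrable setT (EFin \o phi) ->
  [/\ mu.-integrable setT (EFin \o (fun x => v x * \int[mu]_y (phi y * (y < x)%R%:R))),
      mu.-integrable setT (EFin \o (fun y => phi y * tail v y)) &
      \int[mu]_x (v x * \int[mu]_y (phi y * (y < x)%R%:R)) =
      \int[mu]_y (phi y * tail v y)].
Proof.
move=> vi phii.
have mphi : measurable_fun setT phi by apply/measurable_EFinP; exact: measurable_int phii.
have phifin : (\int[mu]_y `|(phi y)%:E|)%E \is a fin_num.
  by have := integrable_fin_num measurableT (integrable_abse phii).
have [|i0 i e] := @Rfubini_kernel R v phi (fun x y => (y < x)%R%:R)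
    (fine (\int[mu]_y `|(phi y)%:E|)%E) vi mphi measurable_lt2.
  move=> x _; rewrite fineK//; apply: ge0_le_integral => //.
  - apply/measurable_EFinP; apply: measurableT_comp => //; apply: measurable_funM => //.
    exact: (@measurable_section2 _ (fun x y => (y < x)%R%:R) x measurable_lt2).
  - by apply: measurableT_comp => //; exact/measurable_EFinP.
  - move=> y _; rewrite lee_fin normrM ler_piMr// ger0_norm//.
    by case: (y < x).
by apply: And3; [exact: i0|exact: i|exact: e].
Qed.

Lemma integral_derive1_lt (D : set R) psi (x : R) : test_function D psi ->
  \int[mu]_y (psi^`()%classic y * (y < x)%R%:R) = psi x.
Proof.
move=> tpsi; have [M M0 hM] := test_function_bounded tpsi.
have hM' := derive1_eq0_out hM.
have cpsi : continuous psi^`()%classic.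
  exact: Cn_continuous (Cn_derive1 (test_function_Cn 2 tpsi)).
have zero y : M < `|y| -> psi y = 0.
  by move=> My; apply: contraTeq My => /hM; rewrite -leNgt.
(* A point to the left of both [x] and the support of [psi]. *)
pose a := - (M + 1 + `|x|).
have ax : a < x by rewrite /a ltrNl; have := ler_norm (- x); rewrite normrN; lra.
rewrite /Rintegral.
transitivity (fine (\int[mu]_(y in `[a, x]) (psi^`()%classic y)%:E)%E).
  rewrite -integral_itv_bndo_bndc; last first.
    by apply/measurable_EFinP/measurable_funTS; exact: continuous_measurable_fun.
  congr fine; apply: integral_supp => y /=; rewrite in_itv/=.
    by move=> /andP[_ ->]; rewrite mulr1.
  move=> /negP; rewrite negb_and -ltNge => /orP[ya|/negbTE ->]; last by rewrite mulr0.
  have [->|/hM'] := eqVneq (psi^`()%classic y) 0; first by rewrite mul0r.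
  rewrite ler_norml => /andP[My _]; exfalso.
  by move: ya; rewrite /a; have := normr_ge0 x; lra.
rewrite (@continuous_FTC2 _ _ psi)//.
- by rewrite -EFinB/= (zero a) ?subr0// /a normrN ger0_norm; have := normr_ge0 x; lra.
- exact: continuous_subspaceT.
- have cp : continuous psi by exact: Cn_continuous (test_function_Cn 1 tpsi).
  split.
  + by move=> y _; have [] := Cn_is_derive y (test_function_Cn 1 tpsi).
  + by apply: cvg_at_right_filter; exact: cp.
  + by apply: cvg_at_left_filter; exact: cp.
Qed.

(** In the sense of distributions, -v is the derivative of [tail v]. With [rlderiv_pairing], the
    definition of the weak derivative becomes a condition on g J - V tested against derivatives. *)
Lemma derive1_pairing (D : set R) v psi : mu.-integrable setT (EFin \o v) ->
  test_function D psi ->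
  \int[mu]_x (v x * psi x) = \int[mu]_y (psi^`()%classic y * tail v y).
Proof.
move=> vi tpsi; have [M M0 hM] := test_function_bounded tpsi.
have hM' := derive1_eq0_out hM.
have cpsi : continuous psi^`()%classic.
  exact: Cn_continuous (Cn_derive1 (test_function_Cn 2 tpsi)).
have [_ _ <-] := tail_pairing vi (integrable_compact_supp cpsi hM').
by apply: eq_Rintegral => x _; rewrite (integral_derive1_lt x tpsi).
Qed.
End Pairings.

Section RepresentationByTail.
Context {R : realType}.
Local Notation mu := (@lebesgue_measure R).
Implicit Types (phi psi u v f : R -> R).

Lemma Rintegral_eq0 f : (forall x, f x = 0) -> \int[mu]_x f x = 0.
Proof. by move=> f0; rewrite /Rintegral integral0_eq// => x _; rewrite f0. Qed.

Lemma derive1_supp (A : set R) psi : closed A -> (forall x, psi x != 0 -> A x) ->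
  forall x, psi^`()%classic x != 0 -> A x.
Proof.
move=> clA hA x; apply: contra_neqP => nAx.
rewrite derive1E; apply: derive_val; apply: (@near_eq_is_derive _ _ _ (cst 0)).
have nb : nbhs x (~` A) by apply: open_nbhs_nbhs; split => //; exact: closed_openC.
near=> y; have [//|/hA] := eqVneq (psi y) 0.
by suff : (~` A) y by []; near: y.
Unshelve. all: by end_near. Qed.

Lemma Rintegral_le_fin f (c : R) :
  (\int[mu]_x (f x)%:E <= c%:E)%E -> (forall x, 0 <= f x) -> \int[mu]_x f x <= c.
Proof.
move=> fc f0; rewrite -lee_fin /Rintegral fineK// ge0_fin_numE.
  exact: le_lt_trans fc (ltry _).
by apply: integral_ge0 => x _; rewrite lee_fin.
Qed.

Lemma integral_slice (L t : R) : 0 < t ->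
  (\int[mu]_y ((L - t < y < L)%R%:R)%:E = t%:E)%E.
Proof.
move=> t0; rewrite (@integral_supp _ `]L - t, L[%classic _ (cst 1%E)).
- rewrite integral_cst//= mul1e lebesgue_measure_itv/= lte_fin ltrBlDr ltrDl t0 -EFinB/=.
  by rewrite opprB addrC subrK.
- by move=> y /=; rewrite in_itv/= => ->.
- by move=> y /negP; rewrite /= in_itv/= => /negbTE ->.
Qed.

Lemma integral_slice_lt (L t x : R) : 0 < t ->
  `|\int[mu]_y ((L - t < y < L)%R%:R * (y < x)%R%:R)| <= t * (L - t < x)%R%:R.
Proof.
move=> t0; rewrite ger0_norm; last by apply: Rintegral_ge0 => y _; rewrite mulr_ge0.
case: (ltP (L - t) x) => tx; last first.
  rewrite mulr0 le_eqVlt Rintegral_eq0 ?eqxx// => y.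
  case: (ltP (L - t) y) => ty; last by rewrite mul0r.
  by rewrite (ltNge y x) (ltW (le_lt_trans tx ty)) mulr0.
rewrite mulr1; apply: Rintegral_le_fin; last by move=> y; rewrite mulr_ge0.
rewrite -(integral_slice L t0).
have mI : measurable_fun setT (fun y : R => (L - t < y < L)%R%:R : R).
  by apply: measurable_bool_natr; apply: measurable_and; exact: measurable_fun_ltr.
apply: ge0_le_integral => //.
- by apply/measurable_EFinP; apply: measurable_funM => //; apply: measurable_bool_natr; exact: measurable_fun_ltr.
- exact/measurable_EFinP.
- by move=> y _; rewrite lee_fin ler_piMr//; case: (y < x).
Qed.

Lemma powR1B (r t : R) : 0 < t -> t `^ (1 - r) = t / t `^ r.
Proof. by move=> t0; rewrite powRB ?powRr1 ?(ltW t0)// (gt_eqF t0) implybT. Qed.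

(** Dominated convergence: a point x < L leaves the slice as soon as t < L - x. *)
Lemma cvg_tail0 (L : R) v : mu.-integrable setT (EFin \o v) ->
  (forall x, v x != 0 -> x < L) -> forall e : R, 0 < e ->
  \forall t \near 0^'+, \int[mu]_x (`|v x| * (L - t < x)%R%:R) <= e.
Proof.
move=> vi vL e e0.
have mv : measurable_fun setT v by apply/measurable_EFinP; exact: measurable_int vi.
have mb (t : R) : measurable_fun setT (fun x : R => (L - t < x)%R%:R : R).
  by apply: measurable_bool_natr; exact: measurable_fun_ltr.
suff cv : \int[mu]_x (`|v x| * (L - t < x)%R%:R) @[t --> 0^'+] --> (0 : R).
  move/cvgr0Pnorm_le : cv => /(_ _ e0); apply: filterS => t.
  by apply: le_trans; exact: ler_norm.
apply/cvg_at_rightP => s [s0 scvg].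
have cv : (\int[mu]_x (`|v x| * (L - s n < x)%R%:R)%:E)%E @[n --> \oo] -->
    (\int[mu]_x (cst 0 x))%E.
  apply: (@dominated_cvg _ (measurableTypeR R) R mu setT measurableT
    (fun n x => (`|v x| * (L - s n < x)%R%:R)%:E) (cst 0%E) (fun x => `|v x|%:E)) => //.
  - move=> n; apply/measurable_EFinP; apply: measurable_funM; last exact: mb.
    exact: measurableT_comp.
  - move=> x _; apply: cvg_near_cst; have [->|/vL xL] := eqVneq (v x) 0.
      by apply: nearW => n; rewrite normr0 mul0r.
    near=> n; rewrite ltNge (_ : x <= _) ?mulr0//.
    have : s n < L - x by near: n; apply: (cvgr_lt _ scvg); rewrite subr_gt0.
    by lra.
  - by have := integrable_norm vi.
  - move=> n x _; rewrite lee_fin normrM normr_id ler_piMr// ger0_norm//.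
    by case: (_ < _).
rewrite integral0 in cv.
exact: (fine_cvg cv).
Unshelve. all: by end_near. Qed.

Variable al : R.
Hypotheses (al0 : 0 < al) (al1 : al < 1).

Local Notation K := (rlker al).

(** As x < L, the slice meets the kernel only at arguments in ]0, t[, where its mass is t^(1 - al) /
    (1 - al). To reach o(t), the mass of u near L must therefore be o(t^al). *)
Lemma integral_slice_rlker (L t x : R) : 0 < t -> x < L ->
  `|\int[mu]_y ((L - t < y < L)%R%:R * K (x - y))| <=
    t `^ (1 - al) / (1 - al) * (L - t < x)%R%:R.
Proof.
move=> t0 xL; rewrite ger0_norm; last first.
  by apply: Rintegral_ge0 => y _; rewrite mulr_ge0// rlker_ge0.
case: (ltP (L - t) x) => tx; last first.
  rewrite mulr0 le_eqVlt Rintegral_eq0 ?eqxx// => y.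
  case: (ltP (L - t) y) => ty; last by rewrite mul0r.
  by rewrite rlker_eq0 ?mulr0// subr_le0 ltW// (le_lt_trans tx).
rewrite mulr1; apply: Rintegral_le_fin; last first.
  by move=> y; rewrite mulr_ge0// rlker_ge0.
have mF : measurable_fun setT (fun y : R => K (x - y)).
  exact: (@measurable_section2 _ (fun x y => K (x - y)) x (measurable_rlker2 al)).
rewrite -integral_rlker// [leRHS](ge0_integral_aff x Left)//; last 2 first.
- apply/measurable_EFinP; apply: measurable_funM; first exact: measurable_rlker.
  by apply: measurable_bool_natr; exact: measurable_fun_ltr.
- by move=> y; rewrite lee_fin mulr_ge0// rlker_ge0.
rewrite preimage_setT; apply: ge0_le_integral => //.
- by move=> y _; rewrite lee_fin mulr_ge0// rlker_ge0.
- apply/measurable_EFinP; apply: measurable_funM => //.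
  by apply: measurable_bool_natr; apply: measurable_and; exact: measurable_fun_ltr.
- apply/measurable_EFinP; rewrite /aff/=; under eq_fun do rewrite mulN1r.
  apply: measurable_funM => //; apply: measurable_bool_natr.
  by apply: measurable_fun_ltr => //; exact: measurable_funB.
- move=> y _; rewrite lee_fin /aff/= mulN1r mulrC ler_wpM2l ?rlker_ge0// ler_nat.
  case: (ltP (L - t) y) => //= ty; case: (ltP y L) => //= yL.
  by rewrite (_ : x - y < t)//; lra.
Qed.

Lemma rlint_eq_tail (g L : R) u v : 0 < L ->
  mu.-integrable setT (EFin \o u) -> mu.-integrable setT (EFin \o v) ->
  (forall x, u x != 0 -> 0 < x < L) -> (forall x, v x != 0 -> 0 < x < L) ->
  (forall e : R, 0 < e -> \forall t \near 0^'+,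
    \int[mu]_x (`|u x| * (L - t < x)%R%:R) <= e * t `^ al) ->
  (forall psi, test_function `]0, L[ psi ->
    \int[mu]_x (v x * psi x) = g * \int[mu]_x (u x * rlderiv al psi x)) ->
  {ae mu, forall y, 0 < y -> g * rlint al u y = tail v y}.
Proof.
move=> L0 ui vi uL vL small hyp.
have al1' : 0 <= 1 - al by rewrite subr_ge0 ltW.
pose I (s y : R) : R := (s < y < L)%R%:R.
have mI s : measurable_fun setT (I s).
  by apply: measurable_bool_natr; apply: measurable_and; exact: measurable_fun_ltr.
have I1 s y : `|I s y| <= 1 by rewrite /I; case: (_ && _); rewrite ?normr1 ?normr0.
have IL s y : 0 <= s -> I s y != 0 -> `|y| <= L.
  move=> s0; rewrite /I; case: (ltP s y) => //= sy; last by rewrite eqxx.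
  case: (ltP y L) => yL; last by rewrite eqxx.
  by move=> _; rewrite gtr0_norm ?(le_lt_trans s0 sy)// ltW.
have Ii s : 0 <= s -> mu.-integrable setT (EFin \o I s).
  move=> s0.
  have := @integrable_indic_itv R s L false true.
  by apply: eq_integrable => // y _; rewrite /= indicE mem_setE in_itv.
have pJ s : 0 <= s -> _ := fun s0 => rlint_pairing al0 al1 ui (mI s) ler01 (ltW L0) (I1 s) (fun y => @IL s y s0).
have pV s : 0 <= s -> _ := fun s0 => tail_pairing vi (Ii s s0).
(* J decays like |y|^(-al) at -oo and need not be integrable, so g J - V is cut to ]0, L[, where the
   test functions live. *)
pose h y := g * (I 0 y * rlint al u y) - I 0 y * tail v y.
have iJ s : 0 <= s -> mu.-integrable setT (EFin \o (fun y => I s y * rlint al u y)).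
  by move=> /pJ [].
have iV s : 0 <= s -> mu.-integrable setT (EFin \o (fun y => I s y * tail v y)).
  by move=> /pV [].
have igJ s : 0 <= s -> mu.-integrable setT (EFin \o (fun y => g * (I s y * rlint al u y))).
  by move=> s0; exact: (integrableZl measurableT g (iJ _ s0)).
have hi : mu.-integrable setT (EFin \o h).
  exact: (integrableB measurableT (igJ _ (lexx 0)) (iV _ (lexx 0))).
have [c hc] : exists c, {ae mu, forall x, 0 < x < L -> h x = c}.
  apply: (du_bois_reymond L0 hi) => psi tpsi.
  have [s [t [s0 st tL hst]]] := test_function_oo L0 tpsi.
  have hst' x : psi^`()%classic x != 0 -> s <= x <= t.
    move=> px; have := @derive1_supp `[s, t]%classic psi (@itv_closed _ _ _ _) _ _ px.
    by rewrite /= in_itv; apply => y /hst; rewrite /= in_itv.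
  have Ipsi y : I 0 y * psi^`()%classic y = psi^`()%classic y.
    have [->|/hst' /andP[sy yt]] := eqVneq (psi^`()%classic y) 0; first by rewrite mulr0.
    by rewrite /I (lt_le_trans s0 sy) (le_lt_trans yt tL) mul1r.
  have cpsi : continuous psi^`()%classic.
    exact: Cn_continuous (Cn_derive1 (test_function_Cn 2 tpsi)).
  have [M M0 hM] := test_function_bounded tpsi.
  have [C C0 hC] := compact_supp_bounded cpsi (derive1_eq0_out hM).
  have mpsi : measurable_fun setT psi^`()%classic by exact: continuous_measurable_fun.
  have hE y : h y * psi^`()%classic y =
      g * (psi^`()%classic y * rlint al u y) - psi^`()%classic y * tail v y.
    by rewrite -{2 3}(Ipsi y) /h; ring.
  under eq_Rintegral do rewrite hE.
  have [_ iJpsi _] := rlint_pairing al0 al1 ui mpsi C0 (ltW M0) hC (derive1_eq0_out hM).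
  have [_ iVpsi _] := tail_pairing vi (integrable_compact_supp cpsi (derive1_eq0_out hM)).
  rewrite RintegralB//; last exact: (integrableZl measurableT g iJpsi).
  apply/eqP; rewrite subr_eq0; apply/eqP; rewrite RintegralZl//.
  by rewrite -(rlderiv_pairing al0 al1 ui tpsi) -(derive1_pairing vi tpsi) hyp.
(* Integrate g J - V = c over ]L - t, L[. The J term is at most |g| t^(1 - al) / (1 - al) times e
   t^al and the V term at most t e, so division by t bounds |c| by a multiple of e. *)
have c0 : c = 0.
  suff : forall e, 0 < e -> `|c| <= e * (`|g| / (1 - al) + 1).
    move=> ce; apply/eqP; rewrite -normr_le0; apply/ler_addgt0Pr => e e0.
    have D0 : 0 < `|g| / (1 - al) + 1.
      by rewrite ltr_wpDl// divr_ge0// subr_ge0 ltW.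
    have := ce _ (divr_gt0 e0 D0); rewrite divfK ?gt_eqF//.
    by rewrite add0r.
  move=> e e0.
  have : \forall t \near 0^'+, [/\ 0 < t < L,
      \int[mu]_x (`|u x| * (L - t < x)%R%:R) <= e * t `^ al &
      \int[mu]_x (`|v x| * (L - t < x)%R%:R) <= e].
    near=> t; split.
    + by apply/andP; split; near: t; [exact: nbhs_right_gt|exact: nbhs_right_lt].
    + by near: t; exact: small.
    + near: t; apply: cvg_tail0 => // x /vL; by case/andP.
  move=> /filter_ex [t [/andP[t0 tL] small_u small_v]].
  have Lt0 : 0 <= L - t by rewrite subr_ge0 ltW.
  have It : \int[mu]_y (I (L - t) y * h y) = c * t.
    transitivity (\int[mu]_y (c * I (L - t) y)).
      rewrite /Rintegral; congr fine; apply: ae_eq_integral => //.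
      - apply/measurable_EFinP; apply: measurable_funM; first exact: mI.
        by apply/measurable_EFinP; exact: measurable_int hi.
      - by apply/measurable_EFinP; apply: measurable_funM; last exact: mI.
      - move: hc; apply: filterS; first exact: (ae_filter_ringOfSetsType mu).
        move=> y hy _ /=; congr _%:E; rewrite /I mulrC.
        case: (ltP (L - t) y) => /= ty; last by rewrite !mulr0.
        case: (ltP y L) => yL; last by rewrite !mulr0.
        by rewrite hy// yL (le_lt_trans Lt0).
    rewrite RintegralMl; last exact: mI.
    by congr (c * _); rewrite /Rintegral integral_slice.
  have Ih y : I (L - t) y * h y =
      g * (I (L - t) y * rlint al u y) - I (L - t) y * tail v y.
    rewrite /h /I; case: (ltP (L - t) y) => /= ty; last by rewrite !mul0r mulr0 subr0.
    case: (ltP y L) => yL; last by rewrite !mul0r mulr0 subr0.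
    by rewrite (le_lt_trans Lt0 ty) !mul1r.
  have [iuA iIJ eIJ] := pJ _ Lt0; have [ivA iIV eIV] := pV _ Lt0.
  have absu := integrable_norm ui; have absv := integrable_norm vi.
  have mlt : measurable_fun setT (fun x : R => (L - t < x)%R%:R : R).
    by apply: measurable_bool_natr; exact: measurable_fun_ltr.
  have lt1 (x : R) : `|(L - t < x)%R%:R| <= 1 :> R.
    by case: (_ < _); rewrite ?normr1 ?normr0.
  have iut := integrableM_bounded measurableT absu mlt lt1.
  have ivt := integrableM_bounded measurableT absv mlt lt1.
  have boundJ : `|\int[mu]_y (I (L - t) y * rlint al u y)| <= t `^ (1 - al) / (1 - al) * (e * t `^ al).
    rewrite -eIJ; apply: (le_trans (le_normr_Rintegral measurableT iuA)).
    apply: (@le_trans _ _ (\int[mu]_x (t `^ (1 - al) / (1 - al) * (`|u x| * (L - t < x)%R%:R)))).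
      apply: le_Rintegral.
      - exact: measurableT.
      - exact: (integrable_norm iuA).
      - exact: (integrableZl measurableT (t `^ (1 - al) / (1 - al)) iut).
      - move=> x _; rewrite normrM; have [->|/uL /andP[x0 xL]] := eqVneq (u x) 0.
          by rewrite normr0 !mul0r mulr0.
        rewrite mulrCA; apply: ler_wpM2l; first exact: normr_ge0.
        exact: integral_slice_rlker.
    rewrite RintegralZl; [|exact: measurableT|exact: iut].
    apply: ler_wpM2l small_u.
    apply: divr_ge0; [exact: powR_ge0|exact: al1'].
  have boundV : `|\int[mu]_y (I (L - t) y * tail v y)| <= t * e.
    rewrite -eIV; apply: (le_trans (le_normr_Rintegral measurableT ivA)).
    apply: (@le_trans _ _ (\int[mu]_x (t * (`|v x| * (L - t < x)%R%:R)))).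
      apply: le_Rintegral.
      - exact: measurableT.
      - exact: (integrable_norm ivA).
      - exact: (integrableZl measurableT t ivt).
      - move=> x _; rewrite normrM mulrCA; apply: ler_wpM2l; first exact: normr_ge0.
        exact: integral_slice_lt.
    rewrite RintegralZl; [|exact: measurableT|exact: ivt].
    apply: ler_wpM2l small_v; exact: ltW.
  have : `|c| * t <= e * (`|g| / (1 - al) + 1) * t.
    rewrite -[X in _ * X <= _](gtr0_norm t0) -normrM -It.
    under eq_Rintegral do rewrite Ih.
    rewrite RintegralB; [|exact: measurableT|exact: igJ|exact: iV].
    rewrite RintegralZl; [|exact: measurableT|exact: iJ].
    apply: (le_trans (ler_normB _ _)).
    rewrite normrM mulrDr mulrDl mulr1 [e * t]mulrC; apply: lerD boundV.
    apply: (le_trans (ler_wpM2l (normr_ge0 g) boundJ)).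
    rewrite (powR1B _ t0) le_eqVlt; apply/orP; left; apply/eqP.
    by field; rewrite !gt_eqF ?powR_gt0 ?subr_gt0.
  by rewrite ler_pM2r.
(* Beyond L both J and V vanish, because u and v are supported to the left of L. *)
move: hc; rewrite c0; apply: filterS; first exact: (ae_filter_ringOfSetsType mu).
move=> y hy y0; have [yL|Ly] := ltP y L.
  have := hy; rewrite /h /I y0 yL !mul1r => /(_ isT) /eqP.
  by rewrite subr_eq0 => /eqP.
rewrite /rlint /tail !Rintegral_eq0 ?mulr0// => x.
  have [->|/vL /andP[_ xL]] := eqVneq (v x) 0; first by rewrite mul0r.
  by rewrite ltNge (ltW (lt_le_trans xL Ly)) mulr0.
have [->|/uL /andP[_ xL]] := eqVneq (u x) 0; first by rewrite mul0r.
by rewrite rlker_eq0 ?mulr0// subr_le0 ltW// (lt_le_trans xL).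
Unshelve. all: by end_near. Qed.
End RepresentationByTail.

(** * Balayage to the negative half-line and the derivative of the zero extension *)

Section ZeroExtension.
Context {R : realType}.
Local Notation mu := (@lebesgue_measure R).
Implicit Types (phi psi u v f : R -> R).

Lemma integral_norm_ge0 f : (forall x, 0 <= f x) ->
  (\int[mu]_x `|f x|%:E = \int[mu]_x (f x)%:E)%E.
Proof. by move=> f0; apply: eq_integral => x _; rewrite ger0_norm. Qed.

Variable al : R.
Hypotheses (al0 : 0 < al) (al1 : al < 1).

Local Notation K := (rlker al).
Local Notation B := (betaI al).

Lemma betaF_le q : 0 < q -> betaF al q <= B.
Proof.
move=> q0; rewrite -subr_ge0 betaFB//; apply: Rintegral_ge0 => x /=.
by rewrite in_itv/= => /andP[qx _]; apply: betaf_ge0; exact: lt_trans qx.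
Qed.

(** The kernel identity integrated against u. For x > 0 the averaged kernel (x + Y)^(-al) is at most
    Y^(-al), which justifies the exchange. *)
Lemma rlint_neg u (Y : R) : mu.-integrable setT (EFin \o u) ->
  (forall x, u x != 0 -> 0 < x) -> 0 < Y ->
  mu.-integrable setT (EFin \o (fun S => rho al Y S * rlint al u S)) /\
  rlint al u (- Y) = \int[mu]_S (rho al Y S * rlint al u S).
Proof.
move=> ui u0 Y0.
have [|_ i e] := @Rfubini_kernel R u (rho al Y) (fun x S => K (x - S)) (Y `^ (- al)) ui
    (measurable_rho al Y) (measurable_rlker2 al).
  move=> x /u0 x0; rewrite integral_norm_ge0; last first.
    by move=> S; rewrite mulr_ge0 ?rho_ge0 ?rlker_ge0.
  rewrite integral_rho_rlker// lee_fin rlkerE ?addr_gt0// !powRN.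
  rewrite lef_pV2 ?posrE ?powR_gt0 ?addr_gt0//.
  apply: ge0_ler_powR; rewrite ?nnegrE ?addr_ge0 ?ltW//.
  by rewrite ltrDr.
split; [exact: i|rewrite -e; apply: eq_Rintegral => x _; rewrite opprK].
have [->|/u0 x0] := eqVneq (u x) 0; first by rewrite !mul0r.
by congr (_ * _); rewrite /Rintegral integral_rho_rlker.
Qed.

Lemma rho_tail v (Y : R) : mu.-integrable setT (EFin \o v) ->
  (forall x, v x != 0 -> 0 < x) -> 0 < Y ->
  mu.-integrable setT (EFin \o (fun S => rho al Y S * tail v S)) /\
  \int[mu]_S (rho al Y S * tail v S) =
    \int[mu]_x (v x * (B^-1 * betaF al (x / Y))).
Proof.
move=> vi v0 Y0; have B0 := betaI_gt0 al0 al1.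
have [|_ i e] := @Rfubini_kernel R v (rho al Y) (fun x S => (S < x)%R%:R) 1 vi
    (measurable_rho al Y) measurable_lt2.
  move=> x /v0 x0; rewrite integral_norm_ge0; last first.
    by move=> S; rewrite mulr_ge0 ?rho_ge0.
  rewrite integral_rho_lt// lee_fin mulrC ler_pdivrMr// mul1r.
  by rewrite betaF_le// divr_gt0.
split; [exact: i|rewrite -e; apply: eq_Rintegral => x _].
have [->|/v0 x0] := eqVneq (v x) 0; first by rewrite !mul0r.
by congr (_ * _); rewrite /Rintegral integral_rho_lt.
Qed.

(** The operator T of the overview. *)
Definition overflow v (y : R) : R := \int[mu]_Z (v Z * kappa al y Z).

Lemma overflow_eq0 v (y : R) : 0 <= y -> overflow v y = 0.
Proof.
by move=> y0; apply: Rintegral_eq0 => Z; rewrite /kappa ltNge y0 !mul0r mulr0.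
Qed.

Lemma measurable_kappaT : measurable_fun setT (fun z : R * R => kappa al z.2 z.1).
Proof.
by apply: (measurableT_comp (measurable_kappa al) (@measurable_swap _ _ _ _)).
Qed.

Lemma integrable_overflow v : mu.-integrable setT (EFin \o v) ->
  (forall x, v x != 0 -> 0 < x) -> mu.-integrable setT (EFin \o overflow v).
Proof.
move=> vi v0; have B0 := betaI_gt0 al0 al1.
have [|_ i _] := @Rfubini_kernel R v (cst 1) (fun x y => kappa al y x)
    (B^-1 * betaI (1 - al)) vi (measurable_cst _) measurable_kappaT.
  move=> x /v0 x0.
  have := @integral_kappal_weight R al al0 al1 0 x (lexx 0) _ x0.
  rewrite subr0 !oppr0 powRr0 mulr1 => <-; last by rewrite subr_gt0.
  rewrite le_eqVlt; apply/orP; left; apply/eqP; apply: eq_integral => y _.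
  by rewrite powRr0 /= mul1r ger0_norm ?kappa_ge0// mul1r.
by move: i; apply: eq_integrable => // y _ /=; rewrite mul1r.
Qed.

Lemma tail_overflow v (Y : R) : mu.-integrable setT (EFin \o v) ->
  (forall x, v x != 0 -> 0 < x) -> 0 < Y ->
  mu.-integrable setT (EFin \o (fun x => v x * (1 - B^-1 * betaF al (x / Y)))) /\
  tail (overflow v) (- Y) = \int[mu]_x (v x * (1 - B^-1 * betaF al (x / Y))).
Proof.
move=> vi v0 Y0; have B0 := betaI_gt0 al0 al1.
have [||i _ e] := @Rfubini_kernel R v (fun y => (- Y < y)%R%:R) (fun x y => kappa al y x)
    1 vi _ measurable_kappaT.
- by apply: measurable_bool_natr; exact: measurable_fun_ltr.
- move=> x /v0 x0; rewrite integral_norm_ge0; last first.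
    by move=> S; rewrite mulr_ge0 ?kappa_ge0.
  rewrite integral_kappa_gt// lee_fin gerBl mulr_ge0 ?invr_ge0 ?(ltW B0)//.
  exact: betaF_ge0.
have E x : v x * \int[mu]_y ((- Y < y)%R%:R * kappa al y x) =
    v x * (1 - B^-1 * betaF al (x / Y)).
  have [->|/v0 x0] := eqVneq (v x) 0; first by rewrite !mul0r.
  by congr (_ * _); rewrite /Rintegral integral_kappa_gt.
split; first by move: i; apply: eq_integrable => // x _ /=; rewrite E.
rewrite /tail; transitivity (\int[mu]_y ((- Y < y)%R%:R * overflow v y)).
  by apply: eq_Rintegral => y _; rewrite mulrC.
by rewrite -e; apply: eq_Rintegral => x _; rewrite E.
Qed.

Lemma tailB v f (y : R) : mu.-integrable setT (EFin \o v) ->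
  mu.-integrable setT (EFin \o f) ->
  tail (fun x => v x - f x) y = tail v y - tail f y.
Proof.
move=> vi fi; have mlt : measurable_fun setT (fun x : R => (y < x)%R%:R : R).
  by apply: measurable_bool_natr; exact: measurable_fun_ltr.
have lt1 (x : R) : `|(y < x)%R%:R| <= 1 :> R.
  by case: (_ < _); rewrite ?normr1 ?normr0.
rewrite /tail -RintegralB; [|exact: measurableT|exact: integrableM_bounded vi mlt lt1|exact: integrableM_bounded fi mlt lt1].
by apply: eq_Rintegral => x _; rewrite mulrBl.
Qed.

Lemma ae_neq0 : {ae mu, forall y : R, y != 0}.
Proof.
exists [set 0]; split; [exact: measurable_set1|exact: lebesgue_measure_set1|].
by move=> y /= /negP; rewrite negbK => /eqP.
Qed.

(** The point is that g J equals the tail of v - T v almost everywhere. For y > 0 this is g J = V,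
    since T v lives on ]-oo, 0[; for y < 0 it is balayage; the point 0 is negligible. *)
Lemma zero_extension_pairing (g L : R) u v : 0 < L ->
  mu.-integrable setT (EFin \o u) -> mu.-integrable setT (EFin \o v) ->
  (forall x, u x != 0 -> 0 < x < L) -> (forall x, v x != 0 -> 0 < x < L) ->
  (forall e : R, 0 < e -> \forall t \near 0^'+,
    \int[mu]_x (`|u x| * (L - t < x)%R%:R) <= e * t `^ al) ->
  (forall psi, test_function `]0, L[ psi ->
    \int[mu]_x (v x * psi x) = g * \int[mu]_x (u x * rlderiv al psi x)) ->
  forall D psi, test_function D psi ->
    \int[mu]_x ((v x - overflow v x) * psi x) = g * \int[mu]_x (u x * rlderiv al psi x).
Proof.
move=> L0 ui vi uL vL small hyp D psi tpsi.
have u0 x : u x != 0 -> 0 < x by move=> /uL /andP[].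
have v0 x : v x != 0 -> 0 < x by move=> /vL /andP[].
have oi := integrable_overflow vi v0.
have wi : mu.-integrable setT (EFin \o (fun x => v x - overflow v x)).
  exact: (integrableB measurableT vi oi).
have pos := rlint_eq_tail al0 al1 L0 ui vi uL vL small hyp.
(* Averaging g J = V with [rho] weights v(x) by the mass of [rho] below x. That weight is 1 minus
   the weight in the tail of T v, and the 1 yields the tail of v, which is its full integral at
   -Y. *)
have neg (Y : R) : 0 < Y -> g * rlint al u (- Y) = tail (fun x => v x - overflow v x) (- Y).
  move=> Y0; have [i1 ->] := rlint_neg ui u0 Y0; have [i2 e2] := rho_tail vi v0 Y0.
  transitivity (\int[mu]_S (rho al Y S * tail v S)).
    rewrite -RintegralZl; [|exact: measurableT|exact: i1].
    rewrite /Rintegral; congr fine; apply: ae_eq_integral => //.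
    - apply/measurable_EFinP; apply: measurable_funM; first exact: measurable_cst.
      by apply/measurable_EFinP; exact: measurable_int i1.
    - exact: measurable_int i2.
    - move: pos; apply: filterS; first exact: (ae_filter_ringOfSetsType mu).
      move=> S hS _ /=; congr _%:E; rewrite mulrCA.
      have [S0|S0] := ltP 0 S; first by rewrite hS.
      by rewrite /rho ltNge S0 !mul0r.
  have [i3 e3] := tail_overflow vi v0 Y0.
  rewrite e2 tailB// e3.
  have -> : tail v (- Y) = \int[mu]_x v x.
    apply: eq_Rintegral => x _; have [->|/v0 x0] := eqVneq (v x) 0; first by rewrite mul0r.
    by rewrite (lt_trans _ x0) ?mulr1// oppr_lt0.
  rewrite -RintegralB; [|exact: measurableT|exact: vi|exact: i3].
  by apply: eq_Rintegral => x _; ring.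
have cpsi : continuous psi^`()%classic.
  exact: Cn_continuous (Cn_derive1 (test_function_Cn 2 tpsi)).
have [M M0 hM] := test_function_bounded tpsi.
have [C C0 hC] := compact_supp_bounded cpsi (derive1_eq0_out hM).
have mpsi : measurable_fun setT psi^`()%classic by exact: continuous_measurable_fun.
have [_ iJpsi _] := rlint_pairing al0 al1 ui mpsi C0 (ltW M0) hC (derive1_eq0_out hM).
have [_ iVpsi _] := tail_pairing wi (integrable_compact_supp cpsi (derive1_eq0_out hM)).
rewrite (rlderiv_pairing al0 al1 ui tpsi) (derive1_pairing wi tpsi).
rewrite -RintegralZl; [|exact: measurableT|exact: iJpsi].
rewrite /Rintegral; congr fine; apply: ae_eq_integral => //.
- exact: measurable_int iVpsi.
- apply/measurable_EFinP; apply: measurable_funM; first exact: measurable_cst.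
  by apply/measurable_EFinP; exact: measurable_int iJpsi.
move: pos ae_neq0; apply: filterS2; first exact: (ae_filter_ringOfSetsType mu).
move=> y hy y0 _ /=; congr _%:E; rewrite mulrCA; congr (_ * _).
have [yneg|ypos|yeq] := ltgtP y 0; last by rewrite yeq eqxx in y0.
  by rewrite -(opprK y) neg ?oppr_gt0.
rewrite hy// tailB// [tail (overflow v) y]Rintegral_eq0 ?subr0// => x.
have [yx|_] := ltP y x; last by rewrite mulr0.
by rewrite overflow_eq0 ?mul0r// ltW// (lt_trans ypos).
Qed.
End ZeroExtension.

(** * The L^p bound *)

Section OverflowLp.
Context {R : realType}.
Local Notation mu := (@lebesgue_measure R).
Implicit Types (u v f : R -> R).

(** Either x <= l or (x / l)^(p - 1) >= 1. With [l] left free and chosen later, this crude Young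
    inequality takes the place of Hölder's, including for p = 1. *)
Lemma young_powR (p l x : R) : 1 <= p -> 0 < l -> 0 <= x ->
  x <= l + l `^ (1 - p) * x `^ p.
Proof.
move=> p1 l0 x0; have [xl|lx] := leP x l.
  by rewrite (le_trans xl)// lerDl mulr_ge0// powR_ge0.
have x0' : 0 < x := lt_trans l0 lx.
rewrite -[leLHS]add0r lerD ?(ltW l0)// (powRS p x0') mulrCA ler_peMr//.
rewrite -opprB powRN mulrC ler_pdivlMr ?powR_gt0// mul1r.
by apply: ge0_ler_powR; rewrite ?nnegrE ?subr_ge0// ltW.
Qed.

(* The infimum over [l] of [l m + l ^ (1 - p) Q] is comparable to its value at
   [l = a / (2 m)]. *)
Lemma powR_le_optim (p a m : R) (Q : \bar R) : 1 <= p -> 0 <= a -> 0 < m ->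
  (0 <= Q)%E ->
  (forall l, 0 < l -> (a%:E <= (l * m)%:E + (l `^ (1 - p))%:E * Q)%E) ->
  ((a `^ p)%:E <= (2 `^ p * m `^ (p - 1))%:E * Q)%E.
Proof.
move=> p1 a0 m0 Q0 h; have p0 : 0 < p := lt_le_trans ltr01 p1.
have c0 : 0 < 2 `^ p * m `^ (p - 1) by rewrite mulr_gt0 ?powR_gt0.
move: a0; rewrite le_eqVlt => /orP[/eqP<-|a0].
  by rewrite powR0 ?gt_eqF// mule_ge0// lee_fin ltW.
case: Q Q0 h => [q||] // Q0 h; last by rewrite gt0_muley ?lte_fin// leey.
(* For this value of [l] the first term is a / 2 and is absorbed by the left-hand side. *)
pose r := a / (2 * m).
have r0 : 0 < r by rewrite divr_gt0 ?mulr_gt0.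
have aE : a = 2 * (r * m) by rewrite /r; field; rewrite gt_eqF.
have := h _ r0; rewrite -EFinM -EFinD lee_fin {1}aE mulr_natl mulr2n lerD2l => hr.
have hq : m * r `^ p <= q.
  rewrite -(ler_pM2l (_ : 0 < r `^ (1 - p))) ?powR_gt0// mulrCA -powRD.
    by rewrite subrK powRr1 1?mulrC// ltW.
  by rewrite (gt_eqF r0) implybT.
have rm0 : 0 <= r * m by rewrite mulr_ge0// ltW.
rewrite -EFinM lee_fin aE powRM// [(r * m) `^ p]powRM ?(ltW r0) ?(ltW m0)//.
rewrite -mulrA ler_wpM2l ?powR_ge0// (powRS _ m0).
by rewrite [m * _]mulrC mulrCA ler_wpM2l ?powR_ge0// mulrC.
Qed.

Variable al : R.
Hypotheses (al0 : 0 < al) (al1 : al < 1).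

Local Notation B := (betaI al).

Variable p : R.
Hypotheses (p1 : 1 <= p) (alp : al * p < 1).

Let p0 : 0 < p. Proof. exact: lt_le_trans p1. Qed.

Let alV : al < p^-1.
Proof. by rewrite -(ltr_pM2r p0) mulVf ?gt_eqF. Qed.

(** The two constants of the Schur test for the weight Z^(-1/p): those of [integral_kappar_weight]
    at c = 1/p and of [integral_kappal_weight] at c = 1 - 1/p. Both exponents are admissible because
    al < 1/p. *)
Definition schur_mass : R := B^-1 * betaI (1 + al - p^-1).

Definition schur_dual_mass : R := B^-1 * betaI (1 - al - (1 - p^-1)).

Definition schur_const : R := 2 `^ p * schur_mass `^ (p - 1) * schur_dual_mass.

Definition weighted_overflow v (y : R) : \bar R :=
  (\int[mu]_Z (`|v Z| `^ p * Z * (Z `^ (- p^-1) * kappa al y Z))%:E)%E.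

Let pV1 : p^-1 <= 1. Proof. by rewrite invf_le1. Qed.

Lemma schur_mass_gt0 : 0 < schur_mass.
Proof.
rewrite mulr_gt0 ?invr_gt0 ?betaI_gt0//.
  by rewrite subr_gt0 (le_lt_trans pV1)// ltrDl.
by rewrite -addrA gtrDl subr_lt0.
Qed.

Lemma schur_dual_mass_gt0 : 0 < schur_dual_mass.
Proof.
rewrite /schur_dual_mass (_ : 1 - al - (1 - p^-1) = p^-1 - al); last by ring.
rewrite mulr_gt0 ?invr_gt0 ?betaI_gt0// ?subr_gt0//.
by rewrite ltrBlDr (le_lt_trans pV1)// ltrDl.
Qed.

Lemma schur_const_gt0 : 0 < schur_const.
Proof.
have m0 := schur_mass_gt0; have d0 := schur_dual_mass_gt0.
by rewrite /schur_const mulr_gt0// mulr_gt0// powR_gt0.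
Qed.

Lemma measurable_kappaZ y : measurable_fun setT (kappa al y).
Proof. exact: (@measurable_section2 _ (kappa al) y (measurable_kappa al)). Qed.

Lemma measurable_norm_powR v : measurable_fun setT v ->
  measurable_fun setT (fun x => `|v x| `^ p).
Proof.
by move=> mv; apply: (measurableT_comp (measurable_powR p)); exact: measurableT_comp.
Qed.

Lemma weighted_kappa_ge0 v y Z :
  0 <= `|v Z| `^ p * Z * (Z `^ (- p^-1) * kappa al y Z).
Proof.
have [Z0|Z0] := ltP 0 Z.
  apply: mulr_ge0; first by rewrite mulr_ge0 ?powR_ge0 ?(ltW Z0).
  by apply: mulr_ge0; [exact: powR_ge0|exact: kappa_ge0].
by rewrite /kappa [0 < Z]ltNge Z0 mulr0 !mul0r !mulr0.
Qed.

Lemma weighted_overflow_ge0 v y : (0 <= weighted_overflow v y)%E.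
Proof. by apply: integral_ge0 => Z _; rewrite lee_fin weighted_kappa_ge0. Qed.

Lemma overflow_le v (Y l : R) : measurable_fun setT v ->
  (forall x, v x != 0 -> 0 < x) -> 0 < Y -> 0 < l ->
  (`|overflow al v (- Y)|%:E <= (l * (schur_mass * Y `^ (- p^-1)))%:E +
    (l `^ (1 - p))%:E * weighted_overflow v (- Y))%E.
Proof.
move=> mv v0 Y0 l0; have mk := measurable_kappaZ (- Y).
have k0 := kappa_ge0 al0 al1.
have mZ : measurable_fun setT (fun Z : R => Z `^ (- p^-1) * kappa al (- Y) Z).
  by apply: measurable_funM => //; exact: measurable_powR.
have mvp : measurable_fun setT (fun Z : R => `|v Z| `^ p * Z * (Z `^ (- p^-1) * kappa al (- Y) Z)).
  apply: measurable_funM => //; apply: measurable_funM => //.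
  exact: measurable_norm_powR.
have mvk : measurable_fun setT (fun Z : R => v Z * kappa al (- Y) Z).
  exact: measurable_funM.
have wk0 := weighted_kappa_ge0 v (- Y).
have zk0 Z : 0 <= Z `^ (- p^-1) * kappa al (- Y) Z.
  by apply: mulr_ge0; [exact: powR_ge0|exact: k0].
apply: (@le_trans _ _ (\int[mu]_Z (`|v Z * kappa al (- Y) Z|)%:E)%E).
  apply: (le_trans (le_abse_fine _)).
  by apply: le_abse_integral => //; exact/measurable_EFinP.
apply: (@le_trans _ _ (\int[mu]_Z (l%:E * (Z `^ (- p^-1) * kappa al (- Y) Z)%:E +
    (l `^ (1 - p))%:E * (`|v Z| `^ p * Z * (Z `^ (- p^-1) * kappa al (- Y) Z))%:E))%E).
  apply: ge0_le_integral => //.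
  - by apply/measurable_EFinP; exact: measurableT_comp.
  - apply: emeasurable_funD; apply: measurable_funeM; exact/measurable_EFinP.
  - move=> Z _; rewrite -!EFinM -EFinD lee_fin; have [->|/v0 Z0] := eqVneq (v Z) 0.
      by rewrite mul0r normr0 powR0 ?gt_eqF// !mul0r mulr0 addr0 mulr_ge0// ltW.
    rewrite normrM (ger0_norm (k0 _ _)).
    (* Young's inequality is applied to the factor |v Z| Z^(1/p), whose p-th power is |v Z|^p Z, and
       integrated against the density Z^(-1/p) kappa of known mass. *)
    have -> : `|v Z| * kappa al (- Y) Z =
        (`|v Z| * Z `^ p^-1) * (Z `^ (- p^-1) * kappa al (- Y) Z).
      by rewrite powRN; field; rewrite gt_eqF// powR_gt0.
    rewrite [l `^ _ * _]mulrA -mulrDl ler_wpM2r//.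
    apply: (le_trans (young_powR p1 l0 _)); first by rewrite mulr_ge0// powR_ge0.
    rewrite powRM ?powR_ge0// -powRrM mulVf ?gt_eqF// powRr1 ?(ltW Z0)//.
rewrite ge0_integralD//; last 4 first.
- by move=> Z _; rewrite -EFinM lee_fin mulr_ge0// ltW.
- by apply: measurable_funeM; exact/measurable_EFinP.
- by move=> Z _; rewrite -EFinM lee_fin mulr_ge0// powR_ge0.
- by apply: measurable_funeM; exact/measurable_EFinP.
rewrite ge0_integralZl//; last 3 first.
- exact/measurable_EFinP.
- by move=> Z _; rewrite lee_fin.
- by rewrite lee_fin ltW.
rewrite ge0_integralZl//; last 3 first.
- exact/measurable_EFinP.
- by move=> Z _; rewrite lee_fin.
- by rewrite lee_fin powR_ge0.
by rewrite integral_kappar_weight// (le_lt_trans pV1)// ltrDl.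
Qed.

Lemma measurable_weighted_overflow v : measurable_fun setT v ->
  measurable_fun setT (weighted_overflow v).
Proof.
move=> mv; pose F (z : R * R) := `|v z.2| `^ p * z.2 * (z.2 `^ (- p^-1) * kappa al z.1 z.2).
have mF : measurable_fun setT F.
  apply: measurable_funM.
    apply: (@measurable_comp2 _ (fun y : R => `|v y| `^ p * y)).
    by apply: measurable_funM => //; exact: measurable_norm_powR.
  apply: measurable_funM; last exact: measurable_kappa.
  by apply: (@measurable_comp2 _ (fun y : R => y `^ (- p^-1))); exact: measurable_powR.
apply: (@measurable_fun_fubini_tonelli_F _ _ (measurableTypeR R) (measurableTypeR R) R mu (EFin \o F)).
  exact/measurable_EFinP.
by move=> z; rewrite lee_fin weighted_kappa_ge0.
Qed.

(** The weight in y is the power p - 1 of (-y)^(-1/p), a factor left by the optimization in [l].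
    After Tonelli, the integral in y gives Z^(-(1 - 1/p)), which cancels Z times Z^(-1/p). *)
Lemma weighted_overflow_integral v : measurable_fun setT v ->
  (forall x, v x != 0 -> 0 < x) ->
  (\int[mu]_y (((- y) `^ (- (1 - p^-1)))%:E * weighted_overflow v y) =
   schur_dual_mass%:E * \int[mu]_Z (`|v Z| `^ p)%:E)%E.
Proof.
move=> mv v0; have mk := measurable_kappa al.
have k0 := kappa_ge0 al0 al1.
pose F (z : R * R) := ((- z.1) `^ (- (1 - p^-1)) * (`|v z.2| `^ p * z.2 * (z.2 `^ (- p^-1) * kappa al z.1 z.2))).
have mF : measurable_fun setT F.
  apply: measurable_funM.
    apply: (@measurable_comp1 _ (fun y : R => (- y) `^ (- (1 - p^-1)))).
    by apply: (measurableT_comp (measurable_powR _)) => //; exact: measurable_funN.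
  apply: measurable_funM.
    apply: (@measurable_comp2 _ (fun y : R => `|v y| `^ p * y)).
    by apply: measurable_funM => //; exact: measurable_norm_powR.
  apply: measurable_funM => //.
  by apply: (@measurable_comp2 _ (fun y : R => y `^ (- p^-1))); exact: measurable_powR.
have wk0 := weighted_kappa_ge0 v.
have F0 z : 0 <= F z by apply: mulr_ge0; [exact: powR_ge0|exact: wk0].
transitivity (\int[mu]_y \int[mu]_Z (F (y, Z))%:E)%E.
  apply: eq_integral => y _; rewrite -ge0_integralZl//=.
  - apply/measurable_EFinP; apply: measurable_funM.
      by apply: measurable_funM => //; exact: measurable_norm_powR.
    by apply: measurable_funM; [exact: measurable_powR|exact: measurable_kappaZ].
  - by move=> Z _; rewrite lee_fin.
  - by rewrite lee_fin powR_ge0.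
have := @fubini_tonelli _ _ (measurableTypeR R) (measurableTypeR R) R mu mu (EFin \o F) _ _.
rewrite /= => ->; last 2 first.
- exact/measurable_EFinP.
- by move=> z; rewrite lee_fin.
rewrite -ge0_integralZl//; last 2 first.
- by apply/measurable_EFinP; exact: measurable_norm_powR.
- by rewrite lee_fin ltW// schur_dual_mass_gt0.
apply: eq_integral => Z _; rewrite /F/=; have [->|/v0 Z0] := eqVneq (v Z) 0.
  rewrite normr0 powR0 ?gt_eqF// mule0; apply: integral0_eq => y _.
  by rewrite !mul0r mulr0.
transitivity (\int[mu]_y ((`|v Z| `^ p * Z * Z `^ (- p^-1))%:E *
    ((- y) `^ (- (1 - p^-1)) * kappa al y Z)%:E))%E.
  by apply: eq_integral => y _; rewrite -EFinM; congr _%:E; ring.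
rewrite ge0_integralZl//; last 3 first.
- apply/measurable_EFinP; apply: measurable_funM.
    by apply: (measurableT_comp (measurable_powR _)) => //; exact: measurable_funN.
  exact: (@measurable_section1 _ (kappa al) Z mk).
- by move=> y _; rewrite lee_fin mulr_ge0// powR_ge0.
- by rewrite lee_fin !mulr_ge0 ?powR_ge0// ltW.
rewrite integral_kappal_weight//; last 2 first.
- by rewrite subr_ge0.
- by rewrite ltrD2l ltrN2.
rewrite -!EFinM /schur_dual_mass; congr _%:E.
have -> : - (1 - p^-1) = p^-1 - 1 by ring.
rewrite powRN powRB ?powRr1 ?(ltW Z0) ?(gt_eqF Z0) ?implybT//.
by field; rewrite !gt_eqF ?powR_gt0// betaI_gt0.
Qed.

(** The bound of [overflow_le] is optimized in [l] separately at each y, and only then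
    integrated. *)
Lemma overflow_Lp v : mu.-integrable setT (EFin \o v) -> (forall x, v x != 0 -> 0 < x) ->
  (\int[mu]_y (`|overflow al v y| `^ p)%:E <=
   schur_const%:E * \int[mu]_Z (`|v Z| `^ p)%:E)%E.
Proof.
move=> vi v0; have mv : measurable_fun setT v.
  by apply/measurable_EFinP; exact: measurable_int vi.
have mw : measurable_fun setT (fun y : R => ((- y) `^ (- (1 - p^-1)))%:E * weighted_overflow v y)%E.
  apply: emeasurable_funM; last exact: measurable_weighted_overflow.
  by apply/measurable_EFinP; apply: (measurableT_comp (measurable_powR _)) => //; exact: measurable_funN.
rewrite /schur_const EFinM -muleA -weighted_overflow_integral//.
have m0 := schur_mass_gt0.
have pt y : ((`|overflow al v y| `^ p)%:E <= (2 `^ p * schur_mass `^ (p - 1))%:E *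
    (((- y) `^ (- (1 - p^-1)))%:E * weighted_overflow v y))%E.
  have [y0|y0] := ltP y 0; last first.
    rewrite overflow_eq0// normr0 powR0 ?gt_eqF//.
    by rewrite !mule_ge0 ?weighted_overflow_ge0 ?lee_fin ?mulr_ge0 ?powR_ge0.
  have Y0 : 0 < - y by rewrite oppr_gt0.
  have := @powR_le_optim p `|overflow al v y| (schur_mass * (- y) `^ (- p^-1)) (weighted_overflow v y) p1 (normr_ge0 _).
  rewrite mulr_gt0 ?powR_gt0// => /(_ isT (weighted_overflow_ge0 v y)).
  have := fun l => @overflow_le v (- y) l mv v0 Y0; rewrite opprK => h /(_ h).
  move/le_trans; apply; rewrite muleA -EFinM powRM ?powR_ge0 ?(ltW m0)// mulrA.
  rewrite -powRrM (_ : - p^-1 * (p - 1) = - (1 - p^-1)) ?lexx//.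
  by field; rewrite gt_eqF.
rewrite -ge0_integralZl//; last 2 first.
- by move=> y _; rewrite mule_ge0 ?weighted_overflow_ge0// lee_fin powR_ge0//.
- by rewrite lee_fin mulr_ge0 ?powR_ge0.
apply: ge0_le_integral => //.
- apply/measurable_EFinP; apply: measurable_norm_powR; apply/measurable_EFinP.
  exact: measurable_int (integrable_overflow al0 al1 vi v0).
- exact: measurable_funeM.
Qed.
End OverflowLp.

(** * Decay of the mass of an L^q function near the end of the interval *)

Section LpSmallness.
Context {R : realType}.
Local Notation mu := (@lebesgue_measure R).
Implicit Types (u f : R -> R).

Lemma integral_normM_young (q l : R) u (I : R -> bool) : 1 <= q -> 0 < l ->
  measurable_fun setT u -> measurable_fun setT I ->
  (\int[mu]_x (`|u x| * (I x)%:R)%:E <=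
   l%:E * \int[mu]_x (I x)%:R%:E + (l `^ (1 - q))%:E * \int[mu]_x (`|u x| `^ q)%:E)%E.
Proof.
move=> q1 l0 mu_ mI; have mIr : measurable_fun setT (fun x => (I x)%:R : R) by exact: measurable_bool_natr.
have mq := measurable_norm_powR q mu_.
rewrite -ge0_integralZl//; [|exact/measurable_EFinP|by rewrite lee_fin ltW].
rewrite -ge0_integralZl//; [|exact/measurable_EFinP|by rewrite lee_fin powR_ge0].
rewrite -ge0_integralD//; last 4 first.
- by move=> x _; rewrite -EFinM lee_fin mulr_ge0// ltW.
- by apply: measurable_funeM; exact/measurable_EFinP.
- by move=> x _; rewrite -EFinM lee_fin mulr_ge0// powR_ge0.
- by apply: measurable_funeM; exact/measurable_EFinP.
apply: ge0_le_integral => //.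
- by apply/measurable_EFinP; apply: measurable_funM => //; exact: measurableT_comp.
- by apply: emeasurable_funD; apply: measurable_funeM; exact/measurable_EFinP.
- move=> x _; rewrite -!EFinM -EFinD lee_fin; case: (I x).
    by rewrite !mulr1 young_powR.
  by rewrite !mulr0 add0r mulr_ge0 ?powR_ge0.
Qed.

Lemma Lp_integrable (q L : R) u : 1 <= q -> 0 < L -> measurable_fun setT u ->
  (forall x, u x != 0 -> 0 < x < L) ->
  (\int[mu]_x (`|u x| `^ q)%:E < +oo)%E -> mu.-integrable setT (EFin \o u).
Proof.
move=> q1 L0 mu_ uL uq; apply/integrableP; split; first exact/measurable_EFinP.
(* The interval ]0, L[, written as the slice of width L to fit [integral_slice]. *)
have mI : measurable_fun setT (fun x : R => L - L < x < L).
  by apply: measurable_and; exact: measurable_fun_ltr.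
have := integral_normM_young q1 ltr01 mu_ mI.
rewrite integral_slice// powR1 !mul1e => h.
suff -> : (\int[mu]_x `|(EFin \o u) x| = \int[mu]_x (`|u x| * (L - L < x < L)%R%:R)%:E)%E.
  by apply: (le_lt_trans h); rewrite lte_add_pinfty// ltry.
apply: eq_integral => x _ /=; have [->|/uL] := eqVneq (u x) 0; first by rewrite normr0 mul0r.
by rewrite subrr => ->; rewrite mulr1.
Qed.

Lemma Lp_slice_small (al q L : R) u : 1 <= q -> 1 < q * (1 - al) ->
  measurable_fun setT u -> (forall x, u x != 0 -> x < L) ->
  (\int[mu]_x (`|u x| `^ q)%:E < +oo)%E ->
  forall e : R, 0 < e -> \forall t \near 0^'+,
    \int[mu]_x (`|u x| * (L - t < x)%R%:R) <= e * t `^ al.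
Proof.
move=> q1 qal mu_ uL uq e e0; have q0 : 0 < q := lt_le_trans ltr01 q1.
pose M := fine (\int[mu]_x (`|u x| `^ q)%:E)%E.
have MM : (\int[mu]_x (`|u x| `^ q)%:E)%E = M%:E.
  rewrite fineK// ge0_fin_numE//; apply: integral_ge0 => x _.
  by rewrite lee_fin powR_ge0.
have M0 : 0 <= M by rewrite -lee_fin -MM integral_ge0// => x _; rewrite lee_fin powR_ge0.
(* The slice of width t carries mass O(t^(1 - 1/q)), and [d] is the gain over t^al; it is positive
   exactly when q (1 - al) > 1. *)
pose d := 1 - q^-1 - al.
have d0 : 0 < d.
  rewrite /d -(pmulr_rgt0 _ q0) (_ : _ * _ = q * (1 - al) - 1) ?subr_gt0//.
  by field; rewrite gt_eqF.
have small : \forall t \near 0^'+, (1 + M) * t `^ d <= e.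
  have M1 : 0 < 1 + M by rewrite ltr_wpDr.
  near=> t; rewrite mulrC -ler_pdivlMr//.
  near: t; have := @powR_cvg0 R d d0.
  move/cvgrPdist_le => /(_ (e / (1 + M)) (divr_gt0 e0 M1)).
  apply: filterS => t; rewrite sub0r normrN.
  by apply: le_trans; exact: ler_norm.
near=> t; have t0 : 0 < t by near: t; exact: nbhs_right_gt.
have small_t : (1 + M) * t `^ d <= e by near: t.
apply: (@le_trans _ _ ((1 + M) * t `^ d * t `^ al)); last by rewrite ler_wpM2r ?powR_ge0.
have mI : measurable_fun setT (fun x : R => L - t < x < L).
  by apply: measurable_and; exact: measurable_fun_ltr.
apply: Rintegral_le_fin; last by move=> x; rewrite mulr_ge0.
have -> : (\int[mu]_x (`|u x| * (L - t < x)%R%:R)%:E =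
    \int[mu]_x (`|u x| * (L - t < x < L)%R%:R)%:E)%E.
  apply: eq_integral => x _ /=; have [->|/uL ->] := eqVneq (u x) 0; first by rewrite normr0 !mul0r.
  by rewrite andbT.
(* The choice l = t^(-1/q) balances the terms: l t and l^(1 - q) both equal t^(1 - 1/q). *)
have := integral_normM_young q1 (powR_gt0 (- q^-1) t0) mu_ mI.
move/le_trans; apply; rewrite integral_slice// MM -!EFinM -EFinD lee_fin -powRrM.
rewrite mulrDl mul1r mulrDl -powRD ?(gt_eqF t0) ?implybT//.
rewrite -(mulrA M) -powRD ?(gt_eqF t0) ?implybT// /d subrK.
rewrite -[X in _ `^ _ * X](powRr1 (ltW t0)) -powRD ?(gt_eqF t0) ?implybT//.
rewrite [- q^-1 + 1]addrC mulrC.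
by rewrite (_ : - q^-1 * (1 - q) = 1 - q^-1)//; field; rewrite gt_eqF.
Unshelve. all: by end_near. Qed.
End LpSmallness.

(** * Fractional derivatives on an interval *)

Section FractionalDerivative.
Context {R : realType}.
Local Notation mu := (@lebesgue_measure R).
Implicit Types (phi psi u f : R -> R) (s : side) (x : R).

Lemma is_derive_comp_aff f c s x (df : R) : is_derive (aff c s x) 1 f df ->
  is_derive x 1 (f \o aff c s) (sgnside s * df).
Proof.
move=> h; have d : is_derive x 1 (aff c s) (sgnside s).
  rewrite /aff; apply: (is_derive_eq (is_deriveD _ _)); rewrite ?add0r//.
  by rewrite [_ *: _]mulr1.
by have := is_derive1_comp h d; rewrite mulrC.
Qed.

Lemma Cn_comp_aff n phi c s : Cn n phi -> Cn n (phi \o aff c s).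
Proof.
move=> h; apply: (@eq_Cn _ _ (fun X => phi (sgnside s * X + c))).
  by move=> X; rewrite /= /aff addrC.
exact: Cn_aff.
Qed.

Variable al : R.
Hypotheses (al0 : 0 < al) (al1 : al < 1).

Local Notation K := (rlker al).

Definition rlpot phi x : R := \int[mu]_y (phi y * K (x - y)).

(** The variable x moves from the singular kernel to the smooth factor, which makes differentiation
    under the integral possible. *)
Lemma rlpotE phi x : measurable_fun setT phi ->
  rlpot phi x = \int[mu]_t (phi (x - t) * K t).
Proof.
move=> mphi; rewrite /rlpot (Rintegral_aff x Left measurableT).
  rewrite preimage_setT; apply: eq_Rintegral => t _.
  by rewrite (_ : aff x Left t = x - t) ?subKr// /aff/= mulN1r.
apply: measurable_funM => //.
exact: (@measurable_section2 _ (fun x y => K (x - y)) x (measurable_rlker2 al)).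
Qed.

Lemma integrable_rlker_trunc (C c : R) : 0 <= C -> 0 < c ->
  mu.-integrable setT (EFin \o (fun t => C * (K t * (t < c)%R%:R))).
Proof.
move=> C0 c0; have i1 : mu.-integrable setT (EFin \o (fun t => K t * (t < c)%R%:R)).
  apply: ge0_integrable => //.
  - apply: measurable_funM; first exact: measurable_rlker.
    by apply: measurable_bool_natr; exact: measurable_fun_ltr.
  - by move=> t _; rewrite mulr_ge0// rlker_ge0.
  - by rewrite integral_rlker// ltry.
exact: (integrableZl measurableT C i1).
Qed.

(** A majorant independent of x': if x' < x + 1 and |x' - t| <= M, then t < |x| + |M| + 1. *)
Lemma le_rlker_trunc f (C M x x' t : R) : (forall y, `|f y| <= C) ->
  (forall y, f y != 0 -> `|y| <= M) -> x' < x + 1 ->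
  `|f (x' - t) * K t| <= C * (K t * (t < `|x| + `|M| + 1)%R%:R).
Proof.
move=> fC fM xx; have C0 : 0 <= C := le_trans (normr_ge0 (f 0)) (fC 0).
have [->|/fM ft] := eqVneq (f (x' - t)) 0.
  by rewrite mul0r normr0 mulr_ge0// mulr_ge0// rlker_ge0.
have -> : t < `|x| + `|M| + 1.
  move: ft; rewrite ler_norml => /andP[ft _].
  have := ler_norm x; have := ler_norm M; lra.
by rewrite mulr1 normrM (ger0_norm (rlker_ge0 _ _)) ler_wpM2r// rlker_ge0.
Qed.

(** On functions of compact support, the Riemann-Liouville derivative agrees with the Caputo one,
    where the derivative falls on [phi] before integration. *)
Lemma is_derive_rlpot phi (M : R) x : Cn 2 phi ->
  (forall y, phi y != 0 -> `|y| <= M) -> is_derive x 1 (rlpot phi) (rlderiv al phi x).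
Proof.
move=> c2 hM; have hM' := derive1_eq0_out hM.
have cphi : continuous phi by apply: Cn_continuous; case: c2 => f' [d _]; exists f'; split.
have cphi' : continuous phi^`()%classic by exact: Cn_continuous (Cn_derive1 c2).
have mphi := continuous_measurable_fun cphi.
have mphi' := continuous_measurable_fun cphi'.
have c1 : Cn 1 phi by case: c2 => f' [d _]; exists f'; split.
have [C C0 hC] := compact_supp_bounded cphi hM.
have [C' C0' hC'] := compact_supp_bounded cphi' hM'.
pose f x t := phi (x - t) * K t.
have c0 : 0 < `|x| + `|M| + 1 by rewrite ltr_wpDl// addr_ge0.
have Ix : x \in `](x - 1), (x + 1)[ by rewrite in_itv/= ltrBlDr ltrDl ltr01.
have mf x' : measurable_fun setT (f x').
  apply: measurable_funM; last exact: measurable_rlker.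
  by apply: (measurableT_comp mphi); exact: measurable_funB.
have df x' t : is_derive x' 1 (f ^~ t) (phi^`()%classic (x' - t) * K t).
  have h := is_deriveZ (K t) (@is_derive_comp_aff phi (- t) Right x' _ (Cn_is_derive _ c1)).
  have -> : f ^~ t = K t \*: (phi \o aff (- t) Right).
    by apply/funext => y; rewrite /f /= /aff/= mul1r [- t + y]addrC mulrC.
  by apply: is_derive_eq h _; rewrite /aff/= !mul1r [- t + _]addrC mulrC.
have G0 c t : 0 <= c -> 0 <= c * (K t * (t < `|x| + `|M| + 1)%R%:R).
  by move=> c00; apply: mulr_ge0 => //; apply: mulr_ge0 => //; exact: rlker_ge0.
have intf x' : `](x - 1), (x + 1)[%classic x' -> mu.-integrable setT (EFin \o f x').
  rewrite /= in_itv => /andP[_ xx].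
  apply: le_integrable (integrable_rlker_trunc C0 c0) => //.
    by apply/measurable_EFinP; exact: mf.
  by move=> t _ /=; rewrite lee_fin [leRHS]ger0_norm ?G0//; exact: le_rlker_trunc.
have ub x' t : `](x - 1), (x + 1)[%classic x' -> setT t ->
    `|partial1of2 f x' t| <= C' * (K t * (t < `|x| + `|M| + 1)%R%:R).
  rewrite /= in_itv => /andP[_ xx] _; rewrite partial1of2E.
  have [_ ->] := df x' t; exact: le_rlker_trunc.
have dif x' t : `](x - 1), (x + 1)[%classic x' -> setT t -> derivable (f ^~ t) x' 1.
  by move=> _ _; have [] := df x' t.
have iG := integrable_rlker_trunc C0' c0.
have D := @derivable_under_integral R _ _ mu f setT measurableT x _ _ Ix intf dif _ (fun t => G0 C' t C0') iG ub.
have E := @differentiation_under_integral R _ _ mu f setT measurableT x _ _ Ix intf dif _ (fun t => G0 C' t C0') iG ub.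
have -> : rlpot phi = (fun x => \int[mu]_t f x t) by apply/funext => y; exact: rlpotE.
apply: DeriveDef; first exact: D.
rewrite -derive1E E.
rewrite [RHS](rlpotE _ mphi'); apply: eq_Rintegral => t _.
by rewrite partial1of2E; have [_ ->] := df x t.
Qed.

Lemma measurable_rlderiv phi (M : R) : Cn 3 phi ->
  (forall y, phi y != 0 -> `|y| <= M) -> measurable_fun setT (rlderiv al phi).
Proof.
move=> c3 hM; apply: continuous_measurable_fun => x.
apply/differentiable_continuous/derivable1_diffP.
by have [] := @is_derive_rlpot _ M x (Cn_derive1 c3) (derive1_eq0_out hM).
Qed.

Local Notation g := ((Gamma (1 - al))^-1).

Lemma left_int_rlpot (l r : itv_bound R) phi x :
  (forall y, phi y != 0 -> y \in Interval l r) ->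
  left_int (Interval l r) (1 - al) phi x = g * rlpot phi x.
Proof.
move=> hphi; rewrite /left_int; congr (_ * _); rewrite /rlpot /Rintegral; congr fine.
apply/esym/integral_supp => y /=; rewrite in_itv/=.
  move=> /andP[_ yx]; rewrite rlkerE ?subr_gt0// powRN; congr (_ / _ `^ _)%:E; ring.
move=> nin; have [->|/hphi] := eqVneq (phi y) 0; first by rewrite mul0r.
rewrite in_itv => /andP[ly _]; rewrite rlker_eq0 ?mulr0// subr_le0 leNgt.
by apply/negP => yx; apply: nin; rewrite ly.
Qed.

Lemma right_int_rlpot (l r : itv_bound R) phi x c : measurable_fun setT phi ->
  (forall y, phi y != 0 -> y \in Interval l r) ->
  right_int (Interval l r) (1 - al) phi x = g * rlpot (phi \o aff c Left) (c - x).
Proof.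
move=> mphi hphi; rewrite /right_int; congr (_ * _).
transitivity (\int[mu]_y (phi y * K (y - x))).
  rewrite /Rintegral; congr fine.
  apply/esym/integral_supp => y /=; rewrite in_itv/=.
    move=> /andP[yx _]; rewrite rlkerE ?subr_gt0// powRN; congr (_ / _ `^ _)%:E; ring.
  move=> nin; have [->|/hphi] := eqVneq (phi y) 0; first by rewrite mul0r.
  rewrite in_itv => /andP[_ yr]; rewrite rlker_eq0 ?mulr0// subr_le0 leNgt.
  by apply/negP => yx; apply: nin; rewrite yr andbT.
rewrite (Rintegral_aff c Left measurableT).
  rewrite preimage_setT; apply: eq_Rintegral => t _; congr (_ * K _).
  by rewrite /aff/=; ring.
apply: measurable_funM => //; apply: (measurableT_comp (measurable_rlker al)).
exact: measurable_funB.
Qed.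

(* Reflecting the axis when [s] is [Left] turns the right derivative into the left
   one. *)
Lemma frac_deriv_aff (D : set R) (l r : itv_bound R) s c phi x :
  test_function D phi -> D `<=` [set` Interval l r] ->
  frac_deriv (opposite s) (Interval l r) al phi (aff c s x) =
  g * rlderiv al (phi \o aff c s) x.
Proof.
move=> tphi Di; have [M M0 hM] := test_function_bounded tphi.
have hphi y : phi y != 0 -> y \in Interval l r.
  by case: tphi => _ [_ cD] py; apply/Di/cD/subset_closure.
have mphi : measurable_fun setT phi.
  exact: continuous_measurable_fun (Cn_continuous (test_function_Cn 1 tphi)).
have dphi (y : R) : is_derive y 1 (phi \o aff c s) (sgnside s * phi^`()%classic (aff c s y)).
  exact/is_derive_comp_aff/Cn_is_derive/(test_function_Cn 1 tphi).
case: s dphi => dphi.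
- have hM' y : (phi \o aff c Left) y != 0 -> `|y| <= M + `|c|.
    move=> /= /hM; rewrite /aff/= mulN1r => h.
    rewrite (_ : y = c - (c - y)); last by ring.
    by rewrite (le_trans (ler_normB _ _))// addrC lerD2r.
  have d y := @is_derive_rlpot (phi \o aff c Left) _ y (Cn_comp_aff c Left (test_function_Cn 2 tphi)) hM'.
  rewrite /frac_deriv/= (_ : right_int _ _ _ = (fun y => g * (rlpot (phi \o aff c Left) \o aff c Left) y)); last first.
    apply/funext => y; rewrite (right_int_rlpot y c mphi hphi).
    by rewrite /= /aff/= mulN1r.
  have e : aff c Left (aff c Left x) = x by rewrite /aff/=; ring.
  have [_ h] := is_deriveZ g (is_derive_comp_aff (d (aff c Left (aff c Left x)))).
  by rewrite derive1E h e /= mulN1r scalerN opprK.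
- have d y := @is_derive_rlpot phi M y (test_function_Cn 2 tphi) hM.
  rewrite /frac_deriv/= (_ : left_int _ _ _ = (fun y => g * rlpot phi y)); last first.
    by apply/funext => y; rewrite left_int_rlpot.
  have [_ h] := is_deriveZ g (d (aff c Right x)).
  rewrite derive1E h; congr (_ * _).
  have mphi' : measurable_fun setT phi^`()%classic.
    apply: continuous_measurable_fun.
    exact: Cn_continuous (Cn_derive1 (test_function_Cn 2 tphi)).
  have dE : (phi \o aff c Right)^`()%classic = phi^`()%classic \o aff c Right.
    by apply/funext => y; have [_ dy] := dphi y; rewrite derive1E dy mul1r.
  rewrite [LHS](rlpotE _ mphi') /rlderiv dE [RHS]rlpotE.
    by apply: eq_Rintegral => t _; rewrite /= /aff/= !mul1r addrA.
  by apply: measurableT_comp mphi' _; exact: measurable_aff.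
Qed.
End FractionalDerivative.

(** * Transport to an arbitrary bounded interval and to both sides *)

Section ZeroExtensionInterval.
Context {R : realType}.
Local Notation mu := (@lebesgue_measure R).
Implicit Types (phi psi u v w f : R -> R) (s : side) (x : R).

(** The inverse of [aff c s], written as another [aff] so that the same change of variables
    applies. *)
Definition affV (c : R) s : R -> R := aff (- (sgnside s * c)) s.

Lemma affVE c s x : affV c s x = sgnside s * (x - c).
Proof. by rewrite /affV /aff; ring. Qed.

Lemma affVK c s x : affV c s (aff c s x) = x.
Proof. by rewrite affVE affK. Qed.

Lemma affKV c s x : aff c s (affV c s x) = x.
Proof. by rewrite affVE affK'. Qed.

Lemma ge0_integral_norm_powR_affV c s (p : R) f : measurable_fun setT f ->
  (\int[mu]_x (`|f (affV c s x)| `^ p)%:E = \int[mu]_x (`|f x| `^ p)%:E)%E.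
Proof.
move=> mf; rewrite [RHS](ge0_integral_aff (- (sgnside s * c)) s measurableT).
- by rewrite preimage_setT.
- by apply/measurable_EFinP; exact: measurable_norm_powR.
- by move=> x; rewrite lee_fin powR_ge0.
Qed.

Lemma integral_norm_powR_aff c s (p : R) f : measurable_fun setT f ->
  (\int[mu]_x (`|f (aff c s x)| `^ p)%:E = \int[mu]_x (`|f x| `^ p)%:E)%E.
Proof.
move=> mf; rewrite [RHS](ge0_integral_aff c s measurableT).
- by rewrite preimage_setT.
- by apply/measurable_EFinP; exact: measurable_norm_powR.
- by move=> x; rewrite lee_fin powR_ge0.
Qed.

(** The end that becomes the origin, beyond which the derivative of the zero extension overflows:
    the right end for left derivatives, the left end for right ones. *)
Definition startpoint s (a b : R) : R := match s with Left => b | Right => a end.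

Lemma aff_startpoint s (a b x : R) :
  (a < aff (startpoint s a b) s x < b) = (0 < x < b - a).
Proof.
case: s; rewrite /startpoint /aff /= ?mulN1r ?mul1r.
  by rewrite ltrBrDl gtrDl oppr_lt0 andbC -ltrBrDr.
by rewrite ltrDl -ltrBrDl.
Qed.

Lemma test_function_affV s (a b : R) psi : a < b -> test_function `]0, b - a[ psi ->
  test_function `]a, b[ (psi \o affV (startpoint s a b) s).
Proof.
move=> ab tpsi; have L0 : 0 < b - a by rewrite subr_gt0.
have [x1 [x2 [x10 x12 x2L hx]]] := test_function_oo L0 tpsi.
have cn n : Cn n (psi \o affV (startpoint s a b) s).
  exact/Cn_comp_aff/(test_function_Cn n tpsi).
case: s cn => cn.
- apply: (@test_functionI _ _ _ (b - x2) (b - x1)) => //.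
    by move=> y /= /hx; rewrite affVE/= => /andP[]; lra.
  by apply: subset_itvSoo; rewrite bnd_simp; lra.
- apply: (@test_functionI _ _ _ (a + x1) (a + x2)) => //.
    by move=> y /= /hx; rewrite affVE/= => /andP[]; lra.
  by apply: subset_itvSoo; rewrite bnd_simp; lra.
Qed.

Lemma test_function_aff s (c : R) (D : set R) phi : test_function D phi ->
  test_function setT (phi \o aff c s).
Proof.
move=> tphi; have [M M0 hM] := test_function_bounded tphi.
apply: (@test_functionI _ _ _ (- (M + `|c|)) (M + `|c|)) => //.
  by move=> n; exact/Cn_comp_aff/(test_function_Cn n tphi).
move=> x /= /hM h; rewrite -ler_norml.
have -> : `|x| = `|aff c s x - c|.
  by rewrite -{1}(affK c s x) normrM; case: (s) => /=; rewrite ?normrN normr1 mul1r.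
by rewrite (le_trans (ler_normB _ _))// lerD2r.
Qed.

Variables al p q : R.
Hypotheses (al0 : 0 < al) (al1 : al < 1) (p1 : 1 <= p) (alp : al * p < 1).
Hypotheses (q1 : 1 <= q) (qal : 1 < q * (1 - al)).

(** The supports of v and T v are disjoint, so the p-th powers add up with no constant lost. *)
Lemma overflowB_Lp v : mu.-integrable setT (EFin \o v) ->
  (forall x, v x != 0 -> 0 < x) ->
  (\int[mu]_x (`|v x - overflow al v x| `^ p)%:E <=
    (1 + schur_const al p)%:E * \int[mu]_x (`|v x| `^ p)%:E)%E.
Proof.
move=> vi v0; have p0 : p != 0 by rewrite gt_eqF// (lt_le_trans _ p1).
have mv : measurable_fun setT v by apply/measurable_EFinP; exact: measurable_int vi.
have mo : measurable_fun setT (overflow al v).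
  by apply/measurable_EFinP; exact: measurable_int (integrable_overflow al0 al1 vi v0).
have A0 := schur_const_gt0 al0 al1 p1 alp.
rewrite EFinD ge0_muleDl ?lee_fin// ?(ltW A0)// mul1e.
apply: (@le_trans _ _ (\int[mu]_x (`|v x| `^ p)%:E + \int[mu]_x (`|overflow al v x| `^ p)%:E)%E); last first.
  by rewrite leeD2l//; exact: overflow_Lp.
rewrite -ge0_integralD//; last 2 first.
- by apply/measurable_EFinP; exact: measurable_norm_powR.
- by apply/measurable_EFinP; exact: measurable_norm_powR.
rewrite le_eqVlt; apply/orP; left; apply/eqP; apply: eq_integral => x _.
rewrite -EFinD; congr _%:E; have [x0|x0] := leP 0 x.
  by rewrite overflow_eq0// subr0 normr0 powR0// addr0.
have -> : v x = 0.
  by apply: contraTeq x0 => /v0; rewrite -leNgt; exact: ltW.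
by rewrite sub0r normrN normr0 powR0// add0r.
Qed.

Lemma zero_extension s (a b : R) u v : a < b ->
  measurable_fun setT u -> measurable_fun setT v ->
  (forall x, u x != 0 -> a < x < b) -> (forall x, v x != 0 -> a < x < b) ->
  (\int[mu]_x (`|u x| `^ q)%:E < +oo)%E ->
  (\int[mu]_x (`|v x| `^ p)%:E < +oo)%E ->
  (forall phi, test_function `]a, b[ phi ->
    \int[mu]_x (v x * phi x) =
    \int[mu]_x (u x * frac_deriv (opposite s) `]a, b[ al phi x)) ->
  exists w, [/\ measurable_fun setT w, mu.-integrable setT (EFin \o w),
    (\int[mu]_x (`|w x| `^ p)%:E <=
      (1 + schur_const al p)%:E * \int[mu]_x (`|v x| `^ p)%:E)%E &
    forall phi, test_function setT phi ->
      \int[mu]_x (w x * phi x) =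
      \int[mu]_x (u x * frac_deriv (opposite s) `]-oo, +oo[ al phi x)].
Proof.
move=> ab mu_ mv uab vab uq vp hyp.
set c := startpoint s a b.
have L0 : 0 < b - a by rewrite subr_gt0.
pose U := u \o aff c s; pose V := v \o aff c s.
have maff := measurable_aff c s.
have mU : measurable_fun setT U by exact: measurableT_comp mu_ maff.
have mV : measurable_fun setT V by exact: measurableT_comp mv maff.
have UL x : U x != 0 -> 0 < x < b - a by move=> /uab; rewrite aff_startpoint.
have VL x : V x != 0 -> 0 < x < b - a by move=> /vab; rewrite aff_startpoint.
have Uq : (\int[mu]_x (`|U x| `^ q)%:E < +oo)%E by rewrite /U integral_norm_powR_aff.
have Vp : (\int[mu]_x (`|V x| `^ p)%:E < +oo)%E by rewrite /V integral_norm_powR_aff.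
have Ui := Lp_integrable q1 L0 mU UL Uq.
have Vi := Lp_integrable p1 L0 mV VL Vp.
have V0 x : V x != 0 -> 0 < x by move=> /VL /andP[].
have small := Lp_slice_small q1 qal mU (fun x h => proj2 (andP (UL x h))) Uq.
pose g := (Gamma (1 - al))^-1.
(* The normalized pairing is the same for ]a, b[ and for the whole line, so that extending only
   enlarges the class of test functions. *)
have pair (l r : itv_bound R) (D : set R) phi : test_function D phi ->
    D `<=` [set` Interval l r] ->
    \int[mu]_x (u x * frac_deriv (opposite s) (Interval l r) al phi x) =
    g * \int[mu]_X (U X * rlderiv al (phi \o aff c s) X).
  move=> tphi Di; have tphi' := test_function_aff s c tphi.
  have [M _ hM] := test_function_bounded tphi'.
  have mD := measurable_rlderiv al1 (test_function_Cn 3 tphi') hM.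
  rewrite -RintegralMl; last exact: measurable_funM.
  transitivity (\int[mu]_x (u x * (g * rlderiv al (phi \o aff c s) (affV c s x)))).
    by apply: eq_Rintegral => x _; rewrite -(frac_deriv_aff al1 s c _ tphi Di) affKV.
  rewrite (Rintegral_aff c s measurableT).
    rewrite preimage_setT; apply: eq_Rintegral => x _.
    by rewrite affVK mulrCA.
  apply: measurable_funM; first exact: mu_.
  apply: measurable_funM; first exact: measurable_cst.
  by apply: (measurableT_comp mD); exact: measurable_aff.
have hyp' psi : test_function `]0, b - a[ psi ->
    \int[mu]_x (V x * psi x) = g * \int[mu]_x (U x * rlderiv al psi x).
  move=> tpsi; have tphi := test_function_affV s ab tpsi.
  have E : (psi \o affV c s) \o aff c s = psi.
    by apply/funext => x; rewrite /= affVK.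
  have := pair _ _ _ _ tphi (@subset_refl _ _); rewrite E => <-.
  rewrite -(hyp _ tphi) [RHS](Rintegral_aff c s measurableT).
    by rewrite preimage_setT; apply: eq_Rintegral => x _; rewrite /= affVK.
  apply: measurable_funM => //.
  exact: continuous_measurable_fun (Cn_continuous (test_function_Cn 1 tphi)).
have core := zero_extension_pairing al0 al1 L0 Ui Vi UL VL small hyp'.
pose W X := V X - overflow al V X.
have mW : measurable_fun setT W.
  apply: measurable_funB => //; apply/measurable_EFinP.
  exact: measurable_int (integrable_overflow al0 al1 Vi V0).
have Wi : mu.-integrable setT (EFin \o W).
  exact: (integrableB measurableT Vi (integrable_overflow al0 al1 Vi V0)).
exists (W \o affV c s); split.
- by apply: (measurableT_comp mW); exact: measurable_aff.
- exact: (integrable_aff (- (sgnside s * c)) s measurableT Wi).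
- rewrite ge0_integral_norm_powR_affV// -(integral_norm_powR_aff c s _ mv).
  exact: overflowB_Lp.
- move=> phi tphi.
  have mphi : measurable_fun setT phi.
    exact: continuous_measurable_fun (Cn_continuous (test_function_Cn 1 tphi)).
  rewrite (pair _ _ _ _ tphi) ?set_itvE//.
  rewrite -(core setT) //; last exact: test_function_aff tphi.
  rewrite (Rintegral_aff c s measurableT).
    rewrite preimage_setT; apply: eq_Rintegral => x _.
    by rewrite /= affVK.
  by apply: measurable_funM => //; apply: (measurableT_comp mW); exact: measurable_aff.
Qed.
End ZeroExtensionInterval.

(** * Classes of functions *)

Section FunctionClasses.
Context {R : realType}.
Local Notation mu := (@lebesgue_measure R).
Local Notation fun_on i := {mfun_ (leb_on i), measurableTypeR R >-> measurableTypeR R}.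
Implicit Types (i : interval R) (s : side) (f g w phi : R -> R).

Lemma leb_onE i (A : set R) : leb_on i A = mu (A `&` [set` i]).
Proof. by []. Qed.

Lemma ae_leb_on i (P : R -> Prop) :
  {ae leb_on i, forall x, P x} <-> {ae mu, forall x, [set` i] x -> P x}.
Proof.
split=> -[N [mN N0 sN]].
- exists (N `&` [set` i]); split; [exact: measurableI|exact: N0|].
  by move=> x /= /not_implyP[ix nPx]; split => //; exact: sN.
- exists (N `|` ~` [set` i]); split.
  + by apply: measurableU => //; exact: measurableC.
  + rewrite leb_onE setIUl setICl setU0.
    by apply/eqP; rewrite -measure_le0 -N0 le_measure ?inE//; exact: measurableI.
  + move=> x /= nPx; have [ix|] := pselect ([set` i] x); last by right.
    by left; apply: sN => /= h; apply: nPx; exact: h.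
Qed.

Lemma fun_on_eqP i (U V : fun_on i) :
  {ae mu, forall x, [set` i] x -> U x = V x} -> U = V.
Proof.
move/ae_leb_on => h; rewrite -[U]reprK -[V]reprK; apply/eqP.
rewrite eqmodE; apply/asboolP; move: h.
apply: filterS; first exact: (ae_filter_ringOfSetsType (leb_on i)).
by move=> x /= h _.
Qed.

Lemma fun_onE i w : measurable_fun setT w ->
  exists U : fun_on i, {ae mu, forall x, [set` i] x -> U x = w x}.
Proof.
move=> mw.
have mw' : w \in @mfun _ _ (measurableTypeR R) (measurableTypeR R) by exact: mem_set mw.
pose W : {mfun measurableTypeR R >-> measurableTypeR R} :=
  @mfun_Sub _ _ (measurableTypeR R) (measurableTypeR R) w mw'.
exists (\pi_(fun_on i)%qT W); apply/ae_leb_on.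
have /eqP := reprK (\pi_(fun_on i)%qT W).
rewrite eqmodE => /asboolP h; move: h.
by apply: filterS => x /= h; exact: h.
Qed.

Lemma measurable_fun_on i (U : fun_on i) :
  measurable_fun (setT : set R) (U : R -> R).
Proof.
have h : @measurable_fun _ _ (measurableTypeR R) (measurableTypeR R) setT U.
  exact: measurable_funPT.
exact: h.
Qed.

Lemma ge0_integral_leb_on i (f : R -> \bar R) : measurable_fun setT f ->
  (forall x, 0 <= f x)%E ->
  (\int[leb_on i]_x f x = \int[mu]_(x in [set` i]) f x)%E.
Proof.
move=> mf f0; rewrite (@ge0_negligible_integral _ _ _ (leb_on i) setT (~` [set` i]))//.
- rewrite setTD setCK; apply: eq_measure_integral => A mA Ai.
  by rewrite leb_onE setIidl.
- exact: measurableC.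
- by rewrite leb_onE setICl measure0.
Qed.

Lemma Lp_normE i (p : R) (U : fun_on i) : 0 < p ->
  (Lp_norm p U `^ p = \int[mu]_(x in [set` i]) (`|U x| `^ p)%:E)%E.
Proof.
move=> p0; rewrite /Lp_norm poweR_Lnorm ?gt_eqF//.
rewrite -ge0_integral_leb_on.
- by [].
- apply/measurable_EFinP; have h := measurable_norm_powR p (measurable_fun_on U).
  exact: h.
- by move=> x; rewrite lee_fin powR_ge0.
Qed.

Lemma Lp_spaceP i (p : R) (U : fun_on i) : 0 < p ->
  Lp_space i p U <-> (\int[mu]_(x in [set` i]) (`|U x| `^ p)%:E < +oo)%E.
Proof.
move=> p0; rewrite -Lp_normE// /Lp_space/= /finite_norm -/(Lp_norm p U).
split; first exact: poweR_lty.
by apply: lty_poweRy; rewrite gt_eqF.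
Qed.

Lemma exhaustion i : (exists a b : R, a < b /\ i = `]a, b[) \/ i = `]-oo, +oo[ ->
  exists s t : nat -> R, [/\ forall n, s n < t n,
    forall n, `[s n, t n]%classic `<=` [set` i] &
    forall x, [set` i] x -> exists n, s n < x < t n].
Proof.
move=> [[a [b [ab ->]]]|->].
- have ba : 0 < b - a by rewrite subr_gt0.
  exists (fun n => a + (b - a) / n.+3%:R), (fun n => b - (b - a) / n.+3%:R).
  have d n : 0 < (b - a) / n.+3%:R /\ 2 * ((b - a) / n.+3%:R) < b - a.
    rewrite divr_gt0//; split => //; rewrite mulrA ltr_pdivrMr// mulrC ltr_pM2l//.
    by rewrite ltr_nat.
  split.
  + by move=> n; have [] := d n; move: ((b - a) / _) => c; lra.
  + by move=> n; have [] := d n; move: ((b - a) / _) => c ? ?; apply: subset_itvSoo; rewrite bnd_simp; lra.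
  + move=> x /=; rewrite in_itv/= => /andP[ax xb].
    pose e := Num.min (x - a) (b - x).
    have e0 : 0 < e by rewrite lt_min !subr_gt0 ax.
    exists (Num.truncn ((b - a) / e)).
    have h : (b - a) / (Num.truncn ((b - a) / e)).+3%:R < e.
      rewrite ltr_pdivrMr// mulrC -ltr_pdivrMr//.
      by rewrite (lt_trans (truncnS_gt _))// ltr_nat.
    move: h; move: ((b - a) / _.+3%:R) => c h.
    by move: h; rewrite /e lt_min => /andP[]; lra.
- exists (fun n => - n.+1%:R), (fun n => n.+1%:R); split.
  + by move=> n; rewrite gtrN.
  + by move=> n x _; rewrite /= in_itv.
  + by move=> x _; exists (Num.truncn `|x|); rewrite -ltr_norml truncnS_gt.
Qed.

Lemma locally_integrable_itv i f (s t : R) : locally_integrable [set` i] f ->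
  `[s, t]%classic `<=` [set` i] -> measurable_fun setT f ->
  mu.-integrable `[s, t] (EFin \o f).
Proof.
move=> [_ _ lf] sti mf; apply/integrableP; split.
  by apply/measurable_EFinP; exact: measurable_funTS.
by apply: lf => //; exact: segment_compact.
Qed.

(** Weak derivatives are only locally integrable, so the fundamental lemma is applied on a countable
    exhaustion by compact intervals. *)
Lemma weak_deriv_unique s i (al : R) (U V V' : fun_on i) :
  (exists a b : R, a < b /\ i = `]a, b[) \/ i = `]-oo, +oo[ ->
  is_weak_deriv s al U V -> is_weak_deriv s al U V' -> V = V'.
Proof.
move=> /exhaustion[sq [tq [st sti ex]]] [lV hV] [lV' hV'].
have mV := measurable_fun_on V; have mV' := measurable_fun_on V'.
apply: fun_on_eqP.
suff : {ae mu, forall x : R, forall n, sq n < x < tq n -> V x - V' x = 0}.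
  apply: filterS; first exact: (ae_filter_ringOfSetsType mu).
  move=> x h /ex [n /h /eqP]; rewrite subr_eq0 => /eqP; exact.
apply/ae_foralln => n.
have iV := locally_integrable_itv lV (sti n) mV.
have iV' := locally_integrable_itv lV' (sti n) mV'.
apply: (@integral_test_eq0_ae R (fun x => V x - V' x) _ _ (st n)).
  exact: (integrableB _ iV iV').
move=> phi cphi hphi.
have tphi : test_function [set` i] phi by exact: test_functionI hphi (sti n).
have [M _ hM] := test_function_bounded tphi.
have [C C0 hC] := compact_supp_bounded (Cn_continuous (cphi 1)) hM.
have mphi : measurable_fun setT phi.
  exact: continuous_measurable_fun (Cn_continuous (cphi 1)).
have toi (w : R -> R) : \int[mu]_(x in `[sq n, tq n]) (w x * phi x) =
    \int[mu]_(x in [set` i]) (w x * phi x).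
  have sst x : w x * phi x != 0 -> `[sq n, tq n]%classic x.
    by rewrite mulf_eq0 => /norP[_ /hphi]; rewrite /= in_itv.
  rewrite (Rintegral_supp sst) [RHS]Rintegral_supp// => x /sst; exact: sti.
rewrite -(@Rintegral_supp R `[sq n, tq n]); last first.
  by move=> x; rewrite mulf_eq0 => /norP[_ /hphi]; rewrite /= in_itv.
under eq_Rintegral do rewrite mulrBl.
rewrite RintegralB//.
- by rewrite !toi hV// hV'// subrr.
- exact: integrableM_bounded iV (measurable_funTS mphi) hC.
- exact: integrableM_bounded iV' (measurable_funTS mphi) hC.
Qed.

(** [weak_deriv] is a choice made by [xget]; uniqueness identifies it with any explicit weak
    derivative, which is how [W_norm] is evaluated. *)
Lemma weak_derivE s i (al : R) (U V : fun_on i) :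
  (exists a b : R, a < b /\ i = `]a, b[) \/ i = `]-oo, +oo[ ->
  is_weak_deriv s al U V -> weak_deriv s al U = V.
Proof.
move=> hi hV; apply: xget_unique => // V' hV'; exact: weak_deriv_unique hi hV' hV.
Qed.
End FunctionClasses.

(** * Zero extension of classes of functions *)

Section ZeroExtensionClass.
Context {R : realType}.
Local Notation mu := (@lebesgue_measure R).
Local Notation fun_on i := {mfun_ (leb_on i), measurableTypeR R >-> measurableTypeR R}.
Implicit Types (s : side) (f g w phi : R -> R).

Lemma ae_eq_Rintegral (D : set R) f g : measurable D ->
  measurable_fun setT f -> measurable_fun setT g ->
  {ae mu, forall x, D x -> f x = g x} ->
  \int[mu]_(x in D) f x = \int[mu]_(x in D) g x.
Proof.
move=> mD mf mg fg; rewrite /Rintegral; congr fine; apply: ae_eq_integral => //.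
- by apply/measurable_EFinP; exact: measurable_funTS.
- by apply/measurable_EFinP; exact: measurable_funTS.
- move: fg; apply: filterS; first exact: (ae_filter_ringOfSetsType mu).
  by move=> x h Dx; rewrite h.
Qed.

Lemma ae_eq_integral_norm_powR (D : set R) (p : R) f g : measurable D ->
  measurable_fun setT f -> measurable_fun setT g ->
  {ae mu, forall x, D x -> f x = g x} ->
  (\int[mu]_(x in D) (`|f x| `^ p)%:E = \int[mu]_(x in D) (`|g x| `^ p)%:E)%E.
Proof.
move=> mD mf mg fg; apply: ae_eq_integral => //.
- by apply/measurable_EFinP; apply: measurable_funTS; exact: measurable_norm_powR.
- by apply/measurable_EFinP; apply: measurable_funTS; exact: measurable_norm_powR.
- move: fg; apply: filterS; first exact: (ae_filter_ringOfSetsType mu).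
  by move=> x h Dx; rewrite h.
Qed.

Lemma ae_eq_integrable (D : set R) f g : measurable D ->
  measurable_fun setT f -> {ae mu, forall x, D x -> f x = g x} ->
  mu.-integrable D (EFin \o g) -> mu.-integrable D (EFin \o f).
Proof.
move=> mD mf fg /integrableP[mg ig]; apply/integrableP; split.
  by apply/measurable_EFinP; exact: measurable_funTS.
suff -> : (\int[mu]_(x in D) `|(EFin \o f) x| = \int[mu]_(x in D) `|(EFin \o g) x|)%E.
  exact: ig.
apply: ae_eq_integral => //.
- apply: measurableT_comp => //; apply/measurable_EFinP; exact: measurable_funTS.
- exact: measurableT_comp.
- move: fg; apply: filterS; first exact: (ae_filter_ringOfSetsType mu).
  by move=> x h Dx; rewrite /= h.
Qed.

Variables (a b : R).

Definition cutoff f x : R := f x * (a < x < b)%R%:R.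

Lemma measurable_cutoff f : measurable_fun setT f -> measurable_fun setT (cutoff f).
Proof.
move=> mf; apply: measurable_funM => //; apply: measurable_bool_natr.
by apply: measurable_and; exact: measurable_fun_ltr.
Qed.

Lemma cutoff_supp f x : cutoff f x != 0 -> a < x < b.
Proof. by rewrite /cutoff; case: (a < x < b); rewrite // mulr0 eqxx. Qed.

Lemma cutoffE f x : `]a, b[%classic x -> cutoff f x = f x.
Proof. by rewrite /cutoff /= in_itv/= => ->; rewrite mulr1. Qed.

Lemma integral_norm_powR_cutoff (p : R) f : p != 0 ->
  (\int[mu]_x (`|cutoff f x| `^ p)%:E = \int[mu]_(x in `]a, b[) (`|f x| `^ p)%:E)%E.
Proof.
move=> p0; apply: integral_supp => x abx; first by rewrite cutoffE.
suff -> : cutoff f x = 0 by rewrite normr0 powR0.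
by apply: contra_notP abx => /eqP/cutoff_supp; rewrite /= in_itv.
Qed.

Lemma Rintegral_cutoff f g :
  \int[mu]_x (cutoff f x * g x) = \int[mu]_(x in `]a, b[) (f x * g x).
Proof.
rewrite /Rintegral; congr fine; apply: integral_supp => x abx; first by rewrite cutoffE.
suff -> : cutoff f x = 0 by rewrite mul0r.
by apply: contra_notP abx => /eqP/cutoff_supp; rewrite /= in_itv.
Qed.

Variables (al p q : R).
Hypotheses (ab : a < b) (al0 : 0 < al) (al1 : al < 1) (p1 : 1 <= p) (alp : al * p < 1).
Hypotheses (q1 : 1 <= q) (qal : 1 < q * (1 - al)).

Lemma measurable_frac_deriv (D : set R) (l r : itv_bound R) s phi :
  test_function D phi -> D `<=` [set` Interval l r] ->
  measurable_fun setT (frac_deriv (opposite s) (Interval l r) al phi).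
Proof.
move=> tphi Di; have tphi' := test_function_aff s 0 tphi.
have [M _ hM] := test_function_bounded tphi'.
have mD := measurable_rlderiv al1 (test_function_Cn 3 tphi') hM.
have -> : frac_deriv (opposite s) (Interval l r) al phi =
    (fun x => (Gamma (1 - al))^-1 * rlderiv al (phi \o aff 0 s) (affV 0 s x)).
  by apply/funext => x; rewrite -(frac_deriv_aff al1 s 0 _ tphi Di) affKV.
apply: measurable_funM; first exact: measurable_cst.
by apply: (measurableT_comp mD); exact: measurable_aff.
Qed.

Let p0 : 0 < p. Proof. exact: lt_le_trans p1. Qed.

Lemma zero_extension_weak_deriv s (u v : fun_on `]a, b[) (U : fun_on `]-oo, +oo[) :
  Lp_space `]a, b[ q u -> is_weak_deriv s al u v -> Lp_space `]a, b[ p v ->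
  {ae mu, forall x, `]-oo, +oo[%classic x -> U x = cutoff u x} ->
  exists2 V : fun_on `]-oo, +oo[, is_weak_deriv s al U V &
    (Lp_norm p V `^ p <= (1 + schur_const al p)%:E * Lp_norm p v `^ p)%E.
Proof.
move=> uq [_ hv] vp hU.
have mu_ := measurable_fun_on u; have mv := measurable_fun_on v.
have mcu := measurable_cutoff mu_; have mcv := measurable_cutoff mv.
have cuq : (\int[mu]_x (`|cutoff u x| `^ q)%:E < +oo)%E.
  rewrite integral_norm_powR_cutoff; last by rewrite gt_eqF// (lt_le_trans _ q1).
  by apply/Lp_spaceP => //; exact: lt_le_trans q1.
have cvp : (\int[mu]_x (`|cutoff v x| `^ p)%:E < +oo)%E.
  rewrite integral_norm_powR_cutoff; last by rewrite gt_eqF.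
  exact/Lp_spaceP.
have [|w [mw wi wp hw]] := zero_extension al0 al1 p1 alp q1 qal ab mcu mcv
  (@cutoff_supp u) (@cutoff_supp v) cuq cvp (s := s) _.
  by move=> phi tphi; rewrite !Rintegral_cutoff; exact: hv.
have [V hV] := fun_onE `]-oo, +oo[ mw.
have mV := measurable_fun_on V; have mU := measurable_fun_on U.
exists V.
- split.
    apply: open_integrable_locally; first exact: interval_open.
    apply: (ae_eq_integrable _ mV hV) => //.
    by rewrite set_itvE; exact: wi.
  move=> phi tphi.
  have tphi' : test_function setT phi by exact: test_functionS tphi.
  have mphi : measurable_fun setT phi.
    exact: continuous_measurable_fun (Cn_continuous (test_function_Cn 1 tphi)).
  have mfd := measurable_frac_deriv s tphi (@subset_refl _ _).
  transitivity (\int[mu]_x (w x * phi x)).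
    rewrite (@ae_eq_Rintegral _ _ (fun x => w x * phi x)) ?set_itvE//.
    - exact: measurable_funM.
    - exact: measurable_funM.
    - move: hV; apply: filterS; first exact: (ae_filter_ringOfSetsType mu).
      by move=> x h _; rewrite h.
  rewrite hw// -set_itvE; apply: ae_eq_Rintegral => //.
  - exact: measurable_funM.
  - exact: measurable_funM.
  - move: hU; apply: filterS; first exact: (ae_filter_ringOfSetsType mu).
    by move=> x h hx; rewrite h.
- rewrite !Lp_normE// -(integral_norm_powR_cutoff v (lt0r_neq0 p0)).
  rewrite (ae_eq_integral_norm_powR _ _ mV mw hV)//.
  by rewrite set_itvE; exact: wp.
Qed.

(** This places the closed interval, which carries the essential support of the extension, inside
    the larger domain. *)
Lemma closure_itvoo_sub : `[a, b]%classic `<=` closure `]a, b[%classic.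
Proof.
move=> x /=; rewrite in_itv/= => /andP[ax xb] B Bx.
have [xltb|] := ltP x b.
  have Bx' : \forall t \near x^'+, B t by apply: filterS Bx => y By _; exact: By.
  have : \forall t \near x^'+, B t /\ x < t < b.
    near=> t; split; first by near: t; exact: Bx'.
    by apply/andP; split; near: t; [exact: nbhs_right_gt|exact: nbhs_right_lt].
  move=> /filter_ex[t [Bt /andP[xt tb]]]; exists t; split => //.
  by rewrite /= in_itv/= (le_lt_trans ax).
move=> bx; have {bx xb}xb : x = b by apply/eqP; rewrite eq_le xb.
have Bx' : \forall t \near x^'-, B t by apply: filterS Bx => y By _; exact: By.
have : \forall t \near x^'-, B t /\ a < t < x.
  near=> t; split; first by near: t; exact: Bx'.
  apply/andP; split; near: t; [apply: nbhs_left_gt; rewrite xb//|exact: nbhs_left_lt].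
by move=> /filter_ex[t [Bt abt]]; exists t; split => //; rewrite /= in_itv -xb.
Unshelve. all: by end_near. Qed.

Lemma ess_supp_cutoff f g : {ae mu, forall x, g x = cutoff f x} ->
  ess_supp g `<=` `[a, b]%classic.
Proof.
move=> gf x; apply: contra_notP => nab; exists (~` `[a, b]%classic) => //=.
split; first exact/closed_openC/itv_closed.
move: gf; apply: filterS; first exact: (ae_filter_ringOfSetsType mu).
move=> y -> nyab; apply: contra_notP nyab => /eqP/cutoff_supp.
by rewrite /= in_itv/= => /andP[/ltW -> /ltW ->].
Qed.

(** The L^p norm is unchanged by zero extension and the derivative term grows by at most 1 + A. The
    root then gives (1 + A)^(1/p), which is at most 1 + A. *)
Lemma W_norm_zero_extension s (u v : fun_on `]a, b[) (U V : fun_on `]-oo, +oo[) (A : R) :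
  0 <= A -> {ae mu, forall x, `]-oo, +oo[%classic x -> U x = cutoff u x} ->
  is_weak_deriv s al u v -> is_weak_deriv s al U V ->
  (Lp_norm p V `^ p <= (1 + A)%:E * Lp_norm p v `^ p)%E ->
  (W_norm s al p U <= (1 + A)%:E * W_norm s al p u)%E.
Proof.
move=> A0 hU hv hV hle.
have A1 : 1 <= 1 + A by rewrite lerDl.
have pV0 : 0 <= p^-1 by rewrite invr_ge0 ltW.
have eU : (Lp_norm p U `^ p = Lp_norm p u `^ p)%E.
  have mu_ := measurable_fun_on u.
  rewrite (Lp_normE U p0) (Lp_normE u p0) -(integral_norm_powR_cutoff u (lt0r_neq0 p0)).
  rewrite (ae_eq_integral_norm_powR _ _ (measurable_fun_on U) (measurable_cutoff mu_) hU).
    by rewrite set_itvE.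
  exact: measurable_itv.
rewrite /W_norm (weak_derivE _ hv); last by left; exists a, b.
rewrite (weak_derivE _ hV); last by right.
rewrite eU; set X := (Lp_norm p u `^ p)%E; set Y := (Lp_norm p v `^ p)%E in hle *.
have X0 : (0 <= X)%E by exact: poweR_ge0.
have Y0 : (0 <= Y)%E by exact: poweR_ge0.
apply: (@le_trans _ _ (((1 + A)%:E * (X + Y)) `^ p^-1)%E).
  apply: gt0_ler_poweR => //.
  - by rewrite in_itv/= adde_ge0 ?poweR_ge0 ?leey.
  - by rewrite in_itv/= mule_ge0 ?adde_ge0 ?leey// lee_fin (le_trans ler01).
  - rewrite ge0_muleDr//; apply: leeD => //.
    by rewrite lee_pemull// lee_fin.
rewrite poweRM ?adde_ge0 ?lee_fin ?(le_trans ler01)//.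
rewrite lee_wpmul2r ?poweR_ge0// poweR_EFin lee_fin.
by rewrite ler1_powR// invf_le1.
Qed.
End ZeroExtensionClass.

(** * The extension operator *)

Theorem theorem5p5 (R : realType) (al p : R) (Omega' : set R) (s : side)
    (al_gt0 : 0 < al) (al_lt1 : al < 1) (p_ge1 : 1 <= p) (alp_lt1 : al * p < 1)
    (Omega'_open : open Omega') (Omega'_connected : connected Omega')
    (Omega'_bounded : bounded_set Omega') :
  exists2 C : R, 0 < C &
  forall a b mu : R, a < b -> p * (1 - al * p)^-1 < mu ->
    compactly_contained `]a, b[ Omega' ->
  exists2 E : fun_on `]a, b[ -> fun_on `]-oo, +oo[,
    set_fun (W_space s `]a, b[ al p `&` Lp_space `]a, b[ mu)
            (W_space s `]-oo, +oo[ al p) E &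
    forall u : fun_on `]a, b[,
      (W_space s `]a, b[ al p `&` Lp_space `]a, b[ mu) u ->
      [/\ {ae @lebesgue_measure R, forall x : R, `]a, b[%classic x -> E u x = u x},
          compactly_contained (ess_supp (E u)) Omega' &
          (W_norm s al p (E u) <= C%:E * (W_norm s al p u + Lp_norm mu u))%E].
Proof.
have A0 := schur_const_gt0 al_gt0 al_lt1 p_ge1 alp_lt1.
exists (1 + schur_const al p); first by rewrite addr_gt0.
move=> a b q ab hq [_ abO].
have p0 : 0 < p by exact: lt_le_trans p_ge1.
have c0 : 0 < 1 - al * p by rewrite subr_gt0.
have {}hq : p < q * (1 - al * p) by rewrite -ltr_pdivrMr.
have q0 : 0 < q by rewrite -(pmulr_lgt0 _ c0) (lt_trans p0).
have q1 : 1 <= q.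
  apply: (le_trans p_ge1); apply: (le_trans (ltW hq)).
  by rewrite ler_piMr ?(ltW q0)// gerBl mulr_ge0 ?ltW.
(* After multiplication by p: p q (1 - al) exceeds q (1 - al p) by (p - 1) q, which is
   nonnegative. *)
have qal : 1 < q * (1 - al).
  rewrite -(ltr_pM2l p0) mulr1 (lt_le_trans hq)// -subr_ge0.
  rewrite (_ : _ - _ = (p - 1) * q); last by ring.
  by rewrite mulr_ge0 ?subr_ge0// ltW.
have ex (u : fun_on `]a, b[) : exists U : fun_on `]-oo, +oo[,
    {ae @lebesgue_measure R, forall x : R, `]-oo, +oo[%classic x -> U x = cutoff a b u x}.
  exact: fun_onE (measurable_cutoff a b (measurable_fun_on u)).
pose E u := sval (cid (ex u)); have hE u := svalP (cid (ex u)).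
have key (u : fun_on `]a, b[) : (W_space s `]a, b[ al p `&` Lp_space `]a, b[ q) u ->
  exists v, exists V, [/\ is_weak_deriv s al u v, Lp_space `]a, b[ p v,
    is_weak_deriv s al (E u) V &
    (Lp_norm p V `^ p <= (1 + schur_const al p)%:E * Lp_norm p v `^ p)%E].
  move=> [[_ [v hv vp]] uq].
  have [V hV hle] := zero_extension_weak_deriv ab al_gt0 al_lt1 p_ge1 alp_lt1 q1 qal uq hv vp (hE u).
  by exists v, V.
have le_norm u v V : is_weak_deriv s al u v -> is_weak_deriv s al (E u) V ->
    (Lp_norm p V `^ p <= (1 + schur_const al p)%:E * Lp_norm p v `^ p)%E -> _ :=
  fun h1 h2 h3 => W_norm_zero_extension ab p_ge1 (ltW A0) (hE u) h1 h2 h3.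
exists E.
- move=> u hu; have [v [V [hv vp hV hle]]] := key u hu.
  split; last first.
    exists V => //; apply/(Lp_spaceP _ p0); rewrite -Lp_normE//.
    apply: (le_lt_trans hle); rewrite lte_mul_pinfty ?lee_fin ?addr_ge0 ?(ltW A0)//.
    by rewrite Lp_normE//; exact/Lp_spaceP.
  apply/(Lp_spaceP _ p0).
  have mu_ := measurable_fun_on u.
  rewrite (ae_eq_integral_norm_powR _ _ (measurable_fun_on (E u)) (measurable_cutoff a b mu_) (hE u)).
    rewrite set_itvE integral_norm_powR_cutoff ?(lt0r_neq0 p0)//.
    by apply/Lp_spaceP => //; case: hu => -[].
  exact: measurable_itv.
- move=> u hu; have [v [V [hv vp hV hle]]] := key u hu; split.
  + move: (hE u); apply: filterS; first exact: (ae_filter_ringOfSetsType (@lebesgue_measure R)).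
    by move=> x h abx; rewrite h// cutoffE.
  + have hs : ess_supp (E u) `<=` `[a, b]%classic.
      apply: (@ess_supp_cutoff R a b u).
      move: (hE u); apply: filterS; first exact: (ae_filter_ringOfSetsType (@lebesgue_measure R)).
      by move=> x h; apply: h; rewrite set_itvE.
    have cs : closure (ess_supp (E u)) `<=` `[a, b]%classic.
      rewrite [X in _ `<=` X](iffLR (closure_id _) (@itv_closed _ _ _ _)).
      exact: closureS.
    split; last first.
      apply: subset_trans cs _; apply: subset_trans abO.
      exact: closure_itvoo_sub.
    apply: subclosed_compact cs; first exact: closed_closure.
    exact: segment_compact.
  + apply: (le_trans (le_norm u v V hv hV hle)).
    apply: lee_wpmul2l; first by rewrite lee_fin addr_ge0// (ltW A0).
    by rewrite leeDl// Lnorm_ge0.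
Qed.
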